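(* Let $R$ be a commutative ring, let $(\mathcal{G},\mathcal{S})$ satisfy Axioms (i)--(iv) of the context, set $\mathcal{D}:=\mathcal{C}(\mathcal{G},\mathcal{S})$ and $\mathcal{D}_+:=\mathcal{C}(\mathcal{G},\mathcal{S}_+)$, and let $F\in\mathcal{F}_{\mathcal{D},R}$ be a biset functor on $\mathcal{D}$ over $R$. (a) Mapping a group $G\in\mathcal{G}$ to the $R$-module $F_+(G)$ and an element $[U]\in B(G,H)$, where $U$ is a finite $(G,H)$-biset with point stabilizers in $\mathcal{S}_+(G,H)$, to the $R$-linear map $F_+([U])\colon F_+(H)\to F_+(G)$ induced by the functor $\Gamma_F(U)\colon\Gamma_F(H)\to\Gamma_F(G)$ (that is, $[X,s]\mapsto[U\times_H X,U(s)]$) yields a biset functor $F_+\in\mathcal{F}_{\mathcal{D}_+,R}$. (b) The association $F\mapsto F_+$ defines an $R$-linear functor $-_+\colon\mathcal{F}_{\mathcal{D},R}\to\mathcal{F}_{\mathcal{D}_+,R}$ (where a morphism $\varphi\colon F\to F'$ is sent to the morphism whose component at $G$ is $[X,s]\mapsto[X,\varphi(s)]$, $(\varphi(s))(x):=\varphi_{G_x}(s(x))$). (c) For each $G\in\mathcal{G}$ one has an $R$-module isomorphism $$F_+(G)\cong\Bigl(\bigoplus_{H\in\Sigma_{\mathcal{G}}(G)}F(H)\Bigr)_G,$$ where $M:=\bigoplus_{H\in\Sigma_{\mathcal{G}}(G)}F(H)$ is the $RG$-module in which $g\in G$ maps $a\in F(H)$ to ${}^ga\in F({}^gH)$, and $M_G:=M/IM$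 with $I$ the augmentation ideal of $RG$. The isomorphism associates the class of $a\in F(H)$, for $H\in\Sigma_{\mathcal{G}}(G)$, with $[H,a]_G\in F_+(G)$.
   Context: Bisets. For finite groups $G,H$, a $(G,H)$-biset is a finite set $U$ with commuting left $G$-action and right $H$-action; it is viewed as a left $G\times H$-set via $(g,h)u=guh^{-1}$, and $(G\times H)_u$ is the stabilizer of $u\in U$. For $L\le H$, $(G\times L)_u=(G\times H)_u\cap(G\times L)$. $B(G,H)$ is the Grothendieck group of $(G,H)$-bisets with respect to disjoint unions; it is free abelian on the classes $[(G\times H)/D]$, $D$ up to conjugacy. For a $(G,H)$-biset $U$ and an $(H,K)$-biset $V$ (or a left $H$-set $V$), $U\times_H V$ is the set of $H$-orbits $[u,v]$ of $U\times V$ under $h(u,v)=(uh^{-1},hv)$, with the induced $(G,K)$-biset (resp. $G$-set) structure. The biset category $\mathcal{C}$ has the finite groups as objects, $\mathrm{Hom}_{\mathcal{C}}(H,G)=B(G,H)$, composition induced by $U\times_H V$, and identity $[G]$. Subgroups. $\Delta(H)=\{(h,h)\mid h\in H\}$; $p_1(D)$ is the image of $D\le G\times H$ in $G$. For $D\le G\times H$, $E\le H\times K$, $D*E=\{(g,k)\mid\exists h\in H:(g,h)\in D,(h,k)\in E\}$; for $K\le H$, $D*K=\{g\in G\mid \exists k\in K:(g,k)\in D\}$. A subgroup of $G\times H$ contained in $G'\times H'$ ($G'\le G$, $H'\le H$) is also regarded as a subgroup of $G'\times H'$. ${}^gH=gHg^{-1}$. Data. $\mathcal{G}$ is a class of finite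 groups and $\mathcal{S}=(\mathcal{S}(G,H))_{G,H\in\mathcal{G}}$ with $\mathcal{S}(G,H)$ a set of subgroups of $G\times H$. $\Sigma_{\mathcal{G}}(G)$ is the set of subgroups $H\le G$ with $H\in\mathcal{G}$. Axioms: (i) $\Delta(G)\in\mathcal{S}(G,G)$ for all $G\in\mathcal{G}$. (ii) $\mathcal{S}(G,H)$ is closed under $G\times H$-conjugation. (iii) If $D\in\mathcal{S}(G,H)$, $E\in\mathcal{S}(H,K)$ then $D*E\in\mathcal{S}(G,K)$. (iv) For all $D\in\mathcal{S}(G,H)$, $K\in\Sigma_{\mathcal{G}}(H)$ one has $D*K\in\mathcal{G}$ and $D*\Delta(K)=D\cap(G\times K)\in\mathcal{S}(D*K,K)$. $\mathcal{C}(\mathcal{G},\mathcal{S})$ is the subcategory of $\mathcal{C}$ with objects $\mathcal{G}$ and $\mathrm{Hom}(H,G)=\langle[(G\times H)/D]\mid D\in\mathcal{S}(G,H)\rangle_{\mathbb{Z}}$ (defined whenever (i)--(iii) hold). A biset functor on $\mathcal{D}$ over $R$ is an additive functor $\mathcal{D}\to{}_R\mathsf{Mod}$; with natural transformations these form the category $\mathcal{F}_{\mathcal{D},R}$. $\mathcal{S}_+(G,H):=\{D\le G\times H\mid p_1(D)\in\mathcal{G},\ D\in\mathcal{S}(p_1(D),H)\}$; under (i)--(iv) the pair $(\mathcal{G},\mathcal{S}_+)$ again satisfies (i)--(iii). Conjugation. For $H\in\Sigma_{\mathcal{G}}(G)$, $g\in G$, $a\in F(H)$: ${}^ga:=F([({}^gH\times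 H)/\{(ghg^{-1},h)\mid h\in H\}])(a)\in F({}^gH)$ (this morphism lies in $\mathcal{D}$ and ${}^gH\in\mathcal{G}$). The category $\Gamma_F(G)$ ($G\in\mathcal{G}$). For a finite $G$-set $X$ with all stabilizers $G_x\in\mathcal{G}$, a section of $F$ over $X$ is a function $s$ on $X$ with $s(x)\in F(G_x)$ for all $x$; it is $G$-equivariant if $s(gx)={}^gs(x)$ for all $g\in G,x\in X$. Objects of $\Gamma_F(G)$ are pairs $(X,s)$ with $X$ a finite $G$-set all of whose stabilizers lie in $\mathcal{G}$ and $s$ a $G$-equivariant section of $F$ over $X$. A morphism $(X,s)\to(Y,t)$ is a $G$-map $\alpha\colon X\to Y$ with $G_{\alpha(x)}=G_x$ and $t(\alpha(x))=s(x)$ for all $x\in X$. The functor $\Gamma_F(U)$. For a $(G,H)$-biset $U$ with all $(G\times H)_u\in\mathcal{S}_+(G,H)$, the functor $\Gamma_F(U)\colon\Gamma_F(H)\to\Gamma_F(G)$ sends $(X,s)$ to $(U\times_H X,U(s))$, where $$U(s)([u,x]):=F\left(\left[\frac{G_{[u,x]}\times H_x}{(G\times H_x)_u}\right]\right)(s(x)),$$ and sends a morphism $\alpha$ to $U\times_H\alpha$. (One has $G_{[u,x]}=(G\times H)_u*H_x\in\mathcal{G}$ and $(G\times H_x)_u\in\mathcal{S}(G_{[u,x]},H_x)$.) The module $F_+(G)$. $F_+(G)$ is the free abelian group on the isomorphism classes $\{X,s\}$ of objects of $\Gamma_F(G)$, modulo the subgroup generated by all $\{X\sqcup Y,s\sqcup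 t\}-\{X,s\}-\{Y,t\}$ and all $\{X,s+u\}-\{X,s\}-\{X,u\}$ (pointwise sum of two equivariant sections over the same $G$-set). $[X,s]$ is the image of $\{X,s\}$; $R$ acts by $r[X,s]=[X,rs]$. For $H\in\Sigma_{\mathcal{G}}(G)$ and $a\in F(H)$, $[H,a]_G:=[G/H,s_a]$ where $s_a$ is the unique $G$-equivariant section over $G/H$ with value $a$ at the coset $H$. *)

(* Defs.v *)
From HB Require Import structures.
From mathcomp Require Import all_boot all_fingroup all_algebra.
From mathcomp Require Import generic_quotient ring_quotient boolp freeg.
Set Implicit Arguments.
Unset Strict Implicit.
Unset Printing Implicit Defensive.
Import GRing.Theory.
Local Open Scope ring_scope.
Local Open Scope quotient_scope.

Inductive zspan (V : zmodType) (P : V -> Prop) : V -> Prop :=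
| zspan0 : zspan P 0
| zspan_gen v : P v -> zspan P v
| zspanB v w : zspan P v -> zspan P w -> zspan P (v - w).

Section ZQuot.
Variables (V : zmodType) (P : V -> Prop).

Definition zspanb : {pred V} := fun v => `[< zspan P v >].

Lemma zspanb_closed : zmod_closed zspanb.
Proof.
split=> [|v w]; first by apply/asboolP; exact: zspan0.
by move=> /asboolP vP /asboolP wP; apply/asboolP; exact: zspanB.
Qed.

HB.instance Definition _ := GRing.isZmodClosed.Build V zspanb zspanb_closed.

Definition zquot : Type := {ideal_quot zspanb}.
HB.instance Definition _ := GRing.Zmodule.on zquot.

Definition zpi (v : V) : zquot := \pi_({ideal_quot zspanb}) v.
HB.instance Definition _ := GRing.isZmodMorphism.Build V zquot zpi
  (@pi_is_zmod_morphism _ _ _ {ideal_quot zspanb}).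

Lemma zpi_eq (v w : V) : zpi v = zpi w <-> zspan P (v - w).
Proof.
rewrite /zpi; split=> [/eqP|h].
  by rewrite -Quotient.idealrBE => /asboolP.
by apply/eqP; rewrite -Quotient.idealrBE; apply/asboolP.
Qed.

Lemma zpi_surj (x : zquot) : exists v, x = zpi v.
Proof. by exists (repr (x : {ideal_quot zspanb})); rewrite /zpi reprK. Qed.

Section Lift.
Variables (A : zmodType) (f : {additive V -> A}).
Hypothesis fP : forall v, P v -> f v = 0.

Definition zlift (x : zquot) : A := f (repr (x : {ideal_quot zspanb})).

Lemma zspan_ker v : zspan P v -> f v = 0.
Proof.
elim=> [|{}v /fP//|{}v w _ fv0 _ fw0]; first exact: raddf0.
by rewrite raddfB fv0 fw0 subrr.
Qed.

Lemma zliftE v : zlift (zpi v) = f v.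
Proof.
apply/eqP; rewrite -subr_eq0 /zlift -raddfB; apply/eqP/zspan_ker/zpi_eq.
by rewrite /zpi reprK.
Qed.

Lemma zlift_is_additive : zmod_morphism zlift.
Proof.
move=> x y; have [v ->] := zpi_surj x; have [w ->] := zpi_surj y.
by rewrite -raddfB !zliftE raddfB.
Qed.

End Lift.
End ZQuot.

Section Presentation.
Variables (T : Type) (P : {freeg {classic T}} -> Prop).

Definition pres : Type := zquot P.
HB.instance Definition _ := GRing.Zmodule.on pres.

Definition fgen (t : T) : {freeg {classic T}} := [freeg [:: (1, t : {classic T})]].
Definition pgen (t : T) : pres := zpi P (fgen t).

Lemma pres_ind (Q : pres -> Prop) :
  Q 0 -> (forall x y, Q x -> Q y -> Q (x - y)) -> (forall t, Q (pgen t)) ->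
  forall x, Q x.
Proof.
move=> Q0 QB Qt x; have [v ->] := zpi_surj x.
have QN y : Q y -> Q (- y) by move=> Qy; rewrite -[- y]add0r; exact: QB.
have QD y z : Q y -> Q z -> Q (y + z).
  by move=> Qy Qz; rewrite -[z]opprK; apply/QB/QN.
rewrite -(freeg_sumE v) raddf_sum; apply: big_ind => // t _.
move: (coeff _ _) => n.
have -> : [freeg [:: (n, t)]] = fgen t *~ n :> {freeg {classic T}}.
  by rewrite freeg_mulz intz.
rewrite raddfMz -/(pgen t).
have Qn k : Q (pgen t *+ k) by elim: k => [|k IH]; rewrite ?mulr0n // mulrS; exact: QD.
by case: n => k; rewrite ?NegzE ?mulrNz; [exact: Qn|exact/QN/Qn].
Qed.

Section Lift.
Variables (A : zmodType) (f : T -> A).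

Definition flift (v : {freeg {classic T}}) : A :=
  fglift (f : {classic T} -> zmodule A) v.

Lemma flift_is_additive : zmod_morphism flift.
Proof. exact: (lift_is_additive (f : {classic T} -> zmodule A)). Qed.
HB.instance Definition _ :=
  GRing.isZmodMorphism.Build {freeg {classic T}} A flift flift_is_additive.

Lemma flift_gen t : flift (fgen t) = f t.
Proof. by rewrite /flift /fgen liftU scale1r. Qed.

Hypothesis fP : forall v, P v -> flift v = 0.

Definition plift (x : pres) : A := zlift flift x.

Lemma plift_gen t : plift (pgen t) = f t.
Proof. by rewrite /plift (zliftE fP); exact: flift_gen. Qed.

Lemma plift_is_additive : zmod_morphism plift.
Proof. exact: (zlift_is_additive fP). Qed.

End Lift.

Lemma pres_hom_eq (A : zmodType) (f g : pres -> A) :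
  zmod_morphism f -> zmod_morphism g -> (forall t, f (pgen t) = g (pgen t)) ->
  f =1 g.
Proof.
move=> fB gB fg; apply: pres_ind => [|x y fx fy|//]; last by rewrite fB gB fx fy.
by rewrite -(subrr 0) fB gB !subrr.
Qed.

End Presentation.

Local Open Scope group_scope.

(* A finite group is a subgroup of an ambient finGroupType, so that a subgroup
   of a finite group is again a finite group, and a subgroup of G x H contained
   in G' x H' literally is a subgroup of G' x H'. *)
Record fgrp := FGrp { fgT : finGroupType; fgG :> {group fgT} }.
Arguments FGrp {fgT} fgG.

(* Left G-sets. What elements of the ambient type outside G do is irrelevant. *)
Record gset_on (G : fgrp) (X : finType) := GsetOn {
  gact : fgT G -> X -> X;
  gact1 : forall x, gact 1 x = x;
  gactM : {in G &, forall g h x, gact (g * h) x = gact g (gact h x)} }.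
Record gset (G : fgrp) := Gset { gs_car :> finType; gs_str :> gset_on G gs_car }.
Arguments Gset {G gs_car} gs_str.

Record biset_on (G H : fgrp) (U : finType) := BisetOn {
  lact : fgT G -> U -> U;
  ract : U -> fgT H -> U;
  lact1 : forall u, lact 1 u = u;
  lactM : {in G &, forall g g' u, lact (g * g') u = lact g (lact g' u)};
  ract1 : forall u, ract u 1 = u;
  ractM : {in H &, forall h h' u, ract u (h * h') = ract (ract u h) h'};
  lractA : {in G & H, forall g h u, lact g (ract u h) = ract (lact g u) h} }.
Record biset (G H : fgrp) :=
  Biset { bs_car :> finType; bs_str :> biset_on G H bs_car }.
Arguments Biset {G H bs_car} bs_str.

Section Stabilizers.
Variables (G H : fgrp).

Definition gstab_set X (A : gset_on G X) (x : X) : {set fgT G} :=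
  [set g in G | gact A g x == x].

Lemma gstab_group_set X (A : gset_on G X) x : group_set (gstab_set A x).
Proof.
apply/group_setP; split=> [|g h]; first by rewrite inE group1 gact1 eqxx.
rewrite !inE => /andP[gG /eqP gx] /andP[hG /eqP hx].
by rewrite groupM // gactM // hx gx eqxx.
Qed.

Definition gstab X (A : gset_on G X) x : {group fgT G} :=
  Group (gstab_group_set A x).

(* The stabilizer for the left G x H-action (g, h) u = g u h^-1. *)
Definition bstab_set U (A : biset_on G H U) (u : U) : {set fgT G * fgT H} :=
  [set p in setX G H | lact A p.1 (ract A u p.2^-1) == u].

Lemma bstab_group_set U (A : biset_on G H U) u : group_set (bstab_set A u).
Proof.
apply/group_setP; split=> [|[g h] [g' h']].
  by rewrite !inE !group1 /= invg1 ract1 lact1 eqxx.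
rewrite !inE /= => /andP[/andP[gG hH] /eqP gu] /andP[/andP[g'G h'H] /eqP g'u].
rewrite !groupM //= invMg ractM ?groupV // lactM // lractA ?groupV //.
by rewrite g'u gu eqxx.
Qed.

Definition bstab U (A : biset_on G H U) u : {group fgT G * fgT H} :=
  Group (bstab_group_set A u).
End Stabilizers.

Section Subgroups.
Variables (gT hT kT : finGroupType).

Definition proj1_set (D : {set gT * hT}) : {set gT} :=
  [set p.1 | p in D].

Lemma proj1_group_set (D : {group gT * hT}) : group_set (proj1_set D).
Proof.
apply/group_setP; split=> [|_ _ /imsetP[p pD ->] /imsetP[q qD ->]].
  by apply/imsetP; exists 1.
by apply/imsetP; exists (p * q); rewrite ?groupM.
Qed.
Canonical proj1_group D := Group (proj1_group_set D).

Definition starg_set (D : {set gT * hT}) (K : {set hT}) :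
    {set gT} :=
  [set g | [exists k in K, (g, k) \in D]].

Lemma starg_group_set (D : {group gT * hT}) (K : {group hT}) :
  group_set (starg_set D K).
Proof.
apply/group_setP; split=> [|g g'].
  by rewrite inE; apply/exists_inP; exists 1; rewrite ?group1 //; exact: group1.
rewrite !inE => /exists_inP[k kK gk] /exists_inP[k' k'K gk'].
apply/exists_inP; exists (k * k'); first by rewrite groupM.
exact: (groupM gk gk').
Qed.
Canonical starg_group D K := Group (starg_group_set D K).

Definition star_set (D : {set gT * hT}) (E : {set hT * kT}) : {set gT * kT} :=
  [set p | [exists h, ((p.1, h) \in D) && ((h, p.2) \in E)]].

Lemma star_group_set (D : {group gT * hT}) (E : {group hT * kT}) :
  group_set (star_set D E).
Proof.
apply/group_setP; split=> [|[g k] [g' k']].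
  by rewrite inE; apply/existsP; exists 1; rewrite !(group1 D, group1 E).
rewrite !inE /= => /existsP[h /andP[gh hk]] /existsP[h' /andP[gh' hk']].
by apply/existsP; exists (h * h'); rewrite (groupM gh gh') (groupM hk hk').
Qed.
Canonical star_group D E := Group (star_group_set D E).

Definition diag_set (G : {set gT}) : {set gT * gT} :=
  [set (g, g) | g in G].

Lemma diag_group_set (G : {group gT}) : group_set (diag_set G).
Proof.
apply/group_setP; split=> [|_ _ /imsetP[g gG ->] /imsetP[h hG ->]].
  by apply/imsetP; exists 1.
by apply/imsetP; exists (g * h); rewrite ?groupM.
Qed.
Canonical diag_group G := Group (diag_group_set G).

End Subgroups.

Lemma star_diag (gT hT : finGroupType) (G : {group gT}) (H : {group hT})
    (D : {group gT * hT}) (K : {group hT}) :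
  D \subset setX G H -> star_set D (diag_set K) = D :&: setX G K.
Proof.
move=> /subsetP DGH; apply/setP => -[g k]; rewrite !inE /=.
apply/existsP/andP => [[h /andP[gh /imsetP[h' h'K [eh ek]]]]|[gk /andP[gG kK]]].
  move: gh; rewrite eh ek h'K => gh.
  by move: (gh) => /DGH; rewrite gh !inE /= => /andP[-> _].
by exists k; rewrite gk; apply/imsetP; exists k.
Qed.

Section OrbitSpace.
(* The set of orbits of U x V under h (u, v) = (u h^-1, h v); tcl is the class
   map, and trep picks representatives. *)
Variables (hT : finGroupType) (H : {group hT}) (U V : finType).
Variables (r : U -> hT -> U) (l : hT -> V -> V).

Definition torb (p : U * V) : {set U * V} :=
  [set (r p.1 h^-1, l h p.2) | h in H].

Definition tens : Type := {O : {set U * V} | [exists p, O == torb p]}.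
HB.instance Definition _ := Finite.on tens.

Lemma torb_tens p : [exists q, torb p == torb q].
Proof. by apply/existsP; exists p. Qed.

Definition tcl (p : U * V) : tens := exist _ (torb p) (torb_tens p).

Lemma tcl_surj (O : tens) : exists p, tcl p == O.
Proof. by case: O => O OP; have /existsP[p /eqP e] := OP; exists p; apply/eqP/val_inj. Qed.

Definition trep (O : tens) : U * V := xchoose (tcl_surj O).

Lemma trepK O : tcl (trep O) = O.
Proof. by apply/eqP; exact: (xchooseP (tcl_surj O)). Qed.

Hypotheses (r1 : forall u, r u 1 = u) (l1 : forall v, l 1 v = v).
Hypothesis rM : {in H &, forall h h' u, r u (h * h') = r (r u h) h'}.
Hypothesis lM : {in H &, forall h h' v, l (h * h') v = l h (l h' v)}.

Lemma tclP p q :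
  tcl p = tcl q <-> exists2 h, h \in H & q = (r p.1 h^-1, l h p.2).
Proof.
split=> [/(congr1 val) /= e|[h hH ->]].
  have : q \in torb q by apply/imsetP; exists 1; rewrite // invg1 r1 l1 -surjective_pairing.
  by rewrite -e => /imsetP[h hH ->]; exists h.
apply/val_inj/setP => s /=; apply/imsetP/imsetP => -[k kH ->] /=.
  exists (k * h^-1); rewrite ?groupM ?groupV //.
  by rewrite -rM ?groupV ?groupM ?groupV // -lM ?groupM ?groupV // invMg invgK mulKg mulgKV.
exists (k * h); rewrite ?groupM //.
by rewrite -rM ?groupV // -lM // invMg.
Qed.

Definition tlift (T : Type) (f : U * V -> T) (O : tens) : T := f (trep O).

Lemma tliftE (T : Type) (f : U * V -> T) p :
    (forall h, h \in H -> f (r p.1 h^-1, l h p.2) = f p) ->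
  tlift f (tcl p) = f p.
Proof.
move=> fP; have /tclP[h hH] : tcl p = tcl (trep (tcl p)) by rewrite trepK.
by rewrite /tlift => ->; exact: fP.
Qed.

End OrbitSpace.

Arguments trepK {hT H U V r l} O.

Section Tensor.
Variables (G H K : fgrp).

Section GSetTensor.
Variables (U X : finType) (A : biset_on G H U) (B : gset_on H X).

Notation T := (tens H (ract A) (gact B)).
Notation cl := (tcl H (ract A) (gact B)).

Definition tg_act g : T -> T := tlift (fun p => cl (lact A g p.1, p.2)).

Lemma gcl_eq (p q : U * X) :
  cl p = cl q <-> exists2 h, h \in H & q = (ract A p.1 h^-1, gact B h p.2).
Proof. by apply: tclP; [exact: ract1|exact: gact1|exact: ractM|exact: gactM]. Qed.

Lemma tg_actE g p : g \in G -> tg_act g (cl p) = cl (lact A g p.1, p.2).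
Proof.
move=> gG; apply: tliftE; [exact: ract1|exact: gact1|exact: ractM|exact: gactM|].
move=> h hH /=; apply/esym/gcl_eq; exists h => //=; congr pair.
by rewrite lractA ?groupV.
Qed.

Lemma tg_act1 O : tg_act 1 O = O.
Proof. by rewrite -[O]trepK tg_actE ?group1 // lact1 -surjective_pairing. Qed.

Lemma tg_actM : {in G &, forall g h O, tg_act (g * h) O = tg_act g (tg_act h O)}.
Proof. by move=> g h gG hG O; rewrite -[O]trepK !tg_actE ?groupM //= lactM. Qed.

Definition tens_gset_on : gset_on G T := GsetOn tg_act1 tg_actM.
End GSetTensor.

Section BisetTensor.
Variables (U V : finType) (A : biset_on G H U) (B : biset_on H K V).

Notation T := (tens H (ract A) (lact B)).
Notation cl := (tcl H (ract A) (lact B)).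

Definition tb_lact g : T -> T := tlift (fun p => cl (lact A g p.1, p.2)).
Definition tb_ract (O : T) k : T := tlift (fun p => cl (p.1, ract B p.2 k)) O.

Lemma bcl_eq (p q : U * V) :
  cl p = cl q <-> exists2 h, h \in H & q = (ract A p.1 h^-1, lact B h p.2).
Proof. by apply: tclP; [exact: ract1|exact: lact1|exact: ractM|exact: lactM]. Qed.

Lemma btliftE (T' : Type) (f : U * V -> T') p :
    (forall h, h \in H -> f (ract A p.1 h^-1, lact B h p.2) = f p) ->
  tlift f (cl p) = f p.
Proof. by apply: tliftE; [exact: ract1|exact: lact1|exact: ractM|exact: lactM]. Qed.

Lemma tb_lactE g p : g \in G -> tb_lact g (cl p) = cl (lact A g p.1, p.2).
Proof.
move=> gG; apply: btliftE => h hH /=; apply/esym/bcl_eq; exists h => //=.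
by rewrite lractA ?groupV.
Qed.

Lemma tb_ractE k p : k \in K -> tb_ract (cl p) k = cl (p.1, ract B p.2 k).
Proof.
move=> kK; apply: btliftE => h hH /=; apply/esym/bcl_eq; exists h => //=.
by rewrite lractA.
Qed.

Lemma tb_lact1 O : tb_lact 1 O = O.
Proof. by rewrite -[O]trepK tb_lactE ?group1 // lact1 -surjective_pairing. Qed.

Lemma tb_lactM :
  {in G &, forall g h O, tb_lact (g * h) O = tb_lact g (tb_lact h O)}.
Proof. by move=> g h gG hG O; rewrite -[O]trepK !tb_lactE ?groupM //= lactM. Qed.

Lemma tb_ract1 O : tb_ract O 1 = O.
Proof. by rewrite -[O]trepK tb_ractE ?group1 // ract1 -surjective_pairing. Qed.

Lemma tb_ractM :
  {in K &, forall h k O, tb_ract O (h * k) = tb_ract (tb_ract O h) k}.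
Proof. by move=> h k hK kK O; rewrite -[O]trepK !tb_ractE ?groupM //= ractM. Qed.

Lemma tb_lractA :
  {in G & K, forall g k O, tb_lact g (tb_ract O k) = tb_ract (tb_lact g O) k}.
Proof. by move=> g k gG kK O; rewrite -[O]trepK !(tb_ractE, tb_lactE). Qed.

Definition tens_biset_on : biset_on G K T :=
  BisetOn tb_lact1 tb_lactM tb_ract1 tb_ractM tb_lractA.
End BisetTensor.

End Tensor.

Definition tens_gset G H (U : biset G H) (X : gset H) : gset G :=
  Gset (tens_gset_on U X).
Definition tens_biset G H K (U : biset G H) (V : biset H K) : biset G K :=
  Biset (tens_biset_on U V).

Section BisetConstructions.
Variables (G H : fgrp).

Definition biset_hom (U V : finType) (A : biset_on G H U) (B : biset_on G H V)
    (f : U -> V) : Prop :=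
  {in G, forall g u, f (lact A g u) = lact B g (f u)} /\
  {in H, forall h u, f (ract A u h) = ract B (f u) h}.

Definition biset_iso (A B : biset G H) : Prop :=
  exists f : A -> B, bijective f /\ biset_hom A B f.

Section Transport.
Variables (U V : finType) (A : biset_on G H U) (e : U -> V) (e' : V -> U).
Hypotheses (eK : cancel e e') (eK' : cancel e' e).

Definition tr_lact g v := e (lact A g (e' v)).
Definition tr_ract v h := e (ract A (e' v) h).

Lemma tr_lact1 v : tr_lact 1 v = v.
Proof. by rewrite /tr_lact lact1 eK'. Qed.
Lemma tr_lactM : {in G &, forall g h v, tr_lact (g * h) v = tr_lact g (tr_lact h v)}.
Proof. by move=> g h gG hG v; rewrite /tr_lact lactM // eK. Qed.
Lemma tr_ract1 v : tr_ract v 1 = v.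
Proof. by rewrite /tr_ract ract1 eK'. Qed.
Lemma tr_ractM : {in H &, forall g h v, tr_ract v (g * h) = tr_ract (tr_ract v g) h}.
Proof. by move=> g h gG hG v; rewrite /tr_ract ractM // eK. Qed.
Lemma tr_lractA :
  {in G & H, forall g h v, tr_lact g (tr_ract v h) = tr_ract (tr_lact g v) h}.
Proof. by move=> g h gG hG v; rewrite /tr_ract /tr_lact !eK lractA. Qed.

Definition tr_biset_on : biset_on G H V :=
  BisetOn tr_lact1 tr_lactM tr_ract1 tr_ractM tr_lractA.
End Transport.

Section Sum.
Variables (U V : finType) (A : biset_on G H U) (B : biset_on G H V).

Definition sum_lact g (x : U + V) : U + V :=
  match x with inl u => inl (lact A g u) | inr v => inr (lact B g v) end.
Definition sum_ract (x : U + V) h : U + V :=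
  match x with inl u => inl (ract A u h) | inr v => inr (ract B v h) end.

Lemma sum_lact1 x : sum_lact 1 x = x.
Proof. by case: x => u /=; rewrite lact1. Qed.
Lemma sum_lactM : {in G &, forall g h x, sum_lact (g * h) x = sum_lact g (sum_lact h x)}.
Proof. by move=> g h gG hG [] u /=; rewrite lactM. Qed.
Lemma sum_ract1 x : sum_ract x 1 = x.
Proof. by case: x => u /=; rewrite ract1. Qed.
Lemma sum_ractM : {in H &, forall g h x, sum_ract x (g * h) = sum_ract (sum_ract x g) h}.
Proof. by move=> g h gG hG [] u /=; rewrite ractM. Qed.
Lemma sum_lractA :
  {in G & H, forall g h x, sum_lact g (sum_ract x h) = sum_ract (sum_lact g x) h}.
Proof. by move=> g h gG hG [] u /=; rewrite lractA. Qed.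

Definition sum_biset_on : biset_on G H (U + V)%type :=
  BisetOn sum_lact1 sum_lactM sum_ract1 sum_ractM sum_lractA.
End Sum.

Definition sum_biset (A B : biset G H) : biset G H := Biset (sum_biset_on A B).

(* The transitive biset (G x H) / D, with (g, h) C = g C h^-1. *)
Section Transitive.
Variable D : {set fgT G * fgT H}.

Definition tcoset : Type := {C | C \in lcosets D (setX G H)}.
HB.instance Definition _ := Finite.on tcoset.

Definition tc_act (p : fgT G * fgT H) (C : tcoset) : tcoset :=
  insubd C (p *: val C).

Lemma tc_act_val p C : p \in setX G H -> val (tc_act p C) = p *: val C.
Proof.
move=> pGH; rewrite insubdK //; case: C => C /=.
by move=> /lcosetsP[q qGH ->]; apply/lcosetsP; exists (p * q); rewrite ?groupM ?lcosetM.
Qed.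

Lemma tc_act1 C : tc_act 1 C = C.
Proof. by apply/val_inj; rewrite tc_act_val ?lcoset1. Qed.

Lemma tc_actM : {in setX G H &, forall p q C, tc_act (p * q) C = tc_act p (tc_act q C)}.
Proof. by move=> p q pP qP C; apply/val_inj; rewrite !tc_act_val ?groupM ?lcosetM. Qed.

Definition tc_lact g C := tc_act (g, 1) C.
Definition tc_ract C h := tc_act (1, h^-1) C.

Lemma tc_lact1 C : tc_lact 1 C = C. Proof. exact: tc_act1. Qed.
Lemma tc_lactM : {in G &, forall g h C, tc_lact (g * h) C = tc_lact g (tc_lact h C)}.
Proof.
move=> g h gG hG C; rewrite /tc_lact -tc_actM ?inE ?gG ?hG ?group1 //.
by congr tc_act; congr pair; rewrite mulg1.
Qed.
Lemma tc_ract1 C : tc_ract C 1 = C. Proof. by rewrite /tc_ract invg1; exact: tc_act1. Qed.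
Lemma tc_ractM : {in H &, forall g h C, tc_ract C (g * h) = tc_ract (tc_ract C g) h}.
Proof.
move=> g h gH hH C; rewrite /tc_ract -tc_actM ?inE ?groupV ?gH ?hH ?group1 //.
by congr tc_act; congr pair; rewrite ?mulg1 ?invMg.
Qed.
Lemma tc_lractA :
  {in G & H, forall g h C, tc_lact g (tc_ract C h) = tc_ract (tc_lact g C) h}.
Proof.
move=> g h gG hH C; rewrite /tc_lact /tc_ract -!tc_actM ?inE ?groupV ?gG ?hH ?group1 //.
by congr tc_act; congr pair; rewrite ?mulg1 ?mul1g.
Qed.

Definition trans_biset : biset G H :=
  Biset (BisetOn tc_lact1 tc_lactM tc_ract1 tc_ractM tc_lractA).
End Transitive.

End BisetConstructions.

Section RegularBiset.
Variable G : fgrp.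

Definition reg_lact (g : fgT G) (x : [subg G]) : [subg G] := subg G (g * sgval x).
Definition reg_ract (x : [subg G]) (g : fgT G) : [subg G] := subg G (sgval x * g).

Lemma reg_lact1 x : reg_lact 1 x = x.
Proof. by rewrite /reg_lact mul1g sgvalK. Qed.
Lemma reg_lactM : {in G &, forall g h x, reg_lact (g * h) x = reg_lact g (reg_lact h x)}.
Proof. by move=> g h gG hG x; rewrite /reg_lact subgK ?groupM ?subgP ?mulgA. Qed.
Lemma reg_ract1 x : reg_ract x 1 = x.
Proof. by rewrite /reg_ract mulg1 sgvalK. Qed.
Lemma reg_ractM : {in G &, forall g h x, reg_ract x (g * h) = reg_ract (reg_ract x g) h}.
Proof. by move=> g h gG hG x; rewrite /reg_ract subgK ?groupM ?subgP ?mulgA. Qed.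
Lemma reg_lractA :
  {in G & G, forall g h x, reg_lact g (reg_ract x h) = reg_ract (reg_lact g x) h}.
Proof.
by move=> g h gG hG x; rewrite /reg_ract /reg_lact !subgK ?groupM ?subgP ?mulgA.
Qed.

Definition reg_biset : biset G G :=
  Biset (BisetOn reg_lact1 reg_lactM reg_ract1 reg_ractM reg_lractA).
End RegularBiset.

Section BisetIso.
Variables (G H K : fgrp).

Lemma biset_iso_refl (A : biset G H) : biset_iso A A.
Proof. by exists id; split=> //; exists id. Qed.

Lemma biset_iso_sym (A B : biset G H) : biset_iso A B -> biset_iso B A.
Proof.
case=> f [[f' fK f'K] [fl fr]]; exists f'; split; first by exists f.
by split=> [g gG u|h hH u]; apply: (can_inj fK); rewrite ?fl ?fr // !f'K.
Qed.

Lemma biset_iso_trans (A B C : biset G H) :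
  biset_iso A B -> biset_iso B C -> biset_iso A C.
Proof.
case=> f [fbij [fl fr]] [f' [f'bij [f'l f'r]]]; exists (f' \o f).
split; first exact: bij_comp.
by split=> [g gG u|h hH u] /=; rewrite ?fl ?fr ?f'l ?f'r.
Qed.

Lemma tr_biset_iso (A : biset G H) (V : finType) (e : A -> V) (e' : V -> A)
    (eK : cancel e e') (eK' : cancel e' e) :
  biset_iso (Biset (tr_biset_on A eK eK')) A.
Proof.
exists e'; split; first by exists e.
by split=> [g gG v|h hH v] /=; rewrite /tr_lact /tr_ract eK.
Qed.

Lemma sum_biset_iso (A A' B B' : biset G H) :
  biset_iso A A' -> biset_iso B B' -> biset_iso (sum_biset A B) (sum_biset A' B').
Proof.
case=> f [[f' fK f'K] [fl fr]] [g [[g' gK g'K] [gl gr]]].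
exists (fun x : (A + B)%type => match x with inl u => inl (f u) | inr v => inr (g v) end).
split.
  exists (fun x : (A' + B')%type => match x with inl u => inl (f' u) | inr v => inr (g' v) end).
    by case=> x; rewrite ?fK ?gK.
  by case=> x; rewrite ?f'K ?g'K.
by split=> [k kG|k kH] [] x /=; rewrite ?fl ?fr ?gl ?gr.
Qed.

Section TensIso.
Variables (A A' : biset G H) (B B' : biset H K).

Notation cl A B := (tcl H (ract (bs_str A)) (lact (bs_str B))).

Lemma tens_map (f : A -> A') (g : B -> B') :
    {in H, forall h u, f (ract A u h) = ract A' (f u) h} ->
    {in H, forall h v, g (lact B h v) = lact B' h (g v)} ->
  forall p, tlift (fun p => cl A' B' (f p.1, g p.2)) (cl A B p) = cl A' B' (f p.1, g p.2).
Proof.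
move=> fr gl p; apply: btliftE => h hH; apply/esym/bcl_eq; exists h => //=.
by rewrite fr ?gl ?groupV.
Qed.

Lemma tens_biset_iso :
  biset_iso A A' -> biset_iso B B' -> biset_iso (tens_biset A B) (tens_biset A' B').
Proof.
move=> iA iB; have [f' _] := biset_iso_sym iA.
case: iA => f [[{}f' fK f'K] [fl fr]]; case: iB => g [[g' gK g'K] [gl gr]].
have fr' : {in H, forall h u, f' (ract A' u h) = ract A (f' u) h}.
  by move=> h hH u; apply: (can_inj fK); rewrite fr // !f'K.
have gl' : {in H, forall h v, g' (lact B' h v) = lact B h (g' v)}.
  by move=> h hH u; apply: (can_inj gK); rewrite gl // !g'K.
have E := tens_map fr gl.
have E' : forall p, tlift (fun p => cl A B (f' p.1, g' p.2)) (cl A' B' p) =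
                    cl A B (f' p.1, g' p.2).
  move=> p; apply: btliftE => h hH; apply/esym/bcl_eq; exists h => //=.
  by rewrite fr' ?gl' ?groupV.
exists (tlift (fun p => cl A' B' (f p.1, g p.2))); split.
  exists (tlift (fun p => cl A B (f' p.1, g' p.2))) => O; rewrite -[O]trepK.
    by rewrite E E' /= fK gK -surjective_pairing.
  by rewrite E' E /= f'K g'K -surjective_pairing.
split=> [k kG O|k kK O]; rewrite -[O]trepK /= E.
  by rewrite (tb_lactE _ _ _ kG) E (tb_lactE _ _ _ kG) /= fl.
by rewrite (tb_ractE _ _ _ kK) E (tb_ractE _ _ _ kK) /= gr.
Qed.
End TensIso.

Lemma tens_sum_left (A A' : biset G H) (B : biset H K) :
  biset_iso (tens_biset (sum_biset A A') B) (sum_biset (tens_biset A B) (tens_biset A' B)).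
Proof.
pose AA := sum_biset A A'.
pose c := tcl H (ract AA) (lact B); pose c1 := tcl H (ract A) (lact B).
pose c2 := tcl H (ract A') (lact B).
pose F (p : AA * B) : sum_biset (tens_biset A B) (tens_biset A' B) :=
  match p.1 with inl u => inl (c1 (u, p.2)) | inr u => inr (c2 (u, p.2)) end.
pose F1 (p : A * B) := c ((inl p.1 : AA), p.2).
pose F2 (p : A' * B) := c ((inr p.1 : AA), p.2).
have FE p : tlift F (c p) = F p.
  apply: btliftE => h hH; case: p => [[u|u] v]; rewrite /F /=; congr (_ _).
    by apply/esym/bcl_eq; exists h.
  by apply/esym/bcl_eq; exists h.
have F1E p : tlift F1 (c1 p) = F1 p.
  by apply: btliftE => h hH; apply/esym/bcl_eq; exists h.
have F2E p : tlift F2 (c2 p) = F2 p.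
  by apply: btliftE => h hH; apply/esym/bcl_eq; exists h.
exists (tlift F); split.
  exists (fun O : (tens_biset A B + tens_biset A' B)%type =>
    match O with inl o => tlift F1 o | inr o => tlift F2 o end).
    by move=> O; rewrite -[O]trepK FE; case: (trep O) => [[u|u] v]; rewrite /F /= ?F1E ?F2E.
  by case=> O; rewrite -[O]trepK ?F1E ?F2E FE /F /= -surjective_pairing.
split=> [k kG O|k kK O]; rewrite -[O]trepK /= ?(tb_lactE, tb_ractE) // !FE.
  by case: (trep O) => [[u|u] v]; rewrite /F /= tb_lactE.
by case: (trep O) => [[u|u] v]; rewrite /F /= tb_ractE.
Qed.

Lemma tens_sum_right (A : biset G H) (B B' : biset H K) :
  biset_iso (tens_biset A (sum_biset B B')) (sum_biset (tens_biset A B) (tens_biset A B')).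
Proof.
pose BB := sum_biset B B'.
pose c := tcl H (ract A) (lact BB); pose c1 := tcl H (ract A) (lact B).
pose c2 := tcl H (ract A) (lact B').
pose F (p : A * BB) : sum_biset (tens_biset A B) (tens_biset A B') :=
  match p.2 with inl v => inl (c1 (p.1, v)) | inr v => inr (c2 (p.1, v)) end.
pose F1 (p : A * B) := c (p.1, (inl p.2 : BB)).
pose F2 (p : A * B') := c (p.1, (inr p.2 : BB)).
have FE p : tlift F (c p) = F p.
  apply: btliftE => h hH; case: p => [u [v|v]]; rewrite /F /=; congr (_ _).
    by apply/esym/bcl_eq; exists h.
  by apply/esym/bcl_eq; exists h.
have F1E p : tlift F1 (c1 p) = F1 p.
  by apply: btliftE => h hH; apply/esym/bcl_eq; exists h.
have F2E p : tlift F2 (c2 p) = F2 p.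
  by apply: btliftE => h hH; apply/esym/bcl_eq; exists h.
exists (tlift F); split.
  exists (fun O : (tens_biset A B + tens_biset A B')%type =>
    match O with inl o => tlift F1 o | inr o => tlift F2 o end).
    by move=> O; rewrite -[O]trepK FE; case: (trep O) => [u [v|v]]; rewrite /F /= ?F1E ?F2E.
  by case=> O; rewrite -[O]trepK ?F1E ?F2E FE /F /= -surjective_pairing.
split=> [k kG O|k kK O]; rewrite -[O]trepK /= ?(tb_lactE, tb_ractE) // !FE.
  by case: (trep O) => [u [v|v]]; rewrite /F /= tb_lactE.
by case: (trep O) => [u [v|v]]; rewrite /F /= tb_ractE.
Qed.

End BisetIso.

Local Open Scope ring_scope.

Section BurnsideGroup.
Variables (G H : fgrp).

(* Every biset is isomorphic to one carried by some 'I_n, so these suffice to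
   generate B(G, H); B(G, H) itself has relations for arbitrary bisets. *)
Definition bgen := {n : nat & biset_on G H 'I_n}.
Definition big_biset (t : bgen) : biset G H := Biset (projT2 t).
Definition small_biset (A : biset G H) : bgen :=
  existT _ #|A| (tr_biset_on A (@enum_rankK A) (@enum_valK A)).

Inductive brel : {freeg {classic bgen}} -> Prop :=
| brel_iso t t' : biset_iso (big_biset t) (big_biset t') ->
    brel (fgen t - fgen t')
| brel_sum A B :
    brel (fgen (small_biset (sum_biset A B)) -
          fgen (small_biset A) - fgen (small_biset B)).

Definition bgroup : Type := pres brel.
HB.instance Definition _ := GRing.Zmodule.on bgroup.

Definition bcls (A : biset G H) : bgroup := pgen brel (small_biset A).

Lemma big_small_biset A : biset_iso (big_biset (small_biset A)) A.
Proof. exact: tr_biset_iso. Qed.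

Lemma pgen_bcls t : pgen brel t = bcls (big_biset t).
Proof.
apply/zpi_eq/zspan_gen/brel_iso/biset_iso_sym; exact: big_small_biset.
Qed.

Lemma bcls_iso A B : biset_iso A B -> bcls A = bcls B.
Proof.
move=> AB; apply/zpi_eq/zspan_gen/brel_iso.
apply: biset_iso_trans (big_small_biset A) _.
exact: biset_iso_trans AB (biset_iso_sym (big_small_biset B)).
Qed.

Lemma bcls_sum A B : bcls (sum_biset A B) = bcls A + bcls B.
Proof.
apply/eqP; rewrite -subr_eq0 opprD addrA /bcls /pgen -!raddfB -(raddf0 (zpi _)).
by apply/eqP/zpi_eq; rewrite subr0; apply/zspan_gen/brel_sum.
Qed.

Lemma brel_compat (V : zmodType) (f : biset G H -> V) :
    (forall A B, biset_iso A B -> f A = f B) ->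
    (forall A B, f (sum_biset A B) = f A + f B) ->
  forall v, brel v -> flift (f \o big_biset) v = 0.
Proof.
move=> fI fS v; case=> [t t' tt'|A B].
  by rewrite raddfB /= !flift_gen /= (fI _ _ tt') subrr.
rewrite !raddfB /= !flift_gen /= !(fI _ _ (big_small_biset _)) fS.
by rewrite addrAC addrK subrr.
Qed.
End BurnsideGroup.

Section Composition.
Variables (G H K : fgrp).

Lemma bcomp_compat_r (A : biset G H) v : brel v ->
  flift ((fun B : biset H K => bcls (tens_biset A B)) \o @big_biset H K) v = 0.
Proof.
apply: brel_compat => B B' => [BB'|].
  by apply/bcls_iso/tens_biset_iso => //; exact: biset_iso_refl.
by rewrite -bcls_sum; apply/bcls_iso/tens_sum_right.
Qed.

Definition bcompr (A : biset G H) : bgroup H K -> bgroup G K :=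
  plift (fun t : bgen H K => bcls (tens_biset A (big_biset t))).

Lemma bcomprB A : zmod_morphism (bcompr A).
Proof. exact/plift_is_additive/bcomp_compat_r. Qed.

Lemma bcompr_gen A t : bcompr A (pgen _ t) = bcls (tens_biset A (big_biset t)).
Proof. exact/plift_gen/bcomp_compat_r. Qed.

Lemma bcomp_compat_l (y : bgroup H K) v : brel v ->
  flift ((fun A : biset G H => bcompr A y) \o @big_biset G H) v = 0.
Proof.
apply: brel_compat => A A' => [AA'|].
  apply: (pres_hom_eq (bcomprB A) (bcomprB A')) => t; rewrite !bcompr_gen.
  by apply/bcls_iso/tens_biset_iso => //; exact: biset_iso_refl.
apply: (pres_hom_eq (bcomprB _) (g := fun y => bcompr A y + bcompr A' y)) => [x z|t].
  by rewrite !bcomprB opprD addrACA.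
by rewrite !bcompr_gen -bcls_sum; apply/bcls_iso/tens_sum_left.
Qed.

(* Composition in the biset category: the biadditive map induced by U x_H V. *)
Definition bcomp (x : bgroup G H) (y : bgroup H K) : bgroup G K :=
  plift (fun t : bgen G H => bcompr (big_biset t) y) x.

Lemma bcompBl y : zmod_morphism (bcomp^~ y).
Proof. exact/plift_is_additive/bcomp_compat_l. Qed.

Lemma bcomp_genl t y : bcomp (pgen _ t) y = bcompr (big_biset t) y.
Proof. exact/plift_gen/bcomp_compat_l. Qed.

Lemma bcompBr x : zmod_morphism (bcomp x).
Proof.
move=> y z; move: x; apply: pres_hom_eq => [x x'|x x'|t].
- by rewrite bcompBl.
- by rewrite !bcompBl !opprD !opprK !addrA; congr (_ + _); rewrite addrAC.
- by rewrite !bcomp_genl bcomprB.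
Qed.

Lemma bcomp_cls (A : biset G H) (B : biset H K) :
  bcomp (bcls A) (bcls B) = bcls (tens_biset A B).
Proof.
rewrite /bcls bcomp_genl bcompr_gen.
by apply/bcls_iso/tens_biset_iso; exact: big_small_biset.
Qed.
End Composition.

Section Pairs.
(* A class of finite groups and, for all G and H, a set of subgroups of G x H;
   only the S G H with G and H in the class matter. *)
Variables (cG : fgrp -> Prop).
Variable (cS : forall G H : fgrp, {group fgT G * fgT H} -> Prop).

Definition trans_cls (G H : fgrp) (D : {set fgT G * fgT H}) : bgroup G H :=
  bcls (trans_biset D).

(* By star_diag, the last subgroup in pa_starg is D * Delta(K). *)
Record pair_axioms : Prop := PairAxioms {
  pa_sub : forall G H, cG G -> cG H -> forall D, @cS G H D -> D \subset setX G H;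
  pa_diag : forall G, cG G -> @cS G G (diag_group G);
  pa_conj : forall G H, cG G -> cG H -> forall D, @cS G H D ->
    forall x, x \in setX G H -> @cS G H (D :^ x)%G;
  pa_star : forall G H K, cG G -> cG H -> cG K -> forall D E,
    @cS G H D -> @cS H K E -> @cS G K (star_group D E);
  pa_starg : forall G H, cG G -> cG H -> forall D, @cS G H D ->
    forall K : {group fgT H}, K \subset H -> cG (FGrp K) ->
    cG (FGrp (starg_group D K)) /\
    @cS (FGrp (starg_group D K)) (FGrp K) (D :&: setX G K)%G }.

Definition splus (G H : fgrp) (D : {group fgT G * fgT H}) : Prop :=
  [/\ D \subset setX G H, cG (FGrp (proj1_group D)) &
      @cS (FGrp (proj1_group D)) H D].

(* Hom(H, G) in the category C(G, S), as a subgroup of B(G, H). *)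
Definition homS (G H : fgrp) : bgroup G H -> Prop :=
  zspan (fun b => exists2 D : {group fgT G * fgT H}, @cS G H D & b = trans_cls D).

Variable R : comPzRingType.

(* Functors out of C(G, S) are represented by total functions whose values
   outside of C(G, S) are unconstrained and play no role; accordingly, natural
   transformations are compared by nat_eq. *)
Record functor_on (M : fgrp -> lmodType R) := FunctorOn {
  fmap : forall G H : fgrp, bgroup G H -> {linear M H -> M G};
  fmapD : forall G H, cG G -> cG H -> forall a b : bgroup G H,
    homS a -> homS b -> fmap (a + b) =1 fmap a \+ fmap b;
  fmap1 : forall G, cG G -> fmap (bcls (reg_biset G)) =1 id;
  fmap_comp : forall G H K, cG G -> cG H -> cG K ->
    forall (a : bgroup G H) (b : bgroup H K), homS a -> homS b ->
    fmap (bcomp a b) =1 fmap a \o fmap b }.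

Record biset_functor := BisetFunctor {
  fobj :> fgrp -> lmodType R;
  fstr :> functor_on fobj }.

Record nat_trans (F F' : biset_functor) := NatTrans {
  ncomp :> forall G, {linear F G -> F' G};
  nnat : forall G H, cG G -> cG H -> forall a : bgroup G H, homS a ->
    forall x, ncomp G (fmap F a x) = fmap F' a (ncomp H x) }.

Definition nat_eq (F F' : biset_functor) (phi psi : nat_trans F F') : Prop :=
  forall G, cG G -> phi G =1 psi G.

Section NatTransOps.
Variables (F F' F'' : biset_functor).

Lemma nat_id_subproof G H (_ : cG G) (_ : cG H) (a : bgroup G H) (_ : homS a) x :
  (idfun : {linear F G -> F G}) (fmap F a x) =
  fmap F a ((idfun : {linear F H -> F H}) x).
Proof. by []. Qed.
Definition nat_id := NatTrans nat_id_subproof.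

Variables (phi psi : nat_trans F F') (chi : nat_trans F' F'').

Lemma nat_comp_subproof G H (cGG : cG G) (cGH : cG H) (a : bgroup G H)
    (aS : homS a) x :
  (chi G \o phi G : {linear F G -> F'' G}) (fmap F a x) =
  fmap F'' a ((chi H \o phi H : {linear F H -> F'' H}) x).
Proof. by rewrite /= !nnat. Qed.
Definition nat_comp := NatTrans nat_comp_subproof.

Lemma nat_add_subproof G H (cGG : cG G) (cGH : cG H) (a : bgroup G H)
    (aS : homS a) x :
  (phi G \+ psi G : {linear F G -> F' G}) (fmap F a x) =
  fmap F' a ((phi H \+ psi H : {linear F H -> F' H}) x).
Proof. by rewrite /= !nnat // raddfD. Qed.
Definition nat_add := NatTrans nat_add_subproof.

Variable r : R.

Lemma nat_scale_subproof G H (cGG : cG G) (cGH : cG H) (a : bgroup G H)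
    (aS : homS a) x :
  (r \*: phi G : {linear F G -> F' G}) (fmap F a x) =
  fmap F' a ((r \*: phi H : {linear F H -> F' H}) x).
Proof. by rewrite /= !nnat // linearZ. Qed.
Definition nat_scale := NatTrans nat_scale_subproof.
End NatTransOps.

End Pairs.

Section DependentValues.
Variables (R : comPzRingType) (M : fgrp -> lmodType R) (gT : finGroupType).
Implicit Types H K L : {group gT}.

(* An element a of M(H) together with H: for a in M(H) and b in M(K), the
   equation tg a = tg b says that H = K and a = b. *)
Definition tg H (a : M (FGrp H)) : {L : {group gT} & M (FGrp L)} := existT _ H a.

Definition fcast H K (e : H = K) (a : M (FGrp H)) : M (FGrp K) :=
  eq_rect H (fun L => M (FGrp L)) a K e.

Lemma tg_fcast H K (e : H = K) a : tg (fcast e a) = tg a.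
Proof. by case: K / e. Qed.

Lemma tg_inj H : injective (@tg H).
Proof. by move=> a b; exact: eq_from_Tagged. Qed.

Lemma tgD H K (a b : M (FGrp H)) (c d : M (FGrp K)) :
  tg a = tg c -> tg b = tg d -> tg (a + b) = tg (c + d).
Proof.
move=> ac; have e : H = K := congr1 (@projT1 _ _) ac.
by case: K / e in c d ac * => /tg_inj <-; rewrite (tg_inj ac).
Qed.

Lemma tgZ H K r (a : M (FGrp H)) (c : M (FGrp K)) :
  tg a = tg c -> tg (r *: a) = tg (r *: c).
Proof.
move=> ac; have e : H = K := congr1 (@projT1 _ _) ac.
by case: K / e in c ac *; rewrite (tg_inj ac).
Qed.
End DependentValues.

Section Gamma.
Variables (R : comPzRingType) (cG : fgrp -> Prop).
Variable (cS : forall G H : fgrp, {group fgT G * fgT H} -> Prop).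
Variable F : biset_functor cG cS R.

(* {(g h g^-1, h) | h in H}; here ^gH is H :^ g^-1. *)
Definition conj_graph (gT : finGroupType) (g : gT) (H : {set gT}) : {set gT * gT} :=
  [set (h ^ g^-1, h)%g | h in H].

Definition fconj (gT : finGroupType) (g : gT) (H : {group gT}) :
    F (FGrp H) -> F (FGrp (H :^ g^-1)%G) :=
  fmap F (@trans_cls (FGrp (H :^ g^-1)%G) (FGrp H) (conj_graph g H)).

Lemma tg_fconj (gT : finGroupType) (g : gT) (H K : {group gT})
    (a : F (FGrp H)) (b : F (FGrp K)) :
  tg a = tg b -> tg (fconj g a) = tg (fconj g b).
Proof. by move/(congr1 (fun z => tg (fconj g (projT2 z)))). Qed.

Section Objects.
Variable G : fgrp.

Definition sect (X : finType) (A : gset_on G X) := forall x, F (FGrp (gstab A x)).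

Definition equivariant X (A : gset_on G X) (s : sect A) : Prop :=
  forall g x, g \in G -> tg (s (gact A g x)) = tg (fconj g (s x)).

Definition gamma_obj X (A : gset_on G X) (s : sect A) : Prop :=
  (forall x, cG (FGrp (gstab A x))) /\ equivariant s.

Record gamma_on (X : finType) := GammaOn {
  gm_set :> gset_on G X;
  gm_sec : sect gm_set;
  gm_obj : gamma_obj gm_sec }.
Record gamma := Gamma { gm_car :> finType; gm_str :> gamma_on gm_car }.
Arguments Gamma {gm_car} gm_str.

(* The equation between pairs says that the stabilizers of f x and of x are
   equal and that t (f x) = s x. *)
Definition gamma_hom (A B : gamma) (f : A -> B) : Prop :=
  (forall g x, g \in G -> f (gact A g x) = gact B g (f x)) /\
  (forall x, tg (gm_sec B (f x)) = tg (gm_sec A x)).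

Definition gamma_iso (A B : gamma) : Prop :=
  exists f : A -> B, exists f' : B -> A,
    [/\ gamma_hom f, gamma_hom f', cancel f f' & cancel f' f].

Section Transport.
Variables (X Y : finType) (A : gamma_on X) (e : X -> Y) (e' : Y -> X).
Hypotheses (eK : cancel e e') (eK' : cancel e' e).

Definition tr_gact g y := e (gact A g (e' y)).
Lemma tr_gact1 y : tr_gact 1 y = y.
Proof. by rewrite /tr_gact gact1 eK'. Qed.
Lemma tr_gactM : {in G &, forall g h y, tr_gact (g * h)%g y = tr_gact g (tr_gact h y)}.
Proof. by move=> g h gG hG y; rewrite /tr_gact gactM // eK. Qed.
Definition tr_gset_on : gset_on G Y := GsetOn tr_gact1 tr_gactM.

Lemma tr_gstab y : gstab A (e' y) = gstab tr_gset_on y.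
Proof. by apply/val_inj/setP => g; rewrite /= !inE /tr_gact (can2_eq eK eK'). Qed.

Definition tr_sec : sect tr_gset_on := fun y => fcast (tr_gstab y) (gm_sec A (e' y)).

Lemma tr_gamma_obj : gamma_obj tr_sec.
Proof.
split=> [y|g y gG]; first by rewrite -tr_gstab; case: (gm_obj A).
rewrite tg_fcast /= /tr_gact eK; have [_ /(_ _ _ gG) ->] := gm_obj A.
by apply/esym/tg_fconj; rewrite tg_fcast.
Qed.

Definition tr_gamma_on : gamma_on Y := GammaOn tr_gamma_obj.
End Transport.

Section Sum.
Variables (X Y : finType) (A : gset_on G X) (B : gset_on G Y).

Definition sum_gact g (z : X + Y) : X + Y :=
  match z with inl x => inl (gact A g x) | inr y => inr (gact B g y) end.
Lemma sum_gact1 z : sum_gact 1 z = z.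
Proof. by case: z => x /=; rewrite gact1. Qed.
Lemma sum_gactM : {in G &, forall g h z, sum_gact (g * h)%g z = sum_gact g (sum_gact h z)}.
Proof. by move=> g h gG hG [] x /=; rewrite gactM. Qed.
Definition sum_gset_on : gset_on G (X + Y)%type := GsetOn sum_gact1 sum_gactM.

Lemma gstab_inl x : gstab A x = gstab sum_gset_on (inl x).
Proof. by apply/val_inj/setP => g; rewrite /= !inE. Qed.
Lemma gstab_inr y : gstab B y = gstab sum_gset_on (inr y).
Proof. by apply/val_inj/setP => g; rewrite /= !inE. Qed.

Definition sum_sec (s : sect A) (t : sect B) : sect sum_gset_on := fun z =>
  match z with
  | inl x => fcast (gstab_inl x) (s x)
  | inr y => fcast (gstab_inr y) (t y)
  end.

Lemma sum_gamma_obj s t : gamma_obj s -> gamma_obj t -> gamma_obj (sum_sec s t).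
Proof.
move=> [sG se] [tG te]; split=> [[x|y]|g [x|y] gG].
- by rewrite -gstab_inl.
- by rewrite -gstab_inr.
- by rewrite tg_fcast /= se //; apply/esym/tg_fconj; rewrite tg_fcast.
- by rewrite tg_fcast /= te //; apply/esym/tg_fconj; rewrite tg_fcast.
Qed.
End Sum.

Definition sum_gamma (A B : gamma) : gamma :=
  Gamma (GammaOn (sum_gamma_obj (gm_obj A) (gm_obj B))).

Section SectionOps.
Variables (X : finType) (A : gset_on G X).

Definition add_sec (s t : sect A) : sect A := fun x => s x + t x.
Definition scale_sec (r : R) (s : sect A) : sect A := fun x => r *: s x.

Lemma add_gamma_obj s t : gamma_obj s -> gamma_obj t -> gamma_obj (add_sec s t).
Proof.
move=> [sG se] [_ te]; split=> // g x gG.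
by rewrite /add_sec /fconj raddfD; apply: tgD; [exact: se|exact: te].
Qed.

Lemma scale_gamma_obj r s : gamma_obj s -> gamma_obj (scale_sec r s).
Proof.
move=> [sG se]; split=> // g x gG.
by rewrite /scale_sec /fconj linearZ; apply: tgZ; exact: se.
Qed.
End SectionOps.

Definition scale_gamma_on X (r : R) (A : gamma_on X) : gamma_on X :=
  GammaOn (scale_gamma_obj r (gm_obj A)).

(* As for B(G, H), objects carried by some 'I_n suffice as generators. *)
Definition ggen := {n : nat & gamma_on 'I_n}.
Definition big_gamma (t : ggen) : gamma := Gamma (projT2 t).
Definition small_gamma (A : gamma) : ggen :=
  existT _ #|A| (tr_gamma_on A (@enum_rankK A) (@enum_valK A)).

Inductive grel : {freeg {classic ggen}} -> Prop :=
| grel_iso t t' : gamma_iso (big_gamma t) (big_gamma t') ->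
    grel (fgen t - fgen t')
| grel_sum A B :
    grel (fgen (small_gamma (sum_gamma A B)) -
          fgen (small_gamma A) - fgen (small_gamma B))
| grel_add X (A : gset_on G X) (s t : sect A)
    (sP : gamma_obj s) (tP : gamma_obj t) :
    grel (fgen (small_gamma (Gamma (GammaOn (add_gamma_obj sP tP)))) -
          fgen (small_gamma (Gamma (GammaOn sP))) -
          fgen (small_gamma (Gamma (GammaOn tP)))).

Definition fplus : Type := pres grel.
HB.instance Definition _ := GRing.Zmodule.on fplus.

Definition gcls (A : gamma) : fplus := pgen grel (small_gamma A).

(* z = [X, s]; in particular (X, s) is an object of Gamma_F(G). *)
Definition is_gcls X (A : gset_on G X) (s : sect A) (z : fplus) : Prop :=
  exists sP : gamma_obj s, z = gcls (Gamma (GammaOn sP)).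

Lemma gamma_iso_sym A B : gamma_iso A B -> gamma_iso B A.
Proof. by case=> f [f' [? ? ? ?]]; exists f', f. Qed.

Lemma gamma_hom_comp (A B C : gamma) (f : A -> B) (g : B -> C) :
  gamma_hom f -> gamma_hom g -> gamma_hom (g \o f).
Proof.
by move=> [f1 f2] [g1 g2]; split=> [k x kG|x] /=; rewrite ?f1 ?g1 ?g2 ?f2.
Qed.

Lemma gamma_iso_trans A B C : gamma_iso A B -> gamma_iso B C -> gamma_iso A C.
Proof.
move=> [f [f' [fh f'h fK f'K]]] [g [g' [gh g'h gK g'K]]].
exists (g \o f), (f' \o g'); split; try exact: gamma_hom_comp.
  exact: can_comp.
exact: can_comp.
Qed.

Lemma big_small_gamma A : gamma_iso (big_gamma (small_gamma A)) A.
Proof.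
exists (enum_val : _ -> A), (enum_rank : A -> _); split.
- by split=> [g x gG|x]; [rewrite /= /tr_gact enum_rankK|rewrite tg_fcast].
- by split=> [g x gG|x]; [rewrite /= /tr_gact enum_rankK|rewrite tg_fcast enum_rankK].
- exact: enum_valK.
- exact: enum_rankK.
Qed.

Lemma pgen_gcls t : pgen grel t = gcls (big_gamma t).
Proof.
apply/zpi_eq/zspan_gen/grel_iso/gamma_iso_sym; exact: big_small_gamma.
Qed.

Lemma gcls_iso A B : gamma_iso A B -> gcls A = gcls B.
Proof.
move=> AB; apply/zpi_eq/zspan_gen/grel_iso.
apply: gamma_iso_trans (big_small_gamma A) _.
exact: gamma_iso_trans AB (gamma_iso_sym (big_small_gamma B)).
Qed.

Lemma gcls_sum A B : gcls (sum_gamma A B) = gcls A + gcls B.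
Proof.
apply/eqP; rewrite -subr_eq0 opprD addrA /gcls /pgen -!raddfB -(raddf0 (zpi _)).
by apply/eqP/zpi_eq; rewrite subr0; apply/zspan_gen/grel_sum.
Qed.

Lemma gcls_add X (A : gset_on G X) (s t : sect A) (sP : gamma_obj s)
    (tP : gamma_obj t) :
  gcls (Gamma (GammaOn (add_gamma_obj sP tP))) =
  gcls (Gamma (GammaOn sP)) + gcls (Gamma (GammaOn tP)).
Proof.
apply/eqP; rewrite -subr_eq0 opprD addrA /gcls /pgen -!raddfB -(raddf0 (zpi _)).
by apply/eqP/zpi_eq; rewrite subr0; apply/zspan_gen/grel_add.
Qed.

Lemma grel_compat (V : zmodType) (f : gamma -> V) :
    (forall A B, gamma_iso A B -> f A = f B) ->
    (forall A B, f (sum_gamma A B) = f A + f B) ->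
    (forall X (A : gset_on G X) (s t : sect A) (sP : gamma_obj s)
       (tP : gamma_obj t),
       f (Gamma (GammaOn (add_gamma_obj sP tP))) =
       f (Gamma (GammaOn sP)) + f (Gamma (GammaOn tP))) ->
  forall v, grel v -> flift (f \o big_gamma) v = 0.
Proof.
move=> fI fS fA v; case=> [t t' tt'|A B|X A s t sP tP].
- by rewrite raddfB /= !flift_gen /= (fI _ _ tt') subrr.
- rewrite !raddfB /= !flift_gen /= !(fI _ _ (big_small_gamma _)) fS.
  by rewrite addrAC addrK subrr.
- rewrite !raddfB /= !flift_gen /= !(fI _ _ (big_small_gamma _)) fA.
  by rewrite addrAC addrK subrr.
Qed.

Definition scale_gamma (r : R) (A : gamma) : gamma := Gamma (scale_gamma_on r A).

Lemma sec_gamma_iso X (A : gset_on G X) (s t : sect A)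
    (sP : gamma_obj s) (tP : gamma_obj t) :
  (forall x, s x = t x) -> gamma_iso (Gamma (GammaOn sP)) (Gamma (GammaOn tP)).
Proof. by move=> st; exists id, id; split=> //; split=> //= x; rewrite st. Qed.

Lemma fplus_scale_compat r v :
  grel v -> flift ((fun A => gcls (scale_gamma r A)) \o big_gamma) v = 0.
Proof.
apply: grel_compat => [A B [f [f' [[fa fs] [f'a f's] fK f'K]]]|A B|X A s t sP tP].
- apply: gcls_iso; exists f, f'; split=> //; split=> //= x; exact: tgZ.
- rewrite -gcls_sum; apply: gcls_iso; exists id, id.
  by split=> //; split=> //= -[x|x]; rewrite /scale_sec /= tg_fcast;
     [apply/esym/tgZ|apply/esym/tgZ|apply/tgZ|apply/tgZ]; rewrite tg_fcast.
- rewrite -gcls_add; apply: gcls_iso; apply: sec_gamma_iso => x.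
  by rewrite /scale_sec /add_sec scalerDr.
Qed.

Definition fplus_scale (r : R) : fplus -> fplus :=
  plift (fun t => gcls (scale_gamma r (big_gamma t))).

Lemma fplus_scaleB r : zmod_morphism (fplus_scale r).
Proof. exact/plift_is_additive/fplus_scale_compat. Qed.

Lemma fplus_scale_gen r t : fplus_scale r (pgen _ t) = gcls (scale_gamma r (big_gamma t)).
Proof. exact/plift_gen/fplus_scale_compat. Qed.

Lemma fplus_scale_cls r A : fplus_scale r (gcls A) = gcls (scale_gamma r A).
Proof.
rewrite /gcls fplus_scale_gen; apply: gcls_iso.
have [f [f' [[fa fs] [f'a f's] fK f'K]]] := big_small_gamma A.
by exists f, f'; split=> //; split=> //= x; exact: tgZ.
Qed.

Lemma fplus_scaleA r r' x : fplus_scale r (fplus_scale r' x) = fplus_scale (r * r') x.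
Proof.
move: x; apply: pres_hom_eq => [x y|x y|t]; rewrite ?fplus_scaleB //.
rewrite (fplus_scale_gen r') fplus_scale_cls fplus_scale_gen; apply: gcls_iso; apply: sec_gamma_iso => x.
by rewrite /scale_sec scalerA.
Qed.

Lemma fplus_scale1 : left_id 1 fplus_scale.
Proof.
apply: pres_hom_eq => [x y|x y|t]; rewrite ?fplus_scaleB //.
rewrite fplus_scale_gen pgen_gcls; apply: gcls_iso; exists id, id.
by split=> //; split=> //= x; rewrite /scale_sec scale1r.
Qed.

Lemma fplus_scaleDr : right_distributive fplus_scale +%R.
Proof.
move=> r x y; have N z : fplus_scale r (- z) = - fplus_scale r z.
  by rewrite -[- z]sub0r fplus_scaleB -(subrr 0) fplus_scaleB !subrr sub0r.
by rewrite -{1}[y]opprK fplus_scaleB N opprK.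
Qed.

Lemma fplus_scaleDl x : {morph fplus_scale^~ x : r r' / r + r'}.
Proof.
move=> r r'; move: x; apply: pres_hom_eq => [x y|x y|t].
- by rewrite fplus_scaleB.
- by rewrite !fplus_scaleB opprD addrACA.
- rewrite !fplus_scale_gen -gcls_add; apply: gcls_iso; apply: sec_gamma_iso => x.
  by rewrite /scale_sec /add_sec scalerDl.
Qed.

HB.instance Definition _ := GRing.Zmodule_isLmodule.Build R fplus
  fplus_scaleA fplus_scale1 fplus_scaleDr fplus_scaleDl.

End Objects.

(* t = U(s) for the section t over U x_H X. *)
Definition induced_sec (G H : fgrp) (U : biset G H) (X : finType) (A : gset_on H X)
    (s : sect A) (t : sect (tens_gset_on U A)) : Prop :=
  forall u x, let ux := tcl H (ract U) (gact A) (u, x) in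
  t ux = fmap F
    (@trans_cls (FGrp (gstab (tens_gset_on U A) ux)) (FGrp (gstab A x))
       (bstab U u :&: setX G (gstab A x)))
    (s x).

Section CosetGset.
Variables (G : fgrp) (H : {group fgT G}).

Definition gcoset : Type := {C | C \in lcosets H G}.
HB.instance Definition _ := Finite.on gcoset.

Definition gc_act (g : fgT G) (C : gcoset) : gcoset := insubd C (g *: val C)%g.

Lemma gc_act_val g C : g \in G -> val (gc_act g C) = (g *: val C)%g.
Proof.
move=> gG; rewrite insubdK //; case: C => C /=.
by move=> /lcosetsP[h hG ->]; apply/lcosetsP; exists (g * h)%g; rewrite ?groupM ?lcosetM.
Qed.

Lemma gc_act1 C : gc_act 1 C = C.
Proof. by apply/val_inj; rewrite gc_act_val ?lcoset1. Qed.

Lemma gc_actM : {in G &, forall g h C, gc_act (g * h)%g C = gc_act g (gc_act h C)}.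
Proof. by move=> g h gG hG C; apply/val_inj; rewrite !gc_act_val ?groupM ?lcosetM. Qed.

Definition coset_gset_on : gset_on G gcoset := GsetOn gc_act1 gc_actM.

Lemma base_in : (H : {set fgT G}) \in lcosets H G.
Proof. by apply/lcosetsP; exists 1%g; rewrite ?lcoset1. Qed.

Definition base_coset : gcoset := exist _ (H : {set fgT G}) base_in.
End CosetGset.

Section Coinvariants.
Variable G : fgrp.

Definition sigmaG : Type :=
  {H : {group fgT G} | (H \subset G) && `[< cG (FGrp H) >]}.
HB.instance Definition _ := Finite.on sigmaG.

Definition dsum : Type := forall i : sigmaG, F (FGrp (val i)).
HB.instance Definition _ := Choice.copy dsum (forall i : sigmaG, F (FGrp (val i))).

Definition dsum0 : dsum := fun=> 0.
Definition dsum_opp (v : dsum) : dsum := fun i => - v i.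
Definition dsum_add (v w : dsum) : dsum := fun i => v i + w i.
Definition dsum_scale (r : R) (v : dsum) : dsum := fun i => r *: v i.

Lemma dsum_addA : associative dsum_add.
Proof. by move=> u v w; apply: functional_extensionality_dep => i; exact: addrA. Qed.
Lemma dsum_addC : commutative dsum_add.
Proof. by move=> u v; apply: functional_extensionality_dep => i; exact: addrC. Qed.
Lemma dsum_add0 : left_id dsum0 dsum_add.
Proof. by move=> v; apply: functional_extensionality_dep => i; exact: add0r. Qed.
Lemma dsum_addN : left_inverse dsum0 dsum_opp dsum_add.
Proof. by move=> v; apply: functional_extensionality_dep => i; exact: addNr. Qed.
HB.instance Definition _ :=
  GRing.isZmodule.Build dsum dsum_addA dsum_addC dsum_add0 dsum_addN.

Lemma dsum_scaleA r r' v : dsum_scale r (dsum_scale r' v) = dsum_scale (r * r') v.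
Proof. by apply: functional_extensionality_dep => i; exact: scalerA. Qed.
Lemma dsum_scale1 : left_id 1 dsum_scale.
Proof. by move=> v; apply: functional_extensionality_dep => i; exact: scale1r. Qed.
Lemma dsum_scaleDr : right_distributive dsum_scale +%R.
Proof. by move=> r v w; apply: functional_extensionality_dep => i; exact: scalerDr. Qed.
Lemma dsum_scaleDl v : {morph dsum_scale^~ v : r r' / r + r'}.
Proof. by move=> r r'; apply: functional_extensionality_dep => i; exact: scalerDl. Qed.
HB.instance Definition _ := GRing.Zmodule_isLmodule.Build R dsum
  dsum_scaleA dsum_scale1 dsum_scaleDr dsum_scaleDl.

(* The inclusion of the summand F(H), and 0 if H is not in Sigma(G). *)
Definition dinj (H : {group fgT G}) (a : F (FGrp H)) : dsum := fun i =>
  if H =P val i is ReflectT e then fcast e a else 0.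

Definition dact (g : fgT G) (v : dsum) : dsum :=
  \sum_(i : sigmaG) dinj (fconj g (v i)).

(* The products of an element of the augmentation ideal of RG, given by its
   coefficients c, and an element of the direct sum. *)
Definition aug_prod (w : dsum) : Prop :=
  exists (c : fgT G -> R) (v : dsum),
    \sum_(g in G) c g = 0 /\ w = \sum_(g in G) c g *: dact g v.

Definition coinv : Type := zquot aug_prod.
HB.instance Definition _ := GRing.Zmodule.on coinv.

Definition coinv_cls (v : dsum) : coinv := zpi aug_prod v.

Definition coinv_premap (r : R) (v : dsum) : coinv := zpi aug_prod (r *: v).
Lemma coinv_premapB r : zmod_morphism (coinv_premap r).
Proof. by move=> v w; rewrite /coinv_premap scalerBr raddfB. Qed.
HB.instance Definition _ r :=
  GRing.isZmodMorphism.Build dsum coinv (coinv_premap r) (coinv_premapB r).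

Lemma coinv_premap_ker r v : aug_prod v -> coinv_premap r v = 0.
Proof.
move=> [c [w [c0 ->]]]; rewrite -(raddf0 (zpi aug_prod)); apply/zpi_eq.
rewrite subr0; apply: zspan_gen; exists (fun g => r * c g), w.
rewrite -mulr_sumr c0 mulr0; split=> //.
by rewrite scaler_sumr; apply: eq_bigr => g _; rewrite scalerA.
Qed.

Definition coinv_scale (r : R) : coinv -> coinv := zlift (coinv_premap r).

Lemma coinv_scaleE r v : coinv_scale r (zpi _ v) = zpi _ (r *: v).
Proof. by rewrite /coinv_scale (zliftE (@coinv_premap_ker r)). Qed.

Lemma coinv_scaleA r r' x : coinv_scale r (coinv_scale r' x) = coinv_scale (r * r') x.
Proof. by have [v ->] := zpi_surj x; rewrite !coinv_scaleE scalerA. Qed.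
Lemma coinv_scale1 : left_id 1 coinv_scale.
Proof. by move=> x; have [v ->] := zpi_surj x; rewrite coinv_scaleE scale1r. Qed.
Lemma coinv_scaleDr : right_distributive coinv_scale +%R.
Proof.
move=> r x y; have [v ->] := zpi_surj x; have [w ->] := zpi_surj y.
by rewrite -raddfD !coinv_scaleE scalerDr raddfD.
Qed.
Lemma coinv_scaleDl x : {morph coinv_scale^~ x : r r' / r + r'}.
Proof.
by move=> r r'; have [v ->] := zpi_surj x; rewrite !coinv_scaleE scalerDl raddfD.
Qed.
HB.instance Definition _ := GRing.Zmodule_isLmodule.Build R coinv
  coinv_scaleA coinv_scale1 coinv_scaleDr coinv_scaleDl.
End Coinvariants.
End Gamma.

Arguments Gamma {R cG cS F G gm_car} gm_str.

(* Main.v *)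
(* Write a * z for the action of [(L x K)/D] on z in F(K).  All of (a) rests on
   one case of the Mackey formula: if M = p_2(D) p_1(E), then
   [(L x M)/D] o [(M x K)/E] = [(L x K)/(D * E)], because the composite biset is
   transitive with point stabilizer D * E.  It applies with D or E projecting
   onto M, and yields that U(s)([u,x]) is independent of (u,x), that U(s) is
   equivariant and that (U x_H V)(s) = U(V(s)).
   F_+(b) is defined for every b in B(G,H), additively in b, by letting a biset
   act through its part with stabilizers in S_+; no cancellation of bisets is
   needed.
   For (c), [X,s] |-> sum over the orbits Gx of X of the class of s(x) is a left
   inverse of the map M_G -> F_+(G), which is onto since every object of
   Gamma_F(G) is a disjoint union of transitive ones. *)
Require Import Defs.
From HB Require Import structures.
From mathcomp Require Import all_boot all_fingroup all_algebra.
From mathcomp Require Import boolp.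
(* Again, since all_fingroup has its own gact and ract. *)
Require Import Defs.
Set Implicit Arguments.
Unset Strict Implicit.
Unset Printing Implicit Defensive.
Import GRing.Theory.
Local Open Scope ring_scope.

(** The values of a section lie in modules [F (FGrp L)] whose type depends on the stabilizer L, so
    an equation between two values presupposes an equation between two groups. The pairs [tg a]
    absorb this: a value is carried along with its subgroup, and [zconj] and [zop] act on such
    pairs. The second obstacle is that orbit spaces have no canonical representatives. Isomorphisms
    between them are therefore given by a type of parameters with surjections p and q onto both
    sides having the same fibres, as in [span_bij]; equivariance, stabilizers and sections are then
    compared on parameters such as triples (u, v, x). *)

Lemma span_bij (T A B : Type) (p : T -> A) (q : T -> B) :
    (forall a, exists t, p t = a) -> (forall b, exists t, q t = b) ->
    (forall t t', p t = p t' <-> q t = q t') ->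
  exists f : A -> B, exists f' : B -> A,
    [/\ cancel f f', cancel f' f, forall t, f (p t) = q t &
        forall t, f' (q t) = p t].
Proof.
move=> sp sq pq; pose f a := q (sval (cid (sp a))).
pose f' b := p (sval (cid (sq b))).
have fp t : f (p t) = q t by rewrite /f; case: cid => t' /= /pq.
have f'q t : f' (q t) = p t by rewrite /f'; case: cid => t' /= /pq.
exists f, f'; split=> // [a|b].
  by have [t <-] := sp a; rewrite fp f'q.
by have [t <-] := sq b; rewrite f'q fp.
Qed.

(** * Transitive bisets *)

Section TransitiveBisets.
Local Open Scope group_scope.
Variables G H : fgrp.

Lemma biset_iso_span (A B : biset G H) (T : Type) (p : T -> A) (q : T -> B) :
    (forall a, exists t, p t = a) -> (forall b, exists t, q t = b) ->
    (forall t t', p t = p t' <-> q t = q t') ->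
    (forall g t, g \in G ->
       exists2 t', p t' = lact A g (p t) & q t' = lact B g (q t)) ->
    (forall h t, h \in H ->
       exists2 t', p t' = ract A (p t) h & q t' = ract B (q t) h) ->
  biset_iso A B.
Proof.
move=> sp sq pq pl pr; have [f [f' [fK f'K fp f'q]]] := span_bij sp sq pq.
exists f; split; first by exists f'.
split=> [g gG a|h hH a]; have [t <-] := sp a.
  by have [t' <- qt'] := pl g t gG; rewrite !fp.
by have [t' <- qt'] := pr h t hH; rewrite !fp.
Qed.

Section Cancel.
Variables (U : finType) (A : biset_on G H U).
Lemma lactK g u : g \in G -> lact A g^-1 (lact A g u) = u.
Proof. by move=> gG; rewrite -lactM ?groupV // mulVg lact1. Qed.
Lemma lactKV g u : g \in G -> lact A g (lact A g^-1 u) = u.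
Proof. by move=> gG; rewrite -lactM ?groupV // mulgV lact1. Qed.
Lemma ractK h u : h \in H -> ract A (ract A u h) h^-1 = u.
Proof. by move=> hH; rewrite -ractM ?groupV // mulgV ract1. Qed.
Lemma ractKV h u : h \in H -> ract A (ract A u h^-1) h = u.
Proof. by move=> hH; rewrite -ractM ?groupV // mulVg ract1. Qed.
End Cancel.

(** The equation g u = u h is free of the inverse in the definition of the stabilizer; most
    stabilizer computations use this form. *)
Lemma in_bstab (U : finType) (A : biset_on G H U) u g h : g \in G -> h \in H ->
  ((g, h) \in bstab A u) = (lact A g u == ract A u h).
Proof.
move=> gG hH; rewrite !inE gG hH /= lractA ?groupV //.
by apply/eqP/eqP => [{2}<-|->]; rewrite ?ractK ?ractKV.
Qed.

Lemma bstab_sub (U : finType) (A : biset_on G H U) u :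
  bstab A u \subset setX G H.
Proof. by apply/subsetP => p; rewrite inE => /andP[]. Qed.

(** Orbit-stabilizer: the elements (g, h) of G x H parametrize at once the cosets of the stabilizer
    and the points g u h^-1, and both surjections identify (g, h) with (g', h') exactly when (g,
    h)^-1 (g', h') fixes u. *)
Lemma trans_biset_iso (U : biset G H) (u : U) :
    (forall v, exists g h, [/\ g \in G, h \in H & v = lact U g (ract U u h)]) ->
  biset_iso (trans_biset (bstab U u)) U.
Proof.
move=> tr; pose T := {p : fgT G * fgT H | p \in setX G H}.
have cP (t : T) : val t *: bstab U u \in lcosets (bstab U u) (setX G H).
  by apply/lcosetsP; exists (val t) => //; exact: valP.
have inX (t : T) : (val t).1 \in G /\ (val t).2 \in H.
  by apply/andP; have := valP t; rewrite inE.
pose p (t : T) : trans_biset (bstab U u) :=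
  exist (fun C => C \in lcosets (bstab U u) (setX G H)) _ (cP t).
pose q (t : T) : U := lact U (val t).1 (ract U u (val t).2^-1).
apply: (@biset_iso_span _ _ T p q).
- case=> C CP; have /lcosetsP[x xGH e] := CP; exists (exist _ x xGH).
  exact/val_inj.
- move=> v; have [g [h [gG hH ->]]] := tr v.
  have ghX : (g, h^-1) \in setX G H by rewrite inE gG groupV.
  by exists (exist _ (g, h^-1) ghX); rewrite /q /= invgK.
- move=> t t'; have [gG hH] := inX t; have [g'G h'H] := inX t'.
  have -> : (p t = p t') <-> ((val t)^-1 * val t' \in bstab U u).
    rewrite -mem_lcoset; split=> [pp|].
      have -> : val t *: bstab U u = val t' *: bstab U u := congr1 val pp.
      exact: lcoset_refl.
    by move=> /lcoset_eqP e; apply/val_inj.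
  rewrite /q; case: (val t) (val t') gG hH g'G h'H => g h [g' h'] /= gG hH g'G h'H.
  have -> : ((g, h)^-1 * (g', h') \in bstab U u) =
            (lact U (g^-1 * g') u == ract U u (h^-1 * h')).
    by apply: in_bstab; rewrite groupM ?groupV.
  have -> : lact U g' (ract U u h'^-1) =
            lact U g (ract U (lact U (g^-1 * g') u) h'^-1).
    by rewrite !lractA ?groupV ?groupM // -lactM ?groupM ?groupV // mulKVg.
  split=> [/eqP ->|/(congr1 (lact U g^-1))].
    by rewrite -ractM ?groupM ?groupV // mulgK.
  rewrite !lactK // => /(congr1 (fun v => ract U v h')).
  by rewrite ractKV ?groupM // -ractM ?groupV // => ->.
- move=> g t gG; have [tG tH] := inX t.
  have gt : (g, 1) * val t \in setX G H by rewrite groupM ?(valP t) // inE gG group1.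
  exists (exist (fun x => x \in setX G H) _ gt).
    apply/val_inj; rewrite /= tc_act_val ?inE ?gG ?group1 // -lcosetM //.
  by rewrite /q /= mul1g lactM.
- move=> h t hH; have [tG tH] := inX t.
  have ht : (1, h^-1) * val t \in setX G H.
    by rewrite groupM ?(valP t) // inE group1 groupV.
  exists (exist (fun x => x \in setX G H) _ ht).
    by apply/val_inj; rewrite /= tc_act_val ?inE ?groupV ?hH ?group1 // -lcosetM.
  by rewrite /q /= mul1g invMg invgK ractM ?groupV // lractA ?groupV.
Qed.

Lemma tbase_in (D : {group fgT G * fgT H}) :
  (D : {set fgT G * fgT H}) \in lcosets D (setX G H).
Proof. by apply/lcosetsP; exists 1; rewrite ?group1 ?lcoset1. Qed.

Definition tbase (D : {group fgT G * fgT H}) : trans_biset D :=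
  exist (fun C => C \in lcosets D (setX G H)) (D : {set _}) (tbase_in D).

Lemma bstab_tbase (D : {group fgT G * fgT H}) :
  D \subset setX G H -> bstab (trans_biset D) (tbase D) = D.
Proof.
move=> sD; apply/group_inj/setP => p.
case: (boolP (p \in setX G H)) => [pX|pX]; last first.
  by apply/idP/idP => [|/(subsetP sD)]; rewrite ?(negPf pX) // inE (negPf pX).
move: pX; rewrite inE; case: p => g h /= /andP[gG hH].
rewrite !inE gG hH /= /tc_lact /tc_ract invgK -tc_actM ?inE ?gG ?hH ?group1 //.
rewrite -val_eqE /= tc_act_val ?inE ?groupM ?group1 //=.
have -> : (g, 1) * (1, h) = (g, h) by congr pair; rewrite ?mulg1 ?mul1g.
apply/eqP/idP => [<-|ghD]; first exact: lcoset_refl.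
exact: lcoset_id.
Qed.

Lemma trans_bisetP (D : {group fgT G * fgT H}) (C : trans_biset D) :
  exists g h, [/\ g \in G, h \in H &
    C = lact (trans_biset D) g (ract (trans_biset D) (tbase D) h)].
Proof.
case: C => C CP; have /lcosetsP[[g h]] := CP; rewrite inE => /andP[gG hH] e.
exists g, h^-1; split; rewrite ?groupV //; apply/val_inj.
rewrite /= /tc_lact /tc_ract invgK -tc_actM ?inE ?gG ?hH ?group1 //.
rewrite tc_act_val ?inE ?groupM ?group1 // e.
by congr (_ *: _); congr pair; rewrite ?mulg1 ?mul1g.
Qed.

Lemma bcls_trans (U : biset G H) (u : U) :
    (forall v, exists g h, [/\ g \in G, h \in H & v = lact U g (ract U u h)]) ->
  bcls U = trans_cls (bstab U u).
Proof. by move=> tr; apply/esym/bcls_iso/trans_biset_iso. Qed.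

End TransitiveBisets.

(** * Stabilizers in tensor products and composition of transitive bisets *)

Section TensorStabilizers.
Local Open Scope group_scope.
Variables G H K : fgrp.

Lemma gact_tens (U : biset G H) (X : finType) (A : gset_on H X) g p : g \in G ->
  gact (tens_gset_on U A) g (tcl H (ract U) (gact A) p) =
  tcl H (ract U) (gact A) (lact U g p.1, p.2).
Proof. exact: tg_actE. Qed.

Lemma lact_tens (U : biset G H) (V : biset H K) g p : g \in G ->
  lact (tens_biset U V) g (tcl H (ract U) (lact V) p) =
  tcl H (ract U) (lact V) (lact U g p.1, p.2).
Proof. exact: tb_lactE. Qed.

Lemma ract_tens (U : biset G H) (V : biset H K) p k : k \in K ->
  ract (tens_biset U V) (tcl H (ract U) (lact V) p) k =
  tcl H (ract U) (lact V) (p.1, ract V p.2 k).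
Proof. exact: tb_ractE. Qed.

(** The equation g [u, v] = [u, v] k holds when some h in H satisfies g u = u h and h v = v k, and
    only then. *)
Lemma bstab_tens (U : biset G H) (V : biset H K) u v :
  bstab (tens_biset U V) (tcl H (ract U) (lact V) (u, v)) =
  star_group (bstab U u) (bstab V v).
Proof.
apply/group_inj/setP => -[g k]; apply/idP/idP => [ghS|].
  have /setXP[gG kK] := subsetP (bstab_sub _ _) _ ghS.
  move: ghS; rewrite in_bstab // lact_tens // ract_tens // => /eqP/bcl_eq[h hH [eu ev]].
  rewrite inE; apply/existsP; exists h; rewrite !in_bstab //= ev eqxx andbT.
  by rewrite {2}eu ractKV.
rewrite inE => /existsP[h /andP[gh hk]].
have /setXP[gG hH] := subsetP (bstab_sub _ _) _ gh.
have /setXP[_ kK] := subsetP (bstab_sub _ _) _ hk.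
move: gh hk; rewrite !in_bstab // => /eqP gu /eqP hv.
rewrite lact_tens // ract_tens //; apply/eqP/bcl_eq; exists h => //=.
by rewrite gu ractK // -hv.

Qed.

Lemma trans_cls_comp (D : {group fgT G * fgT H}) (E : {group fgT H * fgT K}) :
    D \subset setX G H -> E \subset setX H K ->
    H \subset [set p.2 | p in D] * proj1_set E ->
  bcomp (trans_cls D) (trans_cls E) = trans_cls (star_set D E).
Proof.
move=> sD sE sH; rewrite /trans_cls bcomp_cls.
set U := trans_biset D; set V := trans_biset E.
pose c := tcl H (ract U) (lact V).
rewrite (@bcls_trans _ _ (tens_biset U V) (c (tbase D, tbase E))).
  by rewrite bstab_tens !bstab_tbase.
move=> O; rewrite -[O]trepK; case: (trep O) => C C' {O}.
have [g [h [gG hH ->]]] := trans_bisetP C.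
have [h' [k [h'H kK ->]]] := trans_bisetP C'.
(* Transitivity: with x and y the base points, write h h' = n n' where (l, n) is in D and (n', r) in
   E. Then [g x h, h' y k] = [g x n, n' y k] = g l [x, y] r k. *)
have [m m' /imsetP[[l n] lD ->{m}] /imsetP[[n' r] nE ->{m'}] e] :=
  mulsgP (subsetP sH _ (groupM hH h'H)).
have /setXP[lG nH] := subsetP sD _ lD; have /setXP[n'H rK] := subsetP sE _ nE.
have Dst : lact U l (tbase D) = ract U (tbase D) n.
  by apply/eqP; rewrite -in_bstab ?bstab_tbase.
have Est : lact V n' (tbase E) = ract V (tbase E) r.
  by apply/eqP; rewrite -in_bstab ?bstab_tbase.
exists (g * l), (r * k); split; rewrite ?groupM //.
rewrite ract_tens ?groupM // lact_tens ?groupM //.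
apply/bcl_eq; exists (n^-1 * h); rewrite ?groupM ?groupV //; congr pair.
  rewrite invMg invgK lactM // Dst !lractA // -ractM ?groupM ?groupV //.
  by rewrite mulKVg.
by rewrite -lactM ?groupM ?groupV // -mulgA e mulKg lractA // Est -ractM.
Qed.
End TensorStabilizers.

(** * Stabilizers and conjugation *)

Section ConjGraph.
Local Open Scope group_scope.
Variable gT : finGroupType.

Lemma conj_graph_group_set (g : gT) (H : {group gT}) : group_set (conj_graph g H).
Proof.
apply/group_setP; split=> [|_ _ /imsetP[h hH ->] /imsetP[k kH ->]].
  by apply/imsetP; exists 1; rewrite ?conj1g.
by apply/imsetP; exists (h * k); rewrite ?groupM // conjMg.
Qed.
Canonical conj_graph_group g H := Group (conj_graph_group_set g H).

Lemma in_conj_graph (g a h : gT) (H : {group gT}) :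
  ((a, h) \in conj_graph g H) = (h \in H) && (a == h ^ g^-1).
Proof.
apply/imsetP/andP => [[k kH [-> ->]]|[hH /eqP ->]]; first by rewrite eqxx.
by exists h.
Qed.

(** Composing with a conjugation graph on the left conjugates first coordinates; the inclusion of
    p_1(D) in H ensures that no element of D is lost. *)
Lemma star_conj_graph (hT : finGroupType) (g : gT) (H : {group gT}) (D : {set gT * hT}) :
  proj1_set D \subset H ->
  star_set (conj_graph g H) D = [set p | (p.1 ^ g, p.2) \in D].
Proof.
move=> sD; apply/setP => -[a k]; rewrite !inE /=; apply/existsP/idP => [[h]|aD].
  by rewrite in_conj_graph => /andP[/andP[_ /eqP ->]]; rewrite -conjgM mulVg conjg1.
exists (a ^ g); rewrite aD in_conj_graph -conjgM mulgV conjg1 eqxx !andbT.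
by apply: (subsetP sD); apply/imsetP; exists (a ^ g, k).
Qed.

Lemma proj1_conj_graph (g : gT) (H : {group gT}) :
  proj1_set (conj_graph g H) = H :^ g^-1.
Proof. by rewrite /proj1_set /conj_graph -imset_comp. Qed.

Lemma conj_graph_sub (g : gT) (H : {group gT}) :
  conj_graph g H \subset setX (H :^ g^-1) H.
Proof.
by apply/subsetP => _ /imsetP[h hH ->]; rewrite inE /= memJ_conjg hH.
Qed.

End ConjGraph.

Section RegularClass.
Local Open Scope group_scope.

(** In the regular biset, a u = u b reads a = u b u^-1. *)
Lemma bstab_reg (G : fgrp) (u : reg_biset G) :
  bstab (reg_biset G) u = conj_graph_group (sgval u) G.
Proof.
apply/group_inj/setP => -[a b].
case: (boolP ((a, b) \in setX G G)) => [/setXP[aG bG]|abG]; last first.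
  apply/idP/idP => [/(subsetP (bstab_sub _ _))|/imsetP[h hG [ea eb]]].
    by rewrite (negPf abG).
  by case/negP: abG; rewrite ea eb inE /= groupJ ?groupV ?subgP.
rewrite in_bstab // [RHS]in_conj_graph bG /= /reg_lact /reg_ract.
rewrite -(inj_eq (@subg_inj _ G)) !subgK ?groupM ?subgP // conjgE invgK.
by apply/eqP/eqP => [/(canRL (mulgK _)) ->|->]; rewrite ?mulgA ?mulgKV.
Qed.

(** Taking g instead of 1 as base point of the regular biset shows that conjugation by an element of
    G is the identity morphism. *)
Lemma trans_cls_conj_graph (G : fgrp) (g : fgT G) : g \in G ->
  @trans_cls G G (conj_graph g G) = bcls (reg_biset G).
Proof.
move=> gG; pose u : reg_biset G := subg G g.
have ug : sgval u = g by rewrite subgK.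
rewrite (@bcls_trans G G (reg_biset G) u) => [|v]; first by rewrite bstab_reg ug.
exists (sgval v * g^-1), 1; rewrite group1 groupM ?groupV ?subgP //; split=> //.
by rewrite ract1 /= /reg_lact ug mulgKV sgvalK.
Qed.

End RegularClass.

Section GStabilizers.
Local Open Scope group_scope.
Variable G : fgrp.

Lemma in_gstab (X : finType) (A : gset_on G X) x g : g \in G ->
  (g \in gstab A x) = (gact A g x == x).
Proof. by move=> gG; rewrite inE gG. Qed.

Lemma gstab_sub (X : finType) (A : gset_on G X) x : gstab A x \subset G.
Proof. by apply/subsetP => g; rewrite inE => /andP[]. Qed.

Lemma gactK (X : finType) (A : gset_on G X) g x :
  g \in G -> gact A g^-1 (gact A g x) = x.
Proof. by move=> gG; rewrite -gactM ?groupV // mulVg gact1. Qed.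

Lemma gactKV (X : finType) (A : gset_on G X) g x :
  g \in G -> gact A g (gact A g^-1 x) = x.
Proof. by move=> gG; rewrite -gactM ?groupV // mulgV gact1. Qed.

Lemma gstab_act (X : finType) (A : gset_on G X) g x : g \in G ->
  gstab A (gact A g x) = (gstab A x :^ g^-1)%G.
Proof.
move=> gG; apply/group_inj/setP => k; rewrite mem_conjgV !inE groupJr //.
case: (boolP (k \in G)) => //= kG; rewrite conjgE !gactM ?groupM ?groupV //.
by apply/eqP/eqP => [->|{2}<-]; rewrite ?gactK ?gactKV.
Qed.

End GStabilizers.

Section BStabilizers.
Local Open Scope group_scope.
Variables G H : fgrp.

Lemma gstab_tens (U : biset G H) (X : finType) (A : gset_on H X) u x :
  gstab (tens_gset_on U A) (tcl H (ract U) (gact A) (u, x)) =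
  starg_group (bstab U u) (gstab A x).
Proof.
apply/group_inj/setP => g; apply/idP/idP => [gS|].
  have gG := subsetP (gstab_sub _ _) _ gS.
  move: gS; rewrite in_gstab // gact_tens // => /eqP/gcl_eq[h hH [eu ex]].
  rewrite inE; apply/existsP; exists h; rewrite in_bstab // in_gstab // -ex eqxx /=.
  by rewrite {2}eu ractKV.
rewrite inE => /exists_inP[h hx gh].
have /setXP[gG hH] := subsetP (bstab_sub _ _) _ gh.
rewrite in_gstab // gact_tens //; apply/eqP/gcl_eq; exists h => //=.
move: hx gh; rewrite in_gstab // in_bstab // => /eqP hx /eqP gu.
by rewrite gu ractK ?hx.
Qed.

(** The right side has the shape produced by [star_conj_graph], so that translating u amounts to
    composing with a conjugation morphism. *)
Lemma bstab_lact (U : finType) (A : biset_on G H U) g u : g \in G ->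
  bstab A (lact A g u) = [set p | (p.1 ^ g, p.2) \in bstab A u] :> {set _}.
Proof.
move=> gG; apply/setP => -[a b]; rewrite [in RHS]inE /=.
case: (boolP ((a, b) \in setX G H)) => [/setXP[aG bH]|abG]; last first.
  apply/idP/idP => [/(subsetP (bstab_sub _ _))|]; first by rewrite (negPf abG).
  move=> /(subsetP (bstab_sub _ _))/setXP[].
  by rewrite groupJr // => aG bH; case/negP: abG; rewrite inE aG.
rewrite !in_bstab ?groupJ // conjgE !lactM ?groupM ?groupV //.
rewrite -lractA //; apply/eqP/eqP => [->|<-]; first by rewrite lactK.
by rewrite lactKV.
Qed.

Lemma bstab_ract (U : finType) (A : biset_on G H U) h u : h \in H ->
  bstab A (ract A u h^-1) = [set p | (p.1, p.2 ^ h) \in bstab A u] :> {set _}.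
Proof.
move=> hH; apply/setP => -[a b]; rewrite [in RHS]inE /=.
case: (boolP ((a, b) \in setX G H)) => [/setXP[aG bH]|abG]; last first.
  apply/idP/idP => [/(subsetP (bstab_sub _ _))|]; first by rewrite (negPf abG).
  move=> /(subsetP (bstab_sub _ _))/setXP[].
  by rewrite groupJr // => aG bH; case/negP: abG; rewrite inE aG.
rewrite !in_bstab ?groupJ // conjgE !ractM ?groupM ?groupV // lractA ?groupV //.
by apply/eqP/eqP => [<-|->]; rewrite ?ractK ?ractKV.
Qed.

End BStabilizers.

Lemma mem_conj_pair (gT hT : finGroupType) (D : {set gT * hT}) a x b y :
  ((a, b) \in D :^ (x, y) = ((a ^ x^-1, b ^ y^-1) \in D))%g.
Proof. by rewrite mem_conjg. Qed.

(** * Closure properties of S and S_+ *)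

Section AdmissiblePairs.
Local Open Scope group_scope.
Variables (cG : fgrp -> Prop).
Variable (cS : forall G H : fgrp, {group fgT G * fgT H} -> Prop).
Hypothesis ax : pair_axioms cG cS.

(** Axioms (i), (ii) and (iv) combine: conjugating Delta(G) by (g^-1, 1) gives the graph D of
    conjugation by g on G, and (iv) for D and H yields both D * H = ^gH and the graph restricted to
    H. *)
Lemma pair_conj_graph (G : fgrp) (H : {group fgT G}) g :
    cG G -> H \subset G -> cG (FGrp H) -> g \in G ->
  cG (FGrp (H :^ g^-1)%G) /\
  @cS (FGrp (H :^ g^-1)%G) (FGrp H) (conj_graph_group g H).
Proof.
move=> GG sHG HH gG; pose x : fgT G * fgT G := (g^-1, 1).
have xX : x \in setX G G by rewrite inE /= groupV gG group1.
pose D := (diag_group G :^ x)%G.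
have DS : @cS G G D by exact: (pa_conj ax) (pa_diag ax GG) _ xX.
have inD a h : ((a, h) \in D) = (h \in G) && (a == h ^ g^-1).
  rewrite mem_conj_pair invgK invg1 conjg1.
  apply/imsetP/andP => [[k kG [e ->]]|[hG /eqP ->]].
    by rewrite kG -e -conjgM mulgV conjg1 eqxx.
  by exists h; rewrite // -conjgM mulVg conjg1.
have [] := pa_starg ax GG GG DS sHG HH.
have -> : starg_group D H = (H :^ g^-1)%G.
  apply/group_inj/setP => a; rewrite inE; apply/exists_inP/idP => [[h hH]|aH].
    by rewrite inD => /andP[_ /eqP ->]; rewrite memJ_conjg.
  exists (a ^ g); first by rewrite -mem_conjgV.
  rewrite inD -conjgM mulgV conjg1 eqxx andbT.
  by rewrite (subsetP sHG) // -mem_conjgV.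
have -> : (D :&: setX G H)%G = conj_graph_group g H.
  apply/group_inj/setP => -[a h]; rewrite inE inD in_setX in_conj_graph.
  case: (boolP (h \in H)) => [hH|]; last by rewrite !andbF.
  rewrite (subsetP sHG) //= andbT andbC; case: eqP => [->|]; last by rewrite andbF.
  by rewrite groupJ ?groupV // (subsetP sHG).
by [].
Qed.

(** Axiom (iv) is applied to D inside p_1(D) x H; intersecting D with p_1(D) x K or with G x K gives
    the same group. *)
Lemma splus_starg (G H : fgrp) (D : {group fgT G * fgT H}) (K : {group fgT H}) :
    cG H -> splus cG cS D -> K \subset H -> cG (FGrp K) ->
  cG (FGrp (starg_group D K)) /\
  @cS (FGrp (starg_group D K)) (FGrp K) (D :&: setX G K)%G.
Proof.
move=> HH [sD D1 DS] sK KK; have [c s] := pa_starg ax D1 HH DS sK KK.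
suff e : (D :&: setX (proj1_group D) K)%G = (D :&: setX G K)%G.
  by split=> //; move: s; rewrite -e.
apply/group_inj/setP => -[a h]; rewrite !(inE, in_setI) /=.
case: (boolP ((a, h) \in D)) => //= aD; have /setXP[-> _] := subsetP sD _ aD.
by congr andb; apply/imsetP; exists (a, h).
Qed.

(** Axiom (iii) is used with middle group p_1(E). Axiom (iv) puts D, cut down to G x p_1(E), into
    S(D * p_1(E), p_1(E)), while E lies in S(p_1(E), K). The cut does not change the star product,
    whose first projection is D * p_1(E). *)
Lemma splus_star (G H K : fgrp) (D : {group fgT G * fgT H}) (E : {group fgT H * fgT K}) :
    cG G -> cG H -> cG K -> splus cG cS D -> splus cG cS E ->
  splus cG cS (star_group D E).
Proof.
move=> GG HH KK DP [sE E1 ES].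
have sE1 : proj1_group E \subset H.
  by apply/subsetP => _ /imsetP[[h k] /(subsetP sE)/setXP[hH _] ->].
have [c s] := splus_starg HH DP sE1 E1.
have e1 : starg_group D (proj1_group E) = proj1_group (star_group D E).
  apply/group_inj/setP => g; rewrite inE; apply/exists_inP/imsetP.
    move=> [_ /imsetP[[h k] hE ->] ghD]; exists (g, k) => //.
    by rewrite inE; apply/existsP; exists h; rewrite ghD.
  move=> [[g' k]]; rewrite inE => /existsP[h /andP[/= gD hE]] -> /=.
  by exists h => //; apply/imsetP; exists (h, k).
have e2 : star_group (D :&: setX G (proj1_group E))%G E = star_group D E.
  apply/group_inj/setP => -[g k]; rewrite !inE /=; apply: eq_existsb => h.
  rewrite !inE /=; case: (boolP ((h, k) \in E)) => hE; rewrite ?andbF // !andbT.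
  case: (boolP ((g, h) \in D)) => //= gD; have [sD _ _] := DP.
  have /setXP[-> _] := subsetP sD _ gD.
  by apply/imsetP; exists (h, k).
split.
- apply/subsetP => -[g k]; rewrite inE => /existsP[h /andP[gD hE]].
  have [sD _ _] := DP; have /setXP[gG _] := subsetP sD _ gD.
  by have /setXP[_ kK] := subsetP sE _ hE; rewrite inE gG.
- by rewrite -e1.
- by have := pa_star ax c E1 KK s ES; rewrite e2 -e1.
Qed.

(** Axiom (ii) for p_1(D) x H does not cover conjugation by an element g outside p_1(D), which may
    turn p_1(D) into another group. Composition with the conjugation graph does. *)
Lemma splus_lact (G H : fgrp) (U : finType) (A : biset_on G H U) g u :
  cG G -> cG H -> g \in G ->
  splus cG cS (bstab A u) -> splus cG cS (bstab A (lact A g u)).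
Proof.
move=> GG HH gG [sD D1 DS].
have s1 : proj1_group (bstab A u) \subset G.
  by apply/subsetP => _ /imsetP[[h k] /(subsetP sD)/setXP[hH _] ->].
have [c s] := pair_conj_graph GG s1 D1 gG.
have e : star_group (conj_graph_group g (proj1_group (bstab A u))) (bstab A u) =
         bstab A (lact A g u).
  by apply/group_inj; rewrite bstab_lact //; exact: star_conj_graph.
have e1 : (proj1_group (bstab A u) :^ g^-1)%G = proj1_group (bstab A (lact A g u)).
  apply/group_inj/setP => a; rewrite mem_conjgV.
  apply/imsetP/imsetP => -[[b h]].
    move=> hD eb; exists (a, h) => //.
    by rewrite bstab_lact // inE /= eb.
  by rewrite bstab_lact // inE => hD /= ->; exists (b ^ g, h).
split; rewrite ?bstab_sub -?e1 //.
by have := pa_star ax c D1 HH s DS; rewrite e.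
Qed.

(** Here p_1 is unchanged and (1, h) lies in p_1(D) x H, so axiom (ii) applies directly. *)
Lemma splus_ract (G H : fgrp) (U : finType) (A : biset_on G H U) h u :
  cG G -> cG H -> h \in H ->
  splus cG cS (bstab A u) -> splus cG cS (bstab A (ract A u h)).
Proof.
move=> GG HH hH [sD D1 DS].
have xX : (1, h) \in setX (proj1_group (bstab A u)) H.
  by apply/setXP; split; rewrite ?group1.
have e : (bstab A u :^ (1%g, h))%G = bstab A (ract A u h).
  apply/group_inj; rewrite -[in RHS](invgK h) bstab_ract ?groupV //.
  by apply/setP => -[a b]; rewrite [in RHS]inE mem_conj_pair invg1 conjg1.
have e1 : proj1_group (bstab A u) = proj1_group (bstab A (ract A u h)).
  rewrite -e; apply/group_inj/setP => a; apply/imsetP/imsetP => -[[b k] kD /= ->].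
    by exists (b, k ^ h) => //; rewrite mem_conj_pair invg1 conjg1 conjgK.
  exists (b, k ^ h^-1) => //.
  by move: kD; rewrite mem_conj_pair invg1 conjg1.
split; rewrite ?bstab_sub -?e1 //.
by have := pa_conj ax D1 HH DS xX; rewrite e.
Qed.

End AdmissiblePairs.

Lemma star_conj_graph_r (gT hT : finGroupType) (h : hT) (K : {group hT})
    (D : {set gT * hT}) :
  star_set D (conj_graph h K) = [set p | (p.2 \in K) && ((p.1, p.2 ^ h^-1)%g \in D)].
Proof.
apply/setP => -[g k]; rewrite !inE /=; apply/existsP/andP => [[y]|[kK gk]].
  by rewrite in_conj_graph => /and3P[gy kK /eqP <-].
by exists (k ^ h^-1)%g; rewrite gk in_conj_graph kK eqxx.
Qed.

(** * Action of transitive bisets on values of F *)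

Section Values.
Variables (cG : fgrp -> Prop).
Variable (cS : forall G H : fgrp, {group fgT G * fgT H} -> Prop).
Hypothesis ax : pair_axioms cG cS.
Variables (R : comPzRingType) (F : biset_functor cG cS R).

(* Values of F at varying subgroups of one group, so that equations between
   them need no transport. *)
Definition zval (gT : finGroupType) := {L : {group gT} & F (FGrp L)}.

(** The source is read off z, whereas the target L has to be supplied, as the set D does not
    determine it. *)
Definition zop (gT hT : finGroupType) (L : {group gT}) (D : {set gT * hT})
    (z : zval hT) : zval gT :=
  tg (fmap F (@trans_cls (FGrp L) (FGrp (tag z)) D) (tagged z)).

Definition zconj (gT : finGroupType) (g : gT) (z : zval gT) : zval gT :=
  tg (fconj g (tagged z)).

Lemma zconjE (gT : finGroupType) (g : gT) (z : zval gT) :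
  zconj g z = zop (tag z :^ g^-1)%G (conj_graph g (tag z)) z.
Proof. by []. Qed.

Lemma zconj_tg (gT : finGroupType) (g : gT) (L : {group gT}) (a : F (FGrp L)) :
  zconj g (tg a) = zop (L :^ g^-1)%G (conj_graph g L) (tg a).
Proof. by []. Qed.

Lemma homS_trans (G H : fgrp) (D : {group fgT G * fgT H}) :
  cS D -> homS cS (trans_cls D).
Proof. by move=> DS; apply: zspan_gen; exists D. Qed.

Lemma zop_comp (gT hT kT : finGroupType) (L : {group gT}) (M : {group hT})
    (D : {group gT * hT}) (E : {group hT * kT}) (z : zval kT) :
    cG (FGrp L) -> cG (FGrp M) -> cG (FGrp (tag z)) ->
    @cS (FGrp L) (FGrp M) D -> @cS (FGrp M) (FGrp (tag z)) E ->
    M \subset ([set p.2 | p in D] * proj1_set E)%g ->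
  zop L D (zop M E z) = zop L (star_set D E) z.
Proof.
move=> LL MM ZZ DS ES sM; rewrite /zop /=; congr tg.
have sD := pa_sub ax LL MM DS; have sE := pa_sub ax MM ZZ ES.
rewrite -(@trans_cls_comp (FGrp L) (FGrp M) (FGrp (tag z)) D E sD sE sM).
by rewrite (fmap_comp F LL MM ZZ (homS_trans DS) (homS_trans ES)).
Qed.

Lemma zop_conj_graph (gT : finGroupType) (L : {group gT}) g (a : F (FGrp L)) :
  cG (FGrp L) -> g \in L -> zop L (conj_graph g L) (tg a) = tg a.
Proof.
move=> LL gL; rewrite /zop /=; congr tg.
by rewrite (@trans_cls_conj_graph (FGrp L)) // fmap1.
Qed.

Lemma zconj_id (gT : finGroupType) (L : {group gT}) g (a : F (FGrp L)) :
  cG (FGrp L) -> g \in L -> zconj g (tg a) = tg a.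
Proof.
move=> LL gL; rewrite zconjE /= (_ : (L :^ g^-1)%G = L) ?zop_conj_graph //.
by apply/group_inj/conjGid; rewrite groupV.
Qed.

(** The graph of conjugation by h projects onto ^hL, so the Mackey case applies, and the star
    product of the two graphs is the graph of conjugation by g h. *)
Lemma zconjM (G : fgrp) (g h : fgT G) (z : zval (fgT G)) :
    cG G -> tag z \subset G -> cG (FGrp (tag z)) -> g \in G -> h \in G ->
  zconj (g * h)%g z = zconj g (zconj h z).
Proof.
case: z => L a /= GG sL LL gG hG.
have [c s] := pair_conj_graph ax GG sL LL hG.
have sL' : (L :^ h^-1)%g \subset G by rewrite -(conjGid (groupVr hG)) conjSg.
have [c' s'] := pair_conj_graph ax GG sL' c gG.
rewrite !zconjE zop_comp //=; last first.
  rewrite proj1_conj_graph mulg_subr //.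
  by apply/imsetP; exists 1%g => //; exact: group1.
congr (zop _ _); first by apply/group_inj; rewrite /= -conjsgM invMg.
rewrite star_conj_graph ?proj1_conj_graph //; apply/setP => -[a' b].
rewrite inE /= !in_conj_graph; congr andb.
by rewrite invMg conjgM (can2_eq (conjgK _) (conjgKV _)) .
Qed.

Lemma zconj1 (G : fgrp) (z : zval (fgT G)) : cG (FGrp (tag z)) -> zconj 1%g z = z.
Proof. by case: z => L a LL; apply: zconj_id. Qed.

End Values.

(** * Isomorphisms in Gamma_F(G) from common parametrizations *)

Section GammaSpan.
Variables (cG : fgrp -> Prop).
Variable (cS : forall G H : fgrp, {group fgT G * fgT H} -> Prop).
Variables (R : comPzRingType) (F : biset_functor cG cS R) (G : fgrp).

Lemma gm_cG (A : gamma F G) x : cG (FGrp (gstab A x)).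
Proof. by have [+ _] := gm_obj A; exact. Qed.

Lemma gm_secE (A : gamma F G) g x : g \in G ->
  tg (gm_sec A (gact A g x)) = zconj g (tg (gm_sec A x)).
Proof. by have [_ +] := gm_obj A; exact. Qed.

(** If t' represents the translate of t by g, then g fixes p t exactly when p t = p t', a condition
    that is the same for q. *)
Lemma gstab_span (X Y : finType) (T : Type) (A : gset_on G X) (B : gset_on G Y)
    (p : T -> X) (q : T -> Y) t :
    (forall t', p t = p t' <-> q t = q t') ->
    (forall g, g \in G ->
       exists2 t', p t' = gact A g (p t) & q t' = gact B g (q t)) ->
  gstab A (p t) = gstab B (q t).
Proof.
move=> pq pact; apply/group_inj/setP => g; rewrite !inE.
case: (boolP (g \in G)) => //= /pact[t' <- <-].
by apply/eqP/eqP => /esym/pq/esym.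
Qed.

Lemma gamma_iso_span (A B : gamma F G) (T : Type) (p : T -> A) (q : T -> B) :
    (forall a, exists t, p t = a) -> (forall b, exists t, q t = b) ->
    (forall t t', p t = p t' <-> q t = q t') ->
    (forall g t, g \in G ->
       exists2 t', p t' = gact A g (p t) & q t' = gact B g (q t)) ->
    (forall t, tg (gm_sec B (q t)) = tg (gm_sec A (p t))) ->
  gamma_iso A B.
Proof.
move=> sp sq pq pact psec; have [f [f' [fK f'K fp f'q]]] := span_bij sp sq pq.
exists f, f'; split=> //; split=> [g a gG|a].
- have [t <-] := sp a; have [t' <- qt'] := pact g t gG.
  by rewrite !fp.
- by have [t <-] := sp a; rewrite fp.
- have [t <-] := sq a; have [t' pt' <-] := pact g t gG.
  by rewrite !f'q.
- by have [t <-] := sq a; rewrite f'q.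
Qed.

End GammaSpan.

(** * The functors Gamma_F(U) *)

Section Induced.
Variables (cG : fgrp -> Prop).
Variable (cS : forall G H : fgrp, {group fgT G * fgT H} -> Prop).
Hypothesis ax : pair_axioms cG cS.
Variables (R : comPzRingType) (F : biset_functor cG cS R).
Variables (G H : fgrp).
Hypotheses (GG : cG G) (HH : cG H).
Variable U : biset G H.
Hypothesis UP : forall u, splus cG cS (bstab U u).
Variable X : gamma F H.

Notation T := (tens_gset_on U X).
Notation cl := (tcl H (ract U) (gact X)).

Definition ten_sec : sect F T := fun O =>
  fmap F (@trans_cls (FGrp (gstab T O)) (FGrp (gstab X (trep O).2))
     (bstab U (trep O).1 :&: setX G (gstab X (trep O).2))) (gm_sec X (trep O).2).

(** The value U(s)([u, x]) computed from the given pair (u, x), whereas [ten_sec] uses the pair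
    picked by [trep]. *)
Definition ten_val u x : zval F (fgT G) :=
  zop (gstab T (cl (u, x))) (bstab U u :&: setX G (gstab X x)) (tg (gm_sec X x)).

Lemma ten_stab u x :
  cG (FGrp (gstab T (cl (u, x)))) /\
  @cS (FGrp (gstab T (cl (u, x)))) (FGrp (gstab X x))
    (bstab U u :&: setX G (gstab X x))%G.
Proof.
have [c s] := splus_starg ax HH (UP u) (gstab_sub X x) (gm_cG x).
by rewrite gstab_tens.
Qed.

(** By equivariance s(h x) = ^h s(x), so the left side is a composite whose right factor is a
    conjugation graph. The star product with this graph undoes the passage from the stabilizer of u
    to that of u h^-1. *)
Lemma ten_val_act h u x : h \in H ->
  ten_val (ract U u h^-1)%g (gact X h x) = ten_val u x.
Proof.
move=> hH; rewrite /ten_val gm_secE // zconj_tg.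
have [c s] := ten_stab (ract U u h^-1)%g (gact X h x).
have [c' s'] := pair_conj_graph ax HH (gstab_sub X x) (gm_cG x) hH.
rewrite (gstab_act X x hH) in s *.
rewrite (zop_comp (z := tg (gm_sec X x)) ax c c' (gm_cG x) s s'); last first.
  rewrite proj1_conj_graph mulg_subr //.
  by apply/imsetP; exists 1%g => //; exact: group1.
congr (zop (gstab T _)) => //.
  by apply/gcl_eq; exists h^-1%g; rewrite ?groupV //= invgK ractKV ?gactK.
rewrite star_conj_graph_r; apply/setP => -[g k]; rewrite [in LHS]inE !in_setI.
rewrite bstab_ract // [in X in _ && X]inE /= !in_setX.
rewrite -conjgM mulVg conjg1 memJ_conjg.
by case: (k \in _); rewrite ?andbF ?andbT.
Qed.

Lemma ten_secE u x : tg (ten_sec (cl (u, x))) = ten_val u x.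
Proof.
have -> : tg (ten_sec (cl (u, x))) =
          ten_val (trep (cl (u, x))).1 (trep (cl (u, x))).2.
  by rewrite /ten_val -surjective_pairing trepK.
have /gcl_eq[h hH ->] : cl (u, x) = cl (trep (cl (u, x))) by rewrite trepK.
exact: ten_val_act.
Qed.

Lemma ten_sec_obj : gamma_obj ten_sec.
Proof.
split=> [O|g O gG]; rewrite -[O]trepK; case: (trep O) => u x.
  by have [] := ten_stab u x.
rewrite gact_tens // ten_secE.
have -> : tg (fconj g (ten_sec (cl (u, x)))) = zconj g (ten_val u x).
  by rewrite -ten_secE.
have [c s] := ten_stab u x.
have [c' s'] := pair_conj_graph ax GG (gstab_sub T _) c gG.
(* In this composite it is the left factor, the conjugation graph on G_[u,x], that projects onto the
   middle group. *)
rewrite [zconj _ _]zconjE (zop_comp (z := tg (gm_sec X x)) ax c' c (gm_cG x) s' s); last first.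
  apply: subset_trans (mulg_subl _ _); last first.
    by apply/imsetP; exists 1%g => //; exact: group1.
  apply/subsetP => k kT; apply/imsetP; exists (k ^ g^-1, k)%g => //.
  by rewrite in_conj_graph kT eqxx.
congr zop; first by rewrite -gstab_act ?gact_tens.
rewrite star_conj_graph.
  apply/setP => -[a k]; rewrite [in RHS]inE !in_setI bstab_lact // [in LHS]inE.
  by rewrite !in_setX groupJr.
have /subsetP sD := pa_sub ax c (gm_cG x) s.
by apply/subsetP => _ /imsetP[[a k] /sD/setXP[aT _] ->].
Qed.

Definition ten_gamma : gamma F G := Gamma (GammaOn ten_sec_obj).

Lemma ten_induced : induced_sec (gm_sec X) ten_sec.
Proof. by move=> u x; apply: tg_inj; exact: ten_secE. Qed.

End Induced.

Section InducedIso.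
Variables (cG : fgrp -> Prop).
Variable (cS : forall G H : fgrp, {group fgT G * fgT H} -> Prop).
Hypothesis ax : pair_axioms cG cS.
Variables (R : comPzRingType) (F : biset_functor cG cS R).

Definition splus_biset (G H : fgrp) (U : biset G H) : Prop :=
  forall u, splus cG cS (bstab U u).

Lemma zop_eq (gT hT : finGroupType) (L L' : {group gT}) (D D' : {set gT * hT})
    (z z' : zval F hT) : L = L' -> D = D' -> z = z' -> zop L D z = zop L' D' z'.
Proof. by move=> -> -> ->. Qed.

Lemma gamma_hom_gstab (G : fgrp) (A B : gamma F G) (f : A -> B) x :
  gamma_hom f -> gstab B (f x) = gstab A x.
Proof. by move=> [_ fs]; have /(congr1 (@projT1 _ _)) := fs x. Qed.

Section One.
Variables (G H : fgrp) (GG : cG G) (HH : cG H).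
Notation ten UP X := (ten_gamma ax GG HH UP X).

Lemma sec_ten (U : biset G H) (UP : splus_biset U) (X : gamma F H) u x :
  tg (gm_sec (ten UP X) (tcl H (ract U) (gact X) (u, x))) = ten_val u x.
Proof. exact: ten_secE. Qed.

Lemma tcl_exists (U : biset G H) (X : finType) (A : gset_on H X)
  (O : tens H (ract U) (gact A)) : exists p, tcl H (ract U) (gact A) p = O.
Proof. by exists (trep O); rewrite trepK. Qed.

Lemma ten_isoX (U : biset G H) (UP : splus_biset U) (X Y : gamma F H) :
  gamma_iso X Y -> gamma_iso (ten UP X) (ten UP Y).
Proof.
move=> [f [f' [fh f'h fK f'K]]].
pose p := tcl H (ract U) (gact X).
pose q (t : U * X) := tcl H (ract U) (gact Y) (t.1, f t.2).
have pq t t' : p t = p t' <-> q t = q t'.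
  split=> /gcl_eq[h hH e]; apply/gcl_eq; exists h => //.
    by rewrite e /=; have [-> ] := fh.
  case: t t' e => u x [u' x'] /= [-> e]; congr pair.
  by apply: (can_inj fK); rewrite e; have [-> ] := fh.
have pact g t : g \in G -> exists2 t', p t' = gact (tens_gset_on U X) g (p t) &
    q t' = gact (tens_gset_on U Y) g (q t).
  by move=> gG; exists (lact U g t.1, t.2); rewrite ?gact_tens.
apply: (@gamma_iso_span _ _ _ _ _ (ten UP X) (ten UP Y) _ p q) => //.
- by move=> O; exact: tcl_exists.
- move=> O; have [[u y] <-] := tcl_exists O.
  by exists (u, f' y); rewrite /q /= f'K.
- move=> [u x]; rewrite /q /p !sec_ten /ten_val; apply: zop_eq.
  + by apply/esym/(@gstab_span _ _ _ _ _ _ p q) => [t'|g gG]; [exact: pq|exact: pact].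
  + by rewrite (gamma_hom_gstab _ fh).
  + by have [_ ->] := fh.
Qed.

Lemma ten_sumX (U : biset G H) (UP : splus_biset U) (X Y : gamma F H) :
  gamma_iso (ten UP (sum_gamma X Y)) (sum_gamma (ten UP X) (ten UP Y)).
Proof.
pose XY := sum_gamma X Y; pose TXY := sum_gamma (ten UP X) (ten UP Y).
pose p := tcl H (ract U) (gact XY).
pose q (t : U * XY) : TXY := match t.2 with
  | inl x => inl (tcl H (ract U) (gact X) (t.1, x))
  | inr y => inr (tcl H (ract U) (gact Y) (t.1, y)) end.
have pq t t' : p t = p t' <-> q t = q t'.
  case: t t' => u [x|y] [u' [x'|y']]; split=> //.
  - by move=> /gcl_eq[h hH [-> ->]]; congr inl; apply/gcl_eq; exists h.
  - by move=> e; have /gcl_eq[h hH [-> ->]] := inl_inj e; apply/gcl_eq; exists h.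
  - by move=> /gcl_eq[h hH []].
  - by move=> /gcl_eq[h hH []].
  - by move=> /gcl_eq[h hH [-> ->]]; congr inr; apply/gcl_eq; exists h.
  - by move=> e; have /gcl_eq[h hH [-> ->]] := inr_inj e; apply/gcl_eq; exists h.
have pact g t : g \in G -> exists2 t', p t' = gact (tens_gset_on U XY) g (p t) &
    q t' = gact TXY g (q t).
  move=> gG; exists (lact U g t.1, t.2); first by rewrite gact_tens.
  by case: t => u [x|y]; rewrite /q /=; congr (_ _); exact/esym/gact_tens.
apply: (@gamma_iso_span _ _ _ _ _ (ten UP XY) TXY _ p q) => //.
- by move=> O; exact: tcl_exists.
- case=> O; have [[u x] <-] := tcl_exists O.
    by exists (u, inl x).
  by exists (u, inr x).
- move=> t; have e : gstab (tens_gset_on U XY) (p t) = gstab TXY (q t).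
    by apply: (@gstab_span _ _ _ _ _ _ p q) => [t'|g gG]; [exact: pq|exact: pact].
  move: e; case: t => u [x|y] e; rewrite /p sec_ten [LHS]tg_fcast.
    rewrite [LHS](sec_ten UP) /ten_val; apply: zop_eq.
    + by rewrite [RHS]e; apply: gstab_inl.
    + by rewrite -gstab_inl.
    + by rewrite [RHS]tg_fcast.
  rewrite [LHS](sec_ten UP) /ten_val; apply: zop_eq.
  + by rewrite [RHS]e; apply: gstab_inr.
  + by rewrite -gstab_inr.
  + by rewrite [RHS]tg_fcast.
Qed.

(** The underlying G-set U x_H X depends on [A] alone, so the identity map is an isomorphism onto
    the pointwise sum of the two induced sections. *)
Lemma ten_add (U : biset G H) (UP : splus_biset U) (X : finType)
    (A : gset_on H X) (s t : sect F A) (sP : gamma_obj s) (tP : gamma_obj t) :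
  gcls (ten UP (Gamma (GammaOn (add_gamma_obj sP tP)))) =
  gcls (ten UP (Gamma (GammaOn sP))) + gcls (ten UP (Gamma (GammaOn tP))).
Proof.
rewrite -[RHS]gcls_add; apply: gcls_iso; apply: sec_gamma_iso => O.
by rewrite /ten_sec /add_sec /= raddfD.
Qed.

Lemma ten_scale (U : biset G H) (UP : splus_biset U) r (X : gamma F H) :
  gamma_iso (ten UP (scale_gamma r X)) (scale_gamma r (ten UP X)).
Proof.
apply: sec_gamma_iso => O.
by rewrite /ten_sec /scale_sec /= linearZ.
Qed.

Lemma biset_iso_bstab (U V : biset G H) (f : U -> V) u :
    injective f ->
    {in G, forall g u, f (lact U g u) = lact V g (f u)} ->
    {in H, forall h u, f (ract U u h) = ract V (f u) h} ->
  bstab V (f u) = bstab U u.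
Proof.
move=> fI fl fr; apply/group_inj/setP => -[g h].
case: (boolP ((g, h) \in setX G H)) => [/setXP[gG hH]|ghX].
  by rewrite !in_bstab // -fl // -fr // (inj_eq fI).
by rewrite !(contraNF (subsetP (bstab_sub _ _) (g, h)) ghX).
Qed.

Lemma ten_isoU (U V : biset G H) (UP : splus_biset U) (VP : splus_biset V)
    (X : gamma F H) :
  biset_iso U V -> gamma_iso (ten UP X) (ten VP X).
Proof.
move=> [f [[f' fK f'K] [fl fr]]].
pose p := tcl H (ract U) (gact X).
pose q (t : U * X) := tcl H (ract V) (gact X) (f t.1, t.2).
have pq t t' : p t = p t' <-> q t = q t'.
  split=> /gcl_eq[h hH e]; apply/gcl_eq; exists h => //.
    by rewrite e /= fr ?groupV.
  case: t t' e => u x [u' x'] /= [e ->]; congr pair.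
  by apply: (can_inj fK); rewrite e fr ?groupV.
have pact g t : g \in G -> exists2 t', p t' = gact (tens_gset_on U X) g (p t) &
    q t' = gact (tens_gset_on V X) g (q t).
  by move=> gG; exists (lact U g t.1, t.2); rewrite ?gact_tens // -fl.
apply: (@gamma_iso_span _ _ _ _ _ (ten UP X) (ten VP X) _ p q) => //.
- by move=> O; exact: tcl_exists.
- move=> O; have [[u x] <-] := tcl_exists O.
  by exists (f' u, x); rewrite /q /= f'K.
- move=> [u x]; rewrite /q /p !sec_ten /ten_val; apply: zop_eq => //.
    by apply/esym/(@gstab_span _ _ _ _ _ _ p q) => [t'|g gG]; [exact: pq|exact: pact].
  by rewrite (biset_iso_bstab _ (can_inj fK)).
Qed.

Lemma ten_sumU (U V : biset G H) (UP : splus_biset U) (VP : splus_biset V)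
    (UVP : splus_biset (sum_biset U V)) (X : gamma F H) :
  gamma_iso (ten UVP X) (sum_gamma (ten UP X) (ten VP X)).
Proof.
pose UV := sum_biset U V; pose TUV := sum_gamma (ten UP X) (ten VP X).
pose p := tcl H (ract UV) (gact X).
pose q (t : UV * X) : TUV := match t.1 with
  | inl u => inl (tcl H (ract U) (gact X) (u, t.2))
  | inr v => inr (tcl H (ract V) (gact X) (v, t.2)) end.
have pq t t' : p t = p t' <-> q t = q t'.
  case: t t' => [[u|v] x] [[u'|v'] x']; split=> //.
  - by move=> /gcl_eq[h hH [-> ->]]; congr inl; apply/gcl_eq; exists h.
  - by move=> e; have /gcl_eq[h hH [-> ->]] := inl_inj e; apply/gcl_eq; exists h.
  - by move=> /gcl_eq[h hH []].
  - by move=> /gcl_eq[h hH []].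
  - by move=> /gcl_eq[h hH [-> ->]]; congr inr; apply/gcl_eq; exists h.
  - by move=> e; have /gcl_eq[h hH [-> ->]] := inr_inj e; apply/gcl_eq; exists h.
have pact g t : g \in G -> exists2 t', p t' = gact (tens_gset_on UV X) g (p t) &
    q t' = gact TUV g (q t).
  move=> gG; exists (lact UV g t.1, t.2); first by rewrite gact_tens.
  by case: t => [[u|v] x]; rewrite /q /=; congr (_ _); exact/esym/gact_tens.
apply: (@gamma_iso_span _ _ _ _ _ (ten UVP X) TUV _ p q) => //.
- by move=> O; exact: tcl_exists.
- case=> O; have [[u x] <-] := tcl_exists O.
    by exists (inl u, x).
  by exists (inr u, x).
- move=> t; have e : gstab (tens_gset_on UV X) (p t) = gstab TUV (q t).
    by apply: (@gstab_span _ _ _ _ _ _ p q) => [t'|g gG]; [exact: pq|exact: pact].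
  move: e; case: t => [[u|v] x] e; rewrite /p sec_ten [LHS]tg_fcast.
    rewrite [LHS](sec_ten UP) /ten_val; apply: zop_eq => //.
    by rewrite [RHS]e; apply: gstab_inl.
  rewrite [LHS](sec_ten VP) /ten_val; apply: zop_eq => //.
  by rewrite [RHS]e; apply: gstab_inr.
Qed.
End One.
End InducedIso.

(** * Unit and associativity isomorphisms *)

Section Composites.
Variables (cG : fgrp -> Prop).
Variable (cS : forall G H : fgrp, {group fgT G * fgT H} -> Prop).
Hypothesis ax : pair_axioms cG cS.
Variables (R : comPzRingType) (F : biset_functor cG cS R).

Lemma splus_reg (G : fgrp) : cG G -> splus_biset cG cS (reg_biset G).
Proof.
case: G => gT G GG u; have uG := subgP u; rewrite bstab_reg.
have [] := @pair_conj_graph _ _ ax (FGrp G) G (sgval u) GG (subxx G) GG uG.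
have -> : (G :^ (sgval u)^-1)%G = proj1_group (conj_graph_group (sgval u) G).
  by apply/group_inj; rewrite /= proj1_conj_graph.
split=> //; have := conj_graph_sub (sgval u) G.
by rewrite conjGid ?groupV.
Qed.

Lemma in_star (gT hT kT : finGroupType) (D : {set gT * hT}) (E : {set hT * kT}) g k :
  ((g, k) \in star_set D E) = [exists h, ((g, h) \in D) && ((h, k) \in E)].
Proof. by rewrite inE. Qed.

Lemma splus_tens (G H K : fgrp) (U : biset G H) (V : biset H K) :
    cG G -> cG H -> cG K -> splus_biset cG cS U -> splus_biset cG cS V ->
  splus_biset cG cS (tens_biset U V).
Proof.
move=> GG HH KK UP VP O; rewrite -[O]trepK; case: (trep O) => u v.
by rewrite bstab_tens; apply: (splus_star ax GG HH KK).
Qed.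

(** The isomorphism is [u, x] |-> u x. Cutting the stabilizer of u down to G x G_x leaves the graph
    of conjugation by u on G_x, so the induced value at [u, x] is ^u s(x) = s(u x). *)
Lemma ten_reg (G : fgrp) (GG : cG G) (UP : splus_biset cG cS (reg_biset G))
    (X : gamma F G) :
  gamma_iso (ten_gamma ax GG GG UP X) X.
Proof.
pose U := reg_biset G; pose p := tcl G (ract U) (gact X).
pose q (t : U * X) : X := gact X (sgval t.1) t.2.
have pq t t' : p t = p t' <-> q t = q t'.
  case: t t' => u x [u' x']; have uG := subgP u; have u'G := subgP u'.
  have pE := gcl_eq (bs_str U) X (u, x) (u', x').
  have qE : q (u, x) = q (u', x') <->
            gact X (sgval u) x = gact X (sgval u') x' by [].
  rewrite /p pE qE; split=> [[h hH [-> ->]]|e].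
    by rewrite /= /reg_ract subgK ?groupM ?groupV // gactM ?groupV // gactK.
  exists ((sgval u')^-1 * sgval u)%g; first by rewrite groupM ?groupV.
  rewrite /= gactM ?groupV // e gactK //; congr pair; apply: val_inj.
  by rewrite /= /reg_ract invMg invgK mulKVg sgvalK.
have pact g t : g \in G -> exists2 t', p t' = gact (tens_gset_on U X) g (p t) &
    q t' = gact X g (q t).
  move=> gG; exists (lact U g t.1, t.2); rewrite ?gact_tens //.
  by rewrite /q /= /reg_lact subgK ?groupM ?subgP // gactM ?subgP.
apply: (@gamma_iso_span _ _ _ _ _ (ten_gamma ax GG GG UP X) X _ p q) => //.
- by move=> O; exact: tcl_exists.
- move=> x; exists (subg G 1%g, x).
  by rewrite /q /= subgK ?group1 // gact1.
- move=> [u x]; have uG := subgP u.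
  rewrite /p sec_ten /q gm_secE // zconj_tg /ten_val; apply: zop_eq => //.
    rewrite -gstab_act //; apply/esym.
    by apply: (@gstab_span _ _ _ _ _ _ p q (u, x)) => [t'|g gG]; [exact: pq|exact: pact].
  apply/setP => -[a b]; rewrite bstab_reg inE in_setX !in_conj_graph.
  case: (boolP (b \in gstab X x)) => [bx|]; last by rewrite !andbF.
  rewrite (subsetP (gstab_sub X x)) //= andbT; apply/idP/andP => [e|[]//].
  have bG := subsetP (gstab_sub X x) _ bx.
  by split=> //; rewrite (eqP e) groupJ ?groupV.
Qed.

(** Triples (u, v, x) parametrize both [[u, v], x] and [u, [v, x]]. On sections the claim is the
    Mackey case with middle group H_[v,x], onto which the right factor projects. *)
Lemma ten_comp (G H K : fgrp) (GG : cG G) (HH : cG H) (KK : cG K)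
    (U : biset G H) (V : biset H K) (UP : splus_biset cG cS U)
    (VP : splus_biset cG cS V) (UVP : splus_biset cG cS (tens_biset U V))
    (X : gamma F K) :
  gamma_iso (ten_gamma ax GG KK UVP X) (ten_gamma ax GG HH UP (ten_gamma ax HH KK VP X)).
Proof.
pose UV := tens_biset U V; pose VX := ten_gamma ax HH KK VP X.
pose T := (U * V * X)%type.
pose clUV := tcl H (ract U) (lact V); pose clVX := tcl K (ract V) (gact X).
pose p (t : T) := tcl K (ract UV) (gact X) (clUV t.1, t.2).
pose q (t : T) := tcl H (ract U) (gact VX) (t.1.1, clVX (t.1.2, t.2)).
have ractUV u v k : k \in K -> ract UV (clUV (u, v)) k = clUV (u, ract V v k).
  exact: ract_tens.
have gactVX h v x : h \in H -> gact VX h (clVX (v, x)) = clVX (lact V h v, x).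
  exact: gact_tens.
have pq t t' : p t = p t' <-> q t = q t'.
  case: t t' => -[u v] x [[u' v'] x']; split.
    move=> /gcl_eq[k kK e]; have -> : x' = gact X k x := congr1 snd e.
    have : clUV (u', v') = ract UV (clUV (u, v)) k^-1 := congr1 fst e.
    rewrite ractUV ?groupV // => /esym/bcl_eq[h hH [-> ->]].
    apply/gcl_eq; exists h => //.
    have -> : gact VX h (clVX (v, x)) = clVX (lact V h v, x) by exact: gactVX.
    congr pair; apply/esym/gcl_eq; exists k => //=.
    by rewrite lractA ?groupV.
  move=> /gcl_eq[h hH e]; have -> : u' = ract U u h^-1 := congr1 fst e.
  have : clVX (v', x') = gact VX h (clVX (v, x)) := congr1 snd e.
  rewrite gactVX // => /esym/gcl_eq[k kK [-> ->]]; apply/gcl_eq; exists k => //.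
  have -> : ract UV (clUV (u, v)) k^-1 = clUV (u, ract V v k^-1)%g.
    by apply: ractUV; rewrite groupV.
  congr pair; apply/esym/bcl_eq; exists h => //=.
  by rewrite lractA ?groupV.
have pact g t : g \in G -> exists2 t', p t' = gact (tens_gset_on UV X) g (p t) &
    q t' = gact (tens_gset_on U VX) g (q t).
  case: t => -[u v] x gG; exists (lact U g u, v, x).
    rewrite [RHS](gact_tens (U := UV) (gm_set X) (clUV (u, v), x) gG).
    have -> : lact UV g (clUV (u, v), x).1 = clUV (lact U g u, v).
      exact: (lact_tens (u, v) gG).
    by [].
  by rewrite [RHS](gact_tens (gm_set VX) (u, clVX (v, x)) gG).
apply: (@gamma_iso_span _ _ _ _ _ (ten_gamma ax GG KK UVP X)
          (ten_gamma ax GG HH UP VX) _ p q) => //.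
- move=> O; have [[O' x] <-] := tcl_exists O.
  by exists (trep O', x); rewrite /p /clUV /= trepK.
- move=> O; have [[u O'] <-] := tcl_exists O; exists (u, (trep O').1, (trep O').2).
  by rewrite /q /clVX /= -surjective_pairing trepK.
- move=> [[u v] x]; rewrite /p /q !sec_ten /=.
  have -> : ten_val u (clVX (v, x) : VX) =
      zop (gstab (tens_gset_on U VX) (q (u, v, x)))
        (bstab U u :&: setX G (gstab VX (clVX (v, x)))) (ten_val v x).
    by rewrite /ten_val (sec_ten ax HH KK VP).
  have [c s] := ten_stab ax HH UP u (clVX (v, x) : VX).
  have [c' s'] := ten_stab ax KK VP v x.
  rewrite [ten_val v x]/ten_val (zop_comp (z := tg (gm_sec X x)) ax c c' (gm_cG x) s s').
    apply: zop_eq => //.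
      apply/esym.
      by apply: (@gstab_span _ _ _ _ _ _ p q (u, v, x)) => [t'|g gG]; [exact: pq|exact: pact].
    apply/setP => -[g k]; rewrite in_setI bstab_tens in_setX !in_star.
    apply/existsP/andP => [[h]|[/existsP[h /andP[gh hk]] /andP[gG kx]]].
      rewrite !in_setI !in_setX => /andP[/andP[gh /andP[gG hx]] /andP[hk /andP[hH kx]]].
      by split; [apply/existsP; exists h; rewrite gh|rewrite gG kx].
    have /setXP[hH _] := subsetP (bstab_sub _ _) _ hk.
    exists h; rewrite !in_setI gh hk !in_setX gG kx hH !(andbT, andTb).
    (* The intermediate h lies in H_[v,x] automatically, since (h, k) stabilizes v and k fixes x;
       restricting the stabilizer of u to G x H_[v,x] loses nothing. *)
    have -> : gstab VX (clVX (v, x)) = starg_group (bstab V v) (gstab X x).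
      exact: gstab_tens.
    by rewrite inE; apply/exists_inP; exists k.
  apply: subset_trans (mulg_subr _ _); last first.
    by apply/imsetP; exists 1%g => //; exact: group1.
  apply/subsetP => h; rewrite gstab_tens inE => /exists_inP[k kx hk].
  have /setXP[hH _] := subsetP (bstab_sub _ _) _ hk.
  by apply/imsetP; exists (h, k); rewrite // in_setI hk in_setX hH.
Qed.

End Composites.

(** * The functor F_+ *)

Section GammaLift.
Variables (cG : fgrp -> Prop).
Variable (cS : forall G H : fgrp, {group fgT G * fgT H} -> Prop).
Variables (R : comPzRingType) (F : biset_functor cG cS R) (G : fgrp).

Lemma fplus_ind (Q : fplus F G -> Prop) :
    Q 0 -> (forall x y, Q x -> Q y -> Q (x - y)) -> (forall A, Q (gcls A)) ->
  forall x, Q x.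
Proof. by move=> Q0 QB QA; apply: pres_ind => // t; rewrite pgen_gcls. Qed.

Lemma fplus_hom_eq (V : zmodType) (f g : fplus F G -> V) :
    zmod_morphism f -> zmod_morphism g -> (forall A, f (gcls A) = g (gcls A)) ->
  f =1 g.
Proof. by move=> fB gB fg; apply: pres_hom_eq => // t; rewrite pgen_gcls. Qed.

Variables (V : zmodType) (f : gamma F G -> V).

(** The defining relations of F_+(G), read as conditions on an invariant f of objects; [glift] is
    the resulting universal property. *)
Record gamma_additive : Prop := GammaAdditive {
  gadd_iso : forall A B, gamma_iso A B -> f A = f B;
  gadd_sum : forall A B, f (sum_gamma A B) = f A + f B;
  gadd_add : forall X (A : gset_on G X) (s t : sect F A) (sP : gamma_obj s)
    (tP : gamma_obj t), f (Gamma (GammaOn (add_gamma_obj sP tP))) =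
                        f (Gamma (GammaOn sP)) + f (Gamma (GammaOn tP)) }.

Definition glift : fplus F G -> V := plift (fun t => f (big_gamma t)).

Hypothesis fP : gamma_additive.

Lemma glift_compat v : @grel _ _ _ F G v -> flift (f \o @big_gamma _ _ _ F G) v = 0.
Proof. by apply: grel_compat; case: fP. Qed.

Lemma glift_cls A : glift (gcls A) = f A.
Proof. exact: etrans (plift_gen glift_compat _) (gadd_iso fP (big_small_gamma A)). Qed.

Lemma gliftB : zmod_morphism glift.
Proof. exact: (plift_is_additive glift_compat). Qed.

End GammaLift.

Lemma zmod_morphD (U V : zmodType) (f : U -> V) :
  zmod_morphism f -> {morph f : x y / x + y}.
Proof.
move=> fB x y; have f0 : f 0 = 0 by rewrite -(subrr 0) fB subrr.
have fN z : f (- z) = - f z by rewrite -sub0r fB f0 sub0r.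
by rewrite -{1}[y]opprK fB fN opprK.
Qed.

Lemma fplus_scaleE (cG : fgrp -> Prop)
    (cS : forall G H : fgrp, {group fgT G * fgT H} -> Prop)
    (R : comPzRingType) (F : biset_functor cG cS R) (G : fgrp) r (A : gamma F G) :
  r *: gcls A = gcls (scale_gamma r A).
Proof. exact: fplus_scale_cls. Qed.

(** * The part of a biset with stabilizers in S_+, and its action on F_+ *)

Section GoodPart.
Variables (cG : fgrp -> Prop).
Variable (cS : forall G H : fgrp, {group fgT G * fgT H} -> Prop).
Hypothesis ax : pair_axioms cG cS.
Variables (G H : fgrp) (GG : cG G) (HH : cG H).

Section One.
Variable U : biset G H.

Definition gpart_car : Type := {u : U | `[< splus cG cS (bstab U u) >]}.
HB.instance Definition _ := Finite.on gpart_car.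

(** For g in G the translate stays in the part by [splus_lact]; the default u of [insubd] can only
    occur for g outside G, where actions are unconstrained. *)
Definition gpart_lact g (u : gpart_car) : gpart_car := insubd u (lact U g (val u)).
Definition gpart_ract (u : gpart_car) h : gpart_car := insubd u (ract U (val u) h).

Lemma gpart_lactE g u : g \in G -> val (gpart_lact g u) = lact U g (val u).
Proof.
move=> gG; rewrite insubdK //; apply/asboolP/(splus_lact ax) => //.
exact/asboolP/(valP u).
Qed.

Lemma gpart_ractE u h : h \in H -> val (gpart_ract u h) = ract U (val u) h.
Proof.
move=> hH; rewrite insubdK //; apply/asboolP/(splus_ract ax) => //.
exact/asboolP/(valP u).
Qed.

Lemma gpart_lact1 u : gpart_lact 1%g u = u.
Proof. by apply: val_inj; rewrite gpart_lactE ?lact1. Qed.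
Lemma gpart_lactM :
  {in G &, forall g h u, gpart_lact (g * h)%g u = gpart_lact g (gpart_lact h u)}.
Proof. by move=> g h gG hG u; apply: val_inj; rewrite !gpart_lactE ?groupM ?lactM. Qed.
Lemma gpart_ract1 u : gpart_ract u 1%g = u.
Proof. by apply: val_inj; rewrite gpart_ractE ?ract1. Qed.
Lemma gpart_ractM :
  {in H &, forall g h u, gpart_ract u (g * h)%g = gpart_ract (gpart_ract u g) h}.
Proof. by move=> g h gG hG u; apply: val_inj; rewrite !gpart_ractE ?groupM ?ractM. Qed.
Lemma gpart_lractA :
  {in G & H, forall g h u, gpart_lact g (gpart_ract u h) = gpart_ract (gpart_lact g u) h}.
Proof.
move=> g h gG hH u; apply: val_inj.
by rewrite gpart_lactE // !gpart_ractE // gpart_lactE // lractA.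
Qed.

Definition gpart : biset G H :=
  Biset (BisetOn gpart_lact1 gpart_lactM gpart_ract1 gpart_ractM gpart_lractA).

Lemma gpart_bstab (u : gpart) : bstab gpart u = bstab U (val u).
Proof.
apply/esym/(@biset_iso_bstab G H gpart U val); first exact: val_inj.
  by move=> g gG v; exact: gpart_lactE.
by move=> h hH v; exact: gpart_ractE.
Qed.

Lemma gpartP : splus_biset cG cS gpart.
Proof. by move=> u; rewrite gpart_bstab; exact/asboolP/(valP u). Qed.

Lemma gpart_id : splus_biset cG cS U -> biset_iso gpart U.
Proof.
move=> UP; exists val; split.
  have uP u : `[< splus cG cS (bstab U u) >] by apply/asboolP.
  exists (fun u => exist (fun u => `[< splus cG cS (bstab U u) >]) u (uP u)) => [u|u] //.
  exact: val_inj.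
by split=> [g gG u|h hH u]; [exact: gpart_lactE|exact: gpart_ractE].
Qed.
End One.

Lemma gpart_iso (U V : biset G H) : biset_iso U V -> biset_iso (gpart U) (gpart V).
Proof.
move=> [f [[f' fK f'K] [fl fr]]].
have fst u : bstab V (f u) = bstab U u by exact: biset_iso_bstab (can_inj fK) fl fr.
have fP (u : gpart U) : `[< splus cG cS (bstab V (f (val u))) >].
  by rewrite fst; exact: (valP u).
have f'P (v : gpart V) : `[< splus cG cS (bstab U (f' (val v))) >].
  by rewrite -fst f'K; exact: (valP v).
exists (fun u => exist (fun v => `[< splus cG cS (bstab V v) >]) _ (fP u)); split.
  exists (fun v => exist (fun u => `[< splus cG cS (bstab U u) >]) _ (f'P v)) => u.
    by apply: val_inj; rewrite /= fK.
  by apply: val_inj; rewrite /= f'K.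
split=> [g gG u|h hH u]; apply: val_inj.
  by rewrite [RHS]gpart_lactE //= gpart_lactE // fl.
by rewrite [RHS]gpart_ractE //= gpart_ractE // fr.
Qed.

(** A point of U or V keeps its stabilizer in the disjoint union, so membership in the part is
    decided in each summand. Together with [gpart_iso], this makes the action of the part respect
    the relations of B(G, H). *)
Lemma gpart_sum (U V : biset G H) :
  biset_iso (gpart (sum_biset U V)) (sum_biset (gpart U) (gpart V)).
Proof.
pose UV := sum_biset U V.
have el u : bstab UV (inl u) = bstab U u.
  by apply: (@biset_iso_bstab G H U UV) => // ? ? [].
have er v : bstab UV (inr v) = bstab V v.
  by apply: (@biset_iso_bstab G H V UV) => // ? ? [].
have lP (u : gpart U) : `[< splus cG cS (bstab UV (inl (val u))) >].
  by rewrite el; exact: (valP u).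
have rP (v : gpart V) : `[< splus cG cS (bstab UV (inr (val v))) >].
  by rewrite er; exact: (valP v).
pose p (t : sum_biset (gpart U) (gpart V)) : gpart UV := match t with
  | inl u => exist (fun w => `[< splus cG cS (bstab UV w) >]) _ (lP u)
  | inr v => exist (fun w => `[< splus cG cS (bstab UV w) >]) _ (rP v) end.
apply: (@biset_iso_span G H (gpart UV) (sum_biset (gpart U) (gpart V)) _ p id).
- move=> [[u|v] wP].
    have uP : `[< splus cG cS (bstab U u) >] by rewrite -el.
    by exists (inl (exist (fun u => `[< splus cG cS (bstab U u) >]) u uP)); apply: val_inj.
  have vP : `[< splus cG cS (bstab V v) >] by rewrite -er.
  by exists (inr (exist (fun u => `[< splus cG cS (bstab V u) >]) v vP)); apply: val_inj.
- by move=> t; exists t.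
- move=> t t'; split=> [/(congr1 val)|-> //].
  by case: t t' => [u|v] [u'|v'] //= [] /val_inj ->.
- move=> g t gG; exists (lact (sum_biset (gpart U) (gpart V)) g t) => //.
  by apply: val_inj; rewrite [RHS]gpart_lactE //; case: t => t /=; rewrite gpart_lactE.
- move=> h t hH; exists (ract (sum_biset (gpart U) (gpart V)) t h) => //.
  by apply: val_inj; rewrite [RHS]gpart_ractE //; case: t => t /=; rewrite gpart_ractE.
Qed.

Variables (R : comPzRingType) (F : biset_functor cG cS R).

Section TenLift.
Variables (U : biset G H) (UP : splus_biset cG cS U).

Lemma ten_additive :
  gamma_additive (fun X : gamma F H => gcls (ten_gamma ax GG HH UP X)).
Proof.
split=> [A B AB|A B|X A s t sP tP].
- exact/gcls_iso/ten_isoX.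
- rewrite -gcls_sum; exact/gcls_iso/ten_sumX.
- exact: ten_add.
Qed.

Definition fplus_ten : fplus F H -> fplus F G :=
  glift (fun X : gamma F H => gcls (ten_gamma ax GG HH UP X)).

Lemma fplus_ten_cls X : fplus_ten (gcls X) = gcls (ten_gamma ax GG HH UP X).
Proof. exact: (glift_cls ten_additive). Qed.

Lemma fplus_tenB : zmod_morphism fplus_ten.
Proof. exact: (gliftB ten_additive). Qed.

Lemma fplus_tenZ : scalable fplus_ten.
Proof.
move=> r; apply: fplus_hom_eq => [x y|x y|X].
- by rewrite scalerBr fplus_tenB.
- by rewrite fplus_tenB scalerBr.
- by rewrite fplus_scaleE !fplus_ten_cls fplus_scaleE; exact/gcls_iso/ten_scale.
Qed.
End TenLift.

Lemma fplus_ten_iso (U V : biset G H) (UP : splus_biset cG cS U)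
    (VP : splus_biset cG cS V) :
  biset_iso U V -> fplus_ten UP =1 fplus_ten VP.
Proof.
move=> UV; apply: fplus_hom_eq => [||X]; try exact: fplus_tenB.
by rewrite !fplus_ten_cls; exact/gcls_iso/ten_isoU.
Qed.

Lemma fplus_ten_sum (U V : biset G H) (UP : splus_biset cG cS U)
    (VP : splus_biset cG cS V) (UVP : splus_biset cG cS (sum_biset U V)) x :
  fplus_ten UVP x = fplus_ten UP x + fplus_ten VP x.
Proof.
move: x; apply: fplus_hom_eq => [|x y|X]; first exact: fplus_tenB.
  by rewrite !fplus_tenB opprD addrACA.
by rewrite !fplus_ten_cls -gcls_sum; exact/gcls_iso/ten_sumU.
Qed.

Lemma splus_sum (U V : biset G H) :
  splus_biset cG cS U -> splus_biset cG cS V -> splus_biset cG cS (sum_biset U V).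
Proof.
move=> UP VP [u|v].
  by rewrite (@biset_iso_bstab G H U (sum_biset U V)) // => ? ? [].
by rewrite (@biset_iso_bstab G H V (sum_biset U V)) // => ? ? [].
Qed.

(** For fixed x the lift runs over B(G, H), so additivity in b comes from the universal property;
    linearity in x then has to be checked only on generators of B(G, H). *)
Definition fplus_map (b : bgroup G H) (x : fplus F H) : fplus F G :=
  plift (fun t : bgen G H => fplus_ten (@gpartP (big_biset t)) x) b.

Lemma fplus_map_compat x v : @brel G H v ->
  flift ((fun U => fplus_ten (@gpartP U) x) \o @big_biset G H) v = 0.
Proof.
apply: brel_compat => [U V UV|U V]; first exact/fplus_ten_iso/gpart_iso.
by rewrite -(fplus_ten_sum _ _ (splus_sum (@gpartP U) (@gpartP V)));
   exact/fplus_ten_iso/gpart_sum.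
Qed.

Lemma fplus_mapBl x : zmod_morphism (fplus_map^~ x).
Proof. exact/plift_is_additive/fplus_map_compat. Qed.

Lemma fplus_map_cls (U : biset G H) x : fplus_map (bcls U) x = fplus_ten (@gpartP U) x.
Proof.
rewrite /fplus_map /bcls (plift_gen (@fplus_map_compat x)).
exact/fplus_ten_iso/gpart_iso/big_small_biset.
Qed.

Lemma fplus_map_splus (U : biset G H) (UP : splus_biset cG cS U) (X : gamma F H) :
  fplus_map (bcls U) (gcls X) = gcls (ten_gamma ax GG HH UP X).
Proof.
by rewrite fplus_map_cls (fplus_ten_iso _ UP (gpart_id UP)) fplus_ten_cls.
Qed.

Lemma fplus_map_linear b : linear (fplus_map b).
Proof.
move=> r x y; move: b; apply: pres_hom_eq => [b b'|b b'|t]; rewrite ?fplus_mapBl //.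
  by rewrite scalerBr opprD addrACA.
rewrite pgen_bcls !fplus_map_cls (zmod_morphD (@fplus_tenB _ _)).
by rewrite fplus_tenZ.
Qed.

HB.instance Definition _ b :=
  GRing.isLinear.Build R (fplus F H) (fplus F G) *:%R (fplus_map b)
    (fplus_map_linear b).

End GoodPart.

Lemma zmod_morph0 (U V : zmodType) (f : U -> V) : zmod_morphism f -> f 0 = 0.
Proof. by move=> fB; rewrite -(subrr 0) fB subrr. Qed.

(** * The functor axioms for F_+ *)

Section PlusFunctor.
Variables (cG : fgrp -> Prop).
Variable (cS : forall G H : fgrp, {group fgT G * fgT H} -> Prop).
Hypothesis ax : pair_axioms cG cS.
Variables (R : comPzRingType) (F : biset_functor cG cS R).

(** Every point is a translate of the base coset, whose stabilizer is D. *)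
Lemma splus_trans (G H : fgrp) (D : {group fgT G * fgT H}) :
  cG G -> cG H -> splus cG cS D -> splus_biset cG cS (trans_biset D).
Proof.
move=> GG HH DP C; have [g [h [gG hH ->]]] := trans_bisetP C.
apply: (splus_lact ax GG HH gG); apply: (splus_ract ax GG HH hH).
by rewrite bstab_tbase //; case: DP.
Qed.

(** [functor_on] asks for a linear map for every pair of finite groups; outside the class it is set
    to zero. [pselect] supplies the membership proofs, and the choice of proof is harmless by proof
    irrelevance. *)
Definition fplus_fmap (G H : fgrp) (b : bgroup G H) :
    {linear fplus F H -> fplus F G} :=
  match pselect (cG G /\ cG H) with
  | left GH => fplus_map ax (proj1 GH) (proj2 GH) (F := F) b
  | right _ => \0
  end.

Lemma fplus_fmapE (G H : fgrp) (GG : cG G) (HH : cG H) b x :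
  fplus_fmap b x = fplus_map ax GG HH b x.
Proof.
rewrite /fplus_fmap; case: pselect => [GH|[]//] /=.
by rewrite (Prop_irrelevance (proj1 GH) GG) (Prop_irrelevance (proj2 GH) HH).
Qed.

Lemma fplus_fmapB (G H : fgrp) (GG : cG G) (HH : cG H) (a b : bgroup G H) x :
  fplus_fmap (a - b) x = fplus_fmap a x - fplus_fmap b x.
Proof. by rewrite !fplus_fmapE fplus_mapBl. Qed.

Lemma fplus_fmap_cls (G H : fgrp) (GG : cG G) (HH : cG H) (U : biset G H)
    (UP : splus_biset cG cS U) (X : gamma F H) :
  fplus_fmap (bcls U) (gcls X) = gcls (ten_gamma ax GG HH UP X).
Proof. by rewrite fplus_fmapE fplus_map_splus. Qed.

Lemma fplus_fmapD (G H : fgrp) : cG G -> cG H -> forall a b : bgroup G H,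
  homS (splus cG cS) a -> homS (splus cG cS) b ->
  fplus_fmap (a + b) =1 fplus_fmap a \+ fplus_fmap b.
Proof.
move=> GG HH a b _ _ x; rewrite /= !fplus_fmapE.
exact: (zmod_morphD (@fplus_mapBl _ _ ax _ _ GG HH _ _ x)).
Qed.

Lemma fplus_fmap1 (G : fgrp) : cG G -> fplus_fmap (bcls (reg_biset G)) =1 id.
Proof.
move=> GG; apply: fplus_hom_eq => [x y|//|X]; first by rewrite raddfB.
by rewrite (fplus_fmap_cls GG GG (splus_reg ax GG)); exact/gcls_iso/ten_reg.
Qed.

(** Both sides are additive in a and in b, so induction on the two spans reduces the claim to
    transitive bisets, where it is the associativity isomorphism [ten_comp]. *)
Lemma fplus_fmap_comp (G H K : fgrp) : cG G -> cG H -> cG K ->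
  forall (a : bgroup G H) (b : bgroup H K),
  homS (splus cG cS) a -> homS (splus cG cS) b ->
  fplus_fmap (bcomp a b) =1 fplus_fmap a \o fplus_fmap b.
Proof.
move=> GG HH KK a b aS bS x /=; elim: aS => [|_ [D DP ->]|v w _ IHv _ IHw].
- rewrite (zmod_morph0 (bcompBl b)) !fplus_fmapE.
  by rewrite !(zmod_morph0 (fplus_mapBl _ _ _ _)).
- elim: bS x => [|_ [E EP ->]|v w _ IHv _ IHw] x.
  + rewrite (zmod_morph0 (bcompBr _)) !fplus_fmapE.
    by rewrite !(zmod_morph0 (fplus_mapBl _ _ _ _)) raddf0.
  + rewrite /trans_cls bcomp_cls; move: x; apply: fplus_hom_eq => [x y|x y|X].
    * by rewrite raddfB.
    * by rewrite !raddfB.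
    have UP := splus_trans GG HH DP; have VP := splus_trans HH KK EP.
    rewrite (fplus_fmap_cls GG KK (splus_tens ax GG HH KK UP VP)).
    rewrite (fplus_fmap_cls HH KK VP) (fplus_fmap_cls GG HH UP).
    exact/gcls_iso/ten_comp.
  + by rewrite bcompBr !fplus_fmapB // raddfB IHv IHw.
- by rewrite bcompBl !fplus_fmapB // IHv IHw.
Qed.

Definition fplus_functor : functor_on cG (splus cG cS) (fplus F) :=
  FunctorOn fplus_fmapD fplus_fmap1 fplus_fmap_comp.

End PlusFunctor.

(** * Naturality in F *)

Section PlusNatural.
Variables (cG : fgrp -> Prop).
Variable (cS : forall G H : fgrp, {group fgT G * fgT H} -> Prop).
Hypothesis ax : pair_axioms cG cS.
Variables (R : comPzRingType) (F F' : biset_functor cG cS R).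
Variable phi : nat_trans F F'.

Definition znat (gT : finGroupType) (z : zval F gT) : zval F' gT :=
  tg (phi (FGrp (tag z)) (tagged z)).

Section One.
Variables (G : fgrp) (GG : cG G).

Definition nat_sec (X : finType) (A : gset_on G X) (s : sect F A) : sect F' A :=
  fun x => phi (FGrp (gstab A x)) (s x).

(** Equivariance of the image is naturality of [phi] at the conjugation morphisms, which lie in the
    category by [pair_conj_graph]. *)
Lemma nat_sec_obj (X : finType) (A : gset_on G X) (s : sect F A) :
  gamma_obj s -> gamma_obj (nat_sec s).
Proof.
move=> [sG se]; split=> // g x gG.
have -> : tg (nat_sec s (gact A g x)) = znat (tg (s (gact A g x))) by [].
rewrite se // /znat; congr tg.
have [c d] := pair_conj_graph ax GG (gstab_sub A x) (sG x) gG.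
exact: (nnat phi c (sG x) (homS_trans d)).
Qed.

Definition nat_gamma (A : gamma F G) : gamma F' G :=
  Gamma (GammaOn (nat_sec_obj (gm_obj A))).

Lemma nat_gamma_iso (A B : gamma F G) :
  gamma_iso A B -> gamma_iso (nat_gamma A) (nat_gamma B).
Proof.
have nat_hom (C D : gamma F G) (f : C -> D) :
    gamma_hom f -> @gamma_hom _ _ _ _ _ (nat_gamma C) (nat_gamma D) f.
  by move=> [fa fs]; split=> // x; have /(congr1 (@znat _)) := fs x.
by move=> [f [f' [fh f'h fK f'K]]]; exists f, f'; split=> //; exact: nat_hom.
Qed.

Lemma nat_gamma_additive : gamma_additive (fun A => gcls (nat_gamma A)).
Proof.
split=> [A B AB|A B|X A s t sP tP].
- exact/gcls_iso/nat_gamma_iso.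
- rewrite -gcls_sum; apply/gcls_iso/sec_gamma_iso => -[x|y]; apply: tg_inj.
    have -> : tg (nat_sec (sum_sec (gm_sec A) (gm_sec B)) (inl x)) =
      znat (tg (fcast (gstab_inl A B x) (gm_sec A x))) by [].
    by rewrite !tg_fcast.
  have -> : tg (nat_sec (sum_sec (gm_sec A) (gm_sec B)) (inr y)) =
    znat (tg (fcast (gstab_inr A B y) (gm_sec B y))) by [].
  by rewrite !tg_fcast.
- rewrite -gcls_add; apply/gcls_iso/sec_gamma_iso => x.
  by rewrite /nat_sec /add_sec raddfD.
Qed.

Definition fplus_nat : fplus F G -> fplus F' G :=
  glift (fun A => gcls (nat_gamma A)).

Lemma fplus_nat_cls A : fplus_nat (gcls A) = gcls (nat_gamma A).
Proof. exact: (glift_cls nat_gamma_additive). Qed.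

Lemma fplus_natB : zmod_morphism fplus_nat.
Proof. exact: (gliftB nat_gamma_additive). Qed.

Lemma fplus_natZ : scalable fplus_nat.
Proof.
move=> r; apply: fplus_hom_eq => [x y|x y|X].
- by rewrite scalerBr fplus_natB.
- by rewrite fplus_natB scalerBr.
- rewrite fplus_scaleE !fplus_nat_cls fplus_scaleE.
  by apply/gcls_iso/sec_gamma_iso => x; rewrite /nat_sec /scale_sec linearZ.
Qed.

HB.instance Definition _ :=
  GRing.isZmodMorphism.Build (fplus F G) (fplus F' G) fplus_nat fplus_natB.
HB.instance Definition _ :=
  GRing.isScalable.Build R (fplus F G) (fplus F' G) *:%R fplus_nat fplus_natZ.
End One.

(** Both sides have the same underlying G-set, and the sections agree by naturality of [phi] at the
    transitive biset that defines U(s). *)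
Lemma nat_ten_gamma (G H : fgrp) (GG : cG G) (HH : cG H) (U : biset G H)
    (UP : splus_biset cG cS U) (X : gamma F H) :
  gamma_iso (nat_gamma GG (ten_gamma ax GG HH UP X))
            (ten_gamma ax GG HH UP (nat_gamma HH X)).
Proof.
apply: sec_gamma_iso => O; rewrite /nat_sec /= /ten_sec.
have [c s] := ten_stab ax HH UP (trep O).1 (trep O).2.
have := nnat phi c (gm_cG (trep O).2) (homS_trans s) (gm_sec X (trep O).2).
by rewrite -surjective_pairing trepK.
Qed.

Notation FP := (BisetFunctor (fplus_functor ax F)).
Notation FP' := (BisetFunctor (fplus_functor ax F')).

Definition fplus_ncomp (G : fgrp) : {linear FP G -> FP' G} :=
  match pselect (cG G) with
  | left GG => fplus_nat GG
  | right _ => \0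
  end.

Lemma fplus_ncomp_cls (G : fgrp) (GG : cG G) (A : gamma F G) :
  fplus_ncomp G (gcls A) = gcls (nat_gamma GG A).
Proof.
rewrite /fplus_ncomp; case: pselect => [GG'|//] /=.
by rewrite (Prop_irrelevance GG' GG) fplus_nat_cls.
Qed.

Lemma fplus_nnat (G H : fgrp) : cG G -> cG H -> forall a : bgroup G H,
  homS (splus cG cS) a -> forall x,
  fplus_ncomp G (fmap FP a x) = fmap FP' a (fplus_ncomp H x).
Proof.
move=> GG HH a aS x; elim: aS x => [|_ [D DP ->]|v w _ IHv _ IHw] x.
- rewrite [fmap FP _ _](fplus_fmapE ax GG HH) [RHS](fplus_fmapE ax GG HH).
  by rewrite !(zmod_morph0 (fplus_mapBl _ _ _ _)) raddf0.
- have UP := splus_trans ax GG HH DP.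
  move: x; apply: fplus_hom_eq => [x y|x y|X]; rewrite ?raddfB //.
  rewrite [fmap FP _ _](fplus_fmap_cls ax GG HH UP) !fplus_ncomp_cls.
  rewrite [RHS](fplus_fmap_cls ax GG HH UP); exact/gcls_iso/nat_ten_gamma.
- have -> : fmap FP (v - w) x = fmap FP v x - fmap FP w x.
    exact: fplus_fmapB.
  apply: etrans (raddfB (fplus_ncomp G) _ _) _.
  apply: etrans (congr2 (fun y z => y - z) (IHv x) (IHw x)) _.
  exact/esym/fplus_fmapB.
Qed.

Definition fplus_nat_trans : nat_trans FP FP' := NatTrans fplus_nnat.

End PlusNatural.

Section PlusNaturalFunctoriality.
Variables (cG : fgrp -> Prop).
Variable (cS : forall G H : fgrp, {group fgT G * fgT H} -> Prop).
Hypothesis ax : pair_axioms cG cS.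
Variables (R : comPzRingType) (F F' F'' : biset_functor cG cS R).

(** Since classes [X, s] generate F_+(G), the identities in (b) reduce to comparisons of sections
    over one G-set. *)
Lemma fplus_nat_eq (psi chi : nat_trans (BisetFunctor (fplus_functor ax F))
                                 (BisetFunctor (fplus_functor ax F'))) :
    (forall G, cG G -> forall A : gamma F G, psi G (gcls A) = chi G (gcls A)) ->
  nat_eq psi chi.
Proof.
by move=> e G GG; apply: fplus_hom_eq => [x y|x y|A]; rewrite ?raddfB ?e.
Qed.
End PlusNaturalFunctoriality.

(** * Coinvariants *)

Section CosetClass.
Variables (cG : fgrp -> Prop).
Variable (cS : forall G H : fgrp, {group fgT G * fgT H} -> Prop).
Hypothesis ax : pair_axioms cG cS.
Variables (R : comPzRingType) (F : biset_functor cG cS R).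
Variables (G : fgrp) (GG : cG G).

Definition in_sigma (H : {group fgT G}) : Prop := H \subset G /\ cG (FGrp H).

Lemma in_sigma_gstab (A : gamma F G) x : in_sigma (gstab A x).
Proof. by split; [exact: gstab_sub|exact: gm_cG]. Qed.

Lemma in_sigma_conj (H : {group fgT G}) g :
  g \in G -> in_sigma H -> in_sigma (H :^ g^-1)%G.
Proof.
move=> gG [sH HH]; have [c _] := pair_conj_graph ax GG sH HH gG.
by split=> //; rewrite /= -(conjGid (groupVr gG)) conjSg.
Qed.

(** Elements of H act trivially on F(H) by conjugation, so ^x a depends only on the coset x H; hence
    [coset_sec] may be computed with any representative. *)
Lemma zconj_in (z : zval F (fgT G)) x h :
    in_sigma (tag z) -> x \in G -> h \in tag z ->
  zconj (x * h)%g z = zconj x z.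
Proof.
case: z => H a [/= sH HH] xG hH; have hG := subsetP sH _ hH.
by rewrite (zconjM ax (G := G)) // (zconj_id a HH hH).
Qed.

Section CosetGamma.
Variables (H : {group fgT G}) (HS : in_sigma H).

Lemma coset_repr (C : gcoset H) :
  [/\ repr (val C) \in G, repr (val C) \in val C & val C = (repr (val C) *: H)%g].
Proof.
have /lcosetsP[g gG e] := valP C.
have rC : repr (val C) \in val C by rewrite e; apply: (mem_repr g); exact: lcoset_refl.
split=> //; move: rC; rewrite e => rC; last exact/esym/lcoset_eqP.
have /lcosetP[h hH ->] := rC; rewrite groupM //.
by case: HS => /subsetP sH _; exact: sH.
Qed.

Lemma coset_gstab (C : gcoset H) :
  (H :^ (repr (val C))^-1)%G = gstab (coset_gset_on H) C.
Proof.
have [rG rC e] := coset_repr C; have [sH _] := HS.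
apply/group_inj/setP => g; rewrite inE mem_conjgV.
case: (boolP (g \in G)) => [gG|gG]; last first.
  apply/negbTE; apply: contra gG => /(subsetP sH).
  by rewrite groupJr.
have -> : (gact (coset_gset_on H) g C == C) = (g *: val C == val C)%g.
  by rewrite -val_eqE /= gc_act_val.
apply/idP/eqP => [grH|ee].
  by rewrite {1}e -lcosetM conjgC lcosetM lcoset_id.
have : (g * repr (val C))%g \in (g *: val C)%g by rewrite mem_lcoset mulKg.
by rewrite ee {2}e mem_lcoset conjgE.
Qed.

Variable a : F (FGrp H).

Definition coset_sec : sect F (coset_gset_on H) := fun C =>
  fcast (coset_gstab C) (fconj (repr (val C)) a).

Lemma coset_secE (C : gcoset H) x : x \in G -> x \in val C -> tg (coset_sec C) = zconj x (tg a).
Proof.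
move=> xG xC; rewrite tg_fcast; have [rG rC e] := coset_repr C.
have /lcosetP[h hH ->] : x \in (repr (val C) *: H)%g by rewrite -e.
exact/esym/zconj_in.
Qed.

Lemma coset_sec_base : tg (coset_sec (base_coset H)) = tg a.
Proof.
by rewrite (coset_secE (x := 1%g)) ?group1 ?zconj1 //; case: HS.
Qed.

Lemma coset_sec_obj : gamma_obj coset_sec.
Proof.
have [sH HH] := HS; split=> [C|g C gG].
  rewrite -coset_gstab; have [rG _ _] := coset_repr C.
  by case: (in_sigma_conj rG HS).
have [rG rC e] := coset_repr C.
rewrite (coset_secE (x := (g * repr (val C))%g)) ?groupM //.
  by rewrite (zconjM ax (G := G)) //= -(coset_secE rG rC).
by rewrite gc_act_val // mem_lcoset mulKg.
Qed.

Definition coset_gamma : gamma F G := Gamma (GammaOn coset_sec_obj).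

(** The elements g of G parametrize both the points g x and the cosets g H. The hypothesis on x says
    at once that G_x = H, so that the fibres agree, and that s(x) = a. *)
Lemma coset_gammaP (A : gamma F G) x : tg (gm_sec A x) = tg a ->
    (forall y, exists2 g, g \in G & y = gact A g x) ->
  gamma_iso A coset_gamma.
Proof.
move=> xa tr; have [sH HH] := HS.
have xH : gstab A x = H := congr1 (@projT1 _ _) xa.
pose T := [subg G]; pose p (t : T) := gact A (sgval t) x.
have qP (t : T) : (sgval t *: H)%g \in lcosets H G.
  by apply/lcosetsP; exists (sgval t); rewrite ?subgP.
pose q (t : T) : coset_gamma := exist (fun C => C \in lcosets H G) _ (qP t).
apply: (@gamma_iso_span _ _ _ _ _ A coset_gamma _ p q).
- by move=> y; have [g gG ->] := tr y; exists (subg G g); rewrite /p subgK.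
- case=> C CP; have /lcosetsP[g gG e] := CP; exists (subg G g).
  by apply: val_inj; rewrite /= subgK.
- move=> t t'; have tG := subgP t; have t'G := subgP t'.
  have -> : (q t = q t') <-> ((sgval t)^-1 * sgval t' \in H)%g.
    rewrite -mem_lcoset; split=> [e|/lcoset_eqP e]; last exact: val_inj.
    have -> : (sgval t *: H)%g = (sgval t' *: H)%g := congr1 val e.
    exact: lcoset_refl.
  rewrite -xH in_gstab ?groupM ?groupV // gactM ?groupV // /p.
  split=> [<-|/eqP e]; first by rewrite gactK.
  by rewrite -{1}e gactKV.
- move=> g t gG; have tG := subgP t; exists (subg G (g * sgval t)%g).
    by rewrite /p subgK ?groupM // gactM.
  by apply: val_inj; rewrite /= gc_act_val // subgK ?groupM // lcosetM.
- move=> t; have tG := subgP t; rewrite gm_secE // xa.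
  by apply: coset_secE; rewrite ?subgP // lcoset_refl.
Qed.

Lemma coset_tr (C : coset_gamma) :
  exists2 g, g \in G & C = gact coset_gamma g (base_coset H).
Proof.
have [rG rC e] := coset_repr C; exists (repr (val C)) => //.
by apply: val_inj; rewrite /= gc_act_val.
Qed.
End CosetGamma.

(* [H, a]_G for z = (H, a), and 0 if H is not in Sigma(G). *)
Definition zcls (z : zval F (fgT G)) : fplus F G :=
  match pselect (in_sigma (tag z)) with
  | left zS => gcls (coset_gamma zS (tagged z))
  | right _ => 0
  end.

Lemma zclsE (H : {group fgT G}) (HS : in_sigma H) a :
  zcls (tg a) = gcls (coset_gamma HS a).
Proof.
by rewrite /zcls /=; case: pselect => //= HS'; rewrite (Prop_irrelevance HS' HS).
Qed.

Lemma zcls_trans (A : gamma F G) x :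
    (forall y, exists2 g, g \in G & y = gact A g x) ->
  gcls A = zcls (tg (gm_sec A x)).
Proof.
move=> tr; rewrite (zclsE (in_sigma_gstab x)).
exact/gcls_iso/(coset_gammaP _ _ tr).
Qed.

(** The object (G/H, s_a) is transitive, so its class can be read off at any point: the base coset
    gives [H, a]_G and the coset g H gives [^gH, ^ga]_G. *)
Lemma zcls_conj g z : g \in G -> in_sigma (tag z) -> zcls (zconj g z) = zcls z.
Proof.
case: z => H a gG HS; rewrite -[existT _ _ _]/(tg a) (zclsE HS).
pose A := coset_gamma HS a; pose x : A := gact A g (base_coset H).
have -> : zconj g (tg a) = tg (gm_sec A x).
  by rewrite gm_secE //; congr (zconj g _); exact/esym/coset_sec_base.
rewrite -zcls_trans // => C; have [k kG ->] := coset_tr C.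
exists (k * g^-1)%g; rewrite ?groupM ?groupV // gactM ?groupV //.
by rewrite [gact A g^-1 x](gactK A (base_coset H) gG).
Qed.

Lemma zclsD (H : {group fgT G}) (a b : F (FGrp H)) :
  zcls (tg (a + b)) = zcls (tg a) + zcls (tg b).
Proof.
have [HS|HS] := pselect (in_sigma H); last first.
  by rewrite /zcls /=; case: pselect => //= _; rewrite addr0.
rewrite !(zclsE HS) -gcls_add; apply/gcls_iso/sec_gamma_iso => C.
apply: tg_inj; rewrite tg_fcast /fconj raddfD.
by apply: tgD; rewrite tg_fcast.
Qed.

Lemma zclsZ r (H : {group fgT G}) (a : F (FGrp H)) :
  zcls (tg (r *: a)) = r *: zcls (tg a).
Proof.
have [HS|HS] := pselect (in_sigma H); last first.
  by rewrite /zcls /=; case: pselect => //= _; rewrite scaler0.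
rewrite !(zclsE HS) fplus_scaleE; apply/gcls_iso/sec_gamma_iso => C.
apply: tg_inj; rewrite tg_fcast /fconj linearZ.
by apply: tgZ; rewrite tg_fcast.
Qed.

Lemma zcls0 (H : {group fgT G}) : zcls (tg (0 : F (FGrp H))) = 0.
Proof.
have := zclsD (0 : F (FGrp H)) 0; rewrite addr0 => e.
by apply: (addrI (zcls (tg (0 : F (FGrp H))))); rewrite -e addr0.
Qed.

Lemma sigmaG_in (i : sigmaG cG G) : in_sigma (val i).
Proof. by have /andP[sH /asboolP HH] := valP i; split. Qed.

Lemma sigmaG_ex (H : {group fgT G}) :
  in_sigma H -> exists i : sigmaG cG G, val i = H.
Proof.
move=> [sH HH]; have HP : (H \subset G) && `[< cG (FGrp H) >].
  by rewrite sH; apply/asboolP.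
by exists (exist (fun H : {group fgT G} => (H \subset G) && `[< cG (FGrp H) >]) H HP).
Qed.

Lemma dinj_eq (i : sigmaG cG G) (a : F (FGrp (val i))) : dinj a i = a.
Proof.
rewrite /dinj; case: eqP => // e; apply: tg_inj; exact: tg_fcast.
Qed.

Lemma dinj_neq (H : {group fgT G}) (a : F (FGrp H)) (i : sigmaG cG G) :
  H <> val i -> dinj a i = 0.
Proof. by move=> ne; rewrite /dinj; case: eqP. Qed.

Lemma dsum_sumE (I : finType) (v : I -> dsum F G) j :
  (\sum_(i : I) v i) j = \sum_(i : I) v i j.
Proof. exact: (big_morph (fun w : dsum F G => w j)). Qed.

Lemma dsum_dinj (v : dsum F G) : v = \sum_(i : sigmaG cG G) dinj (v i).
Proof.
apply: functional_extensionality_dep => j; rewrite dsum_sumE (bigD1 j) //=.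
rewrite dinj_eq big1 ?addr0 // => i ij; apply: dinj_neq => /val_inj e.
by rewrite e eqxx in ij.
Qed.

Definition dsum_fplus (v : dsum F G) : fplus F G :=
  \sum_(i : sigmaG cG G) zcls (tg (v i)).

Lemma dsum_fplus_linear : linear dsum_fplus.
Proof.
move=> r v w; rewrite /dsum_fplus scaler_sumr -big_split /=.
by apply: eq_bigr => i _; rewrite zclsD zclsZ.
Qed.
HB.instance Definition _ :=
  GRing.isLinear.Build R (dsum F G) (fplus F G) *:%R dsum_fplus dsum_fplus_linear.

Lemma dsum_fplus_dinj (H : {group fgT G}) (a : F (FGrp H)) :
  in_sigma H -> dsum_fplus (dinj a) = zcls (tg a).
Proof.
move=> /sigmaG_ex[i e]; case: H / e a => a.
rewrite /dsum_fplus (bigD1 i) //= dinj_eq big1 ?addr0 // => j ji.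
by rewrite dinj_neq ?zcls0 // => /val_inj e; rewrite e eqxx in ji.
Qed.

Lemma dsum_fplus_act g v : g \in G -> dsum_fplus (dact g v) = dsum_fplus v.
Proof.
move=> gG; rewrite /dact raddf_sum; apply: eq_bigr => i _.
have iS := sigmaG_in i; rewrite /= (dsum_fplus_dinj _ (in_sigma_conj gG iS)).
exact: (zcls_conj (z := tg (v i)) gG iS).
Qed.

(** Since [dsum_fplus] is invariant under G, the sum of the c(g) factors out, and it vanishes. *)
Lemma dsum_fplus_ker w : aug_prod w -> dsum_fplus w = 0.
Proof.
move=> [c [v [c0 ->]]]; rewrite raddf_sum /=.
under eq_bigr => g gG do rewrite linearZ /= dsum_fplus_act //.
by rewrite -scaler_suml c0 scale0r.
Qed.

Definition coinv_fplus : coinv F G -> fplus F G := zlift dsum_fplus.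

Lemma coinv_fplus_cls v : coinv_fplus (coinv_cls v) = dsum_fplus v.
Proof. exact: (zliftE dsum_fplus_ker). Qed.

Lemma coinv_surj (x : coinv F G) : exists v, x = coinv_cls v.
Proof. exact: zpi_surj. Qed.

Lemma coinv_cls_linear : linear (@coinv_cls _ _ _ F G : dsum F G -> coinv F G).
Proof.
move=> r v w; have -> : r *: (coinv_cls v : coinv F G) = coinv_cls (r *: v).
  exact: coinv_scaleE.
exact: (raddfD (zpi (@aug_prod _ _ _ F G))).
Qed.

Lemma coinv_fplus_linear : linear coinv_fplus.
Proof.
move=> r x y; have [v ->] := coinv_surj x; have [w ->] := coinv_surj y.
by rewrite -coinv_cls_linear !coinv_fplus_cls linearP.
Qed.
HB.instance Definition _ :=
  GRing.isLinear.Build R (coinv F G) (fplus F G) *:%R coinv_fplus coinv_fplus_linear.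

End CosetClass.

(** * The inverse map, given by sums over orbits *)

Section OrbitSum.
Variables (cG : fgrp -> Prop).
Variable (cS : forall G H : fgrp, {group fgT G * fgT H} -> Prop).
Hypothesis ax : pair_axioms cG cS.
Variables (R : comPzRingType) (F : biset_functor cG cS R).
Variables (G : fgrp) (GG : cG G).

Definition zcoinv (z : zval F (fgT G)) : coinv F G := coinv_cls (dinj (tagged z)).

Lemma dinjD (H : {group fgT G}) (a b : F (FGrp H)) :
  dinj (a + b) = dinj a + dinj b :> dsum F G.
Proof.
apply: functional_extensionality_dep => i; rewrite /dinj.
have -> : (dinj a + dinj b : dsum F G) i = dinj a i + dinj b i by [].
rewrite /dinj; case: eqP => [e|_]; last by rewrite addr0.
by case: (val i) / e.
Qed.

Lemma zcoinvD (H : {group fgT G}) (a b : F (FGrp H)) :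
  zcoinv (tg (a + b)) = zcoinv (tg a) + zcoinv (tg b).
Proof. by rewrite /zcoinv /= dinjD; exact: (raddfD (zpi _)). Qed.

Lemma dinj0 (H : {group fgT G}) : dinj (0 : F (FGrp H)) = 0 :> dsum F G.
Proof.
by apply: (addrI (dinj (0 : F (FGrp H)))); rewrite -dinjD !addr0.
Qed.

Lemma dact_dinj g (H : {group fgT G}) (a : F (FGrp H)) :
  in_sigma cG H -> dact g (dinj a) = dinj (fconj g a) :> dsum F G.
Proof.
move=> /sigmaG_ex[i e]; case: H / e a => a; rewrite /dact (bigD1 i) //= dinj_eq.
rewrite big1 ?addr0 // => j ji; rewrite dinj_neq.
  by rewrite /fconj raddf0 dinj0.
by move=> /val_inj e; rewrite e eqxx in ji.
Qed.

Lemma zcoinv_conj g z : g \in G -> in_sigma cG (tag z) -> zcoinv (zconj g z) = zcoinv z.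
Proof.
case: z => H a gG HS; apply/zpi_eq/zspan_gen.
have [->|g1] := eqVneq g 1%g.
  exists (fun=> 0), 0; split; first by rewrite big1.
  have -> : dinj (tagged (zconj 1%g (tg a))) = dinj (tagged (tg a)) :> dsum F G.
    by rewrite zconj1 //; case: HS.
  by rewrite subrr big1 // => k _; rewrite scale0r.
(* These are the coefficients of g - 1, an element of the augmentation ideal. *)
exists (fun k => (k == g)%:R - (k == 1%g)%:R), (dinj a).
have sum_delta (V : lmodType R) (f : fgT G -> V) k : k \in G ->
    \sum_(x in G) (x == k)%:R *: f x = f k.
  move=> kG; rewrite (bigD1 k) //= eqxx scale1r big1 ?addr0 // => x /andP[_ /negPf ->].
  by rewrite scale0r.
split.
  have sum1 k : k \in G -> \sum_(x in G) (x == k)%:R = 1 :> R.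
    move=> kG; rewrite (bigD1 k) //= eqxx big1 ?addr0 // => x /andP[_ /negPf ->] //.
  by rewrite sumrB !sum1 ?group1 // subrr.
under eq_bigr => k _ do rewrite scalerBl.
rewrite sumrB !sum_delta ?group1 // !dact_dinj //; congr (_ - _).
have -> : dinj (fconj 1%g a) = dinj (tagged (zconj 1%g (tg a))) :> dsum F G by [].
by rewrite zconj1 //; case: HS.
Qed.

(* The orbits of A, as those of {tt} x A. *)
Notation ocl A := (tcl G (fun (u : unit) (_ : fgT G) => u) (gact A)).
Notation orb A := (tens G (fun (u : unit) (_ : fgT G) => u) (gact A)).

Lemma oclP (X : finType) (A : gset_on G X) x y :
  ocl A (tt, x) = ocl A (tt, y) <-> exists2 g, g \in G & y = gact A g x.
Proof.
have E := @tclP (fgT G) G unit X (fun u _ => u) (gact A) (fun _ => erefl) (gact1 A)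
  (fun _ _ _ _ _ => erefl) (gactM A) (tt, x) (tt, y).
rewrite E; split=> -[g gG]; first by move=> /(congr1 snd) /= ->; exists g.
by move=> ->; exists g.
Qed.

Definition osum (A : gamma F G) : coinv F G :=
  \sum_(O : orb A) zcoinv (tg (gm_sec A (trep O).2)).

(** Values at points of one orbit are conjugate and have the same class in M_G by [zcoinv_conj], so
    neither the representatives nor the set I indexing the orbits matters. The lemma serves
    isomorphisms, disjoint unions and single orbits alike. *)
Lemma osum_span (A : gamma F G) (I : finType) (q : A -> I) (f : I -> coinv F G) :
    (forall i, exists x, q x = i) ->
    (forall x y, (exists2 g, g \in G & y = gact A g x) <-> q x = q y) ->
    (forall x, f (q x) = zcoinv (tg (gm_sec A x))) ->
  osum A = \sum_i f i.
Proof.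
move=> sq oq fq; pose p x := ocl A (tt, x).
have sp (O : orb A) : exists x, p x = O.
  by exists (trep O).2; rewrite /p -[RHS]trepK; case: (trep O) => -[].
have [|e [e' [eK e'K ep _]]] := @span_bij A (orb A) I p q sp sq.
  by move=> x y; rewrite -oq; exact: oclP.
rewrite (reindex e) /=; last by exists e' => ? _.
apply: eq_bigr => O _; have [x <-] := sp O.
rewrite ep fq; have /oclP[g gG ->] : ocl A (tt, x) = ocl A (tt, (trep (p x)).2).
  by rewrite -/(p x) -{1}[p x]trepK; case: (trep (p x)) => -[].
by rewrite gm_secE // zcoinv_conj //; exact: in_sigma_gstab.
Qed.

Lemma osum_additive : gamma_additive osum.
Proof.
split=> [A B [f [f' [[fa fs] [f'a f's] fK f'K]]]|A B|X A s t sP tP].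
- apply: (@osum_span A (orb B) (fun x => ocl B (tt, f x))) => [O|x y|x].
  + by exists (f' (trep O).2); rewrite f'K -[RHS]trepK; case: (trep O) => -[].
  + rewrite oclP; split=> -[g gG]; first by move=> ->; exists g; rewrite ?fa.
    by rewrite -fa // => /(can_inj fK) ->; exists g.
  have /oclP[g gG ->] : ocl B (tt, f x) = ocl B (tt, (trep (ocl B (tt, f x))).2).
    by rewrite -{1}[ocl B _]trepK; case: (trep _) => -[].
  by rewrite gm_secE // zcoinv_conj ?fs //; exact: in_sigma_gstab.
- pose q (z : sum_gamma A B) : orb A + orb B :=
    match z with inl x => inl (ocl A (tt, x)) | inr y => inr (ocl B (tt, y)) end.
  pose f (o : orb A + orb B) := match o with
    | inl o => zcoinv (tg (gm_sec A (trep o).2))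
    | inr o => zcoinv (tg (gm_sec B (trep o).2)) end.
  rewrite (@osum_span (sum_gamma A B) _ q f).
  + by rewrite big_sumType.
  + case=> O; [exists (inl (trep O).2)|exists (inr (trep O).2)];
      by rewrite /q -[in RHS](trepK O); case: (trep O) => -[].
  + move=> [x|x] [y|y]; split=> //.
    * by move=> [g gG [->]]; congr inl; apply/oclP; exists g.
    * by move=> e; have /oclP[g gG ->] := inl_inj e; exists g.
    * by move=> [g gG []].
    * by move=> [g gG []].
    * by move=> [g gG [->]]; congr inr; apply/oclP; exists g.
    * by move=> e; have /oclP[g gG ->] := inr_inj e; exists g.
  + move=> [x|x]; rewrite [in RHS]tg_fcast /f /q.
      have /oclP[g gG ->] : ocl A (tt, x) = ocl A (tt, (trep (ocl A (tt, x))).2).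
        by rewrite -{1}[ocl A _]trepK; case: (trep _) => -[].
      by rewrite gm_secE // zcoinv_conj //; exact: in_sigma_gstab.
    have /oclP[g gG ->] : ocl B (tt, x) = ocl B (tt, (trep (ocl B (tt, x))).2).
      by rewrite -{1}[ocl B _]trepK; case: (trep _) => -[].
    by rewrite gm_secE // zcoinv_conj //; exact: in_sigma_gstab.
- by rewrite /osum -big_split; apply: eq_bigr => O _; exact: zcoinvD.
Qed.

Definition fplus_coinv : fplus F G -> coinv F G := glift osum.

Lemma fplus_coinvB : zmod_morphism fplus_coinv.
Proof. exact: (gliftB osum_additive). Qed.

Lemma fplus_coinv_zcls z : in_sigma cG (tag z) ->
  fplus_coinv (zcls ax GG z) = zcoinv z.
Proof.
case: z => H a HS; rewrite -[existT _ _ _]/(tg a) (zclsE ax GG HS).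
rewrite [LHS](glift_cls osum_additive).
(* A coset space is a single orbit, indexed by [unit]. *)
rewrite (@osum_span (coset_gamma ax GG HS a) unit (fun=> tt) (fun=> zcoinv (tg a))).
- by rewrite big_const card_unit /= addr0.
- by case; exists (base_coset H).
- move=> C C'; split=> // _; have [g gG ->] := coset_tr C.
  have [k kG ->] := coset_tr C'; exists (k * g^-1)%g; rewrite ?groupM ?groupV //.
  by rewrite gactM ?groupV // gactK.
- move=> C; have [g gG ->] := coset_tr C.
  rewrite gm_secE // zcoinv_conj //; last exact: in_sigma_gstab.
  by congr zcoinv; exact/esym/coset_sec_base.
Qed.

Lemma coinv_fplusK : cancel (@coinv_fplus _ _ ax _ F G GG) fplus_coinv.
Proof.
move=> x; have [v ->] := coinv_surj x; rewrite coinv_fplus_cls /dsum_fplus.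
have e0 := zmod_morph0 fplus_coinvB.
rewrite (big_morph fplus_coinv (zmod_morphD fplus_coinvB) e0).
rewrite [in RHS](dsum_dinj v) [RHS](raddf_sum (zpi (@aug_prod _ _ _ F G))).
by apply: eq_bigr => i _; rewrite fplus_coinv_zcls //; exact: sigmaG_in.
Qed.

End OrbitSum.

(** * Splitting off an invariant subset *)

Section SubGamma.
Variables (cG : fgrp -> Prop).
Variable (cS : forall G H : fgrp, {group fgT G * fgT H} -> Prop).
Variables (R : comPzRingType) (F : biset_functor cG cS R).
Variables (G : fgrp) (A : gamma F G).

Section One.
Variables (P : pred A) (PG : forall g x, g \in G -> P x -> P (gact A g x)).

Definition sub_car : Type := {x : A | P x}.
HB.instance Definition _ := Finite.on sub_car.

Definition sub_gact g (x : sub_car) : sub_car := insubd x (gact A g (val x)).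

Lemma sub_gactE g x : g \in G -> val (sub_gact g x) = gact A g (val x).
Proof. by move=> gG; rewrite insubdK //; apply: PG; rewrite ?(valP x). Qed.

Lemma sub_gact1 x : sub_gact 1%g x = x.
Proof. by apply: val_inj; rewrite sub_gactE ?gact1. Qed.
Lemma sub_gactM : {in G &, forall g h x, sub_gact (g * h)%g x = sub_gact g (sub_gact h x)}.
Proof. by move=> g h gG hG x; apply: val_inj; rewrite !sub_gactE ?groupM ?gactM. Qed.

Definition sub_gset_on : gset_on G sub_car := GsetOn sub_gact1 sub_gactM.

Lemma sub_gstab x : gstab A (val x) = gstab sub_gset_on x.
Proof.
apply/group_inj/setP => g; rewrite !inE; case: (boolP (g \in G)) => //= gG.
by rewrite -val_eqE /= sub_gactE.
Qed.

Definition sub_sec : sect F sub_gset_on := fun x => fcast (sub_gstab x) (gm_sec A (val x)).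

Lemma sub_sec_obj : gamma_obj sub_sec.
Proof.
split=> [x|g x gG]; first by rewrite -sub_gstab; exact: gm_cG.
rewrite tg_fcast /= sub_gactE // gm_secE //.
by apply/esym/tg_fconj; rewrite tg_fcast.
Qed.

Definition sub_gamma : gamma F G := Gamma (GammaOn sub_sec_obj).
End One.

Lemma gcls_split (P : pred A) (PG : forall g x, g \in G -> P x -> P (gact A g x))
    (PcG : forall g x, g \in G -> predC P x -> predC P (gact A g x)) :
  gcls A = gcls (sub_gamma PG) + gcls (sub_gamma PcG).
Proof.
rewrite -gcls_sum; apply: gcls_iso.
pose B := sum_gamma (sub_gamma PG) (sub_gamma PcG).
pose p (t : B) : A := match t with inl x => val x | inr x => val x end.
apply: (@gamma_iso_span _ _ _ _ _ A B B p id) => [x|b|t t'|g t gG|t].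
- have [Px|Px] := boolP (P x); first by exists (inl (exist (fun y => P y) x Px)).
  by exists (inr (exist (fun y => predC P y) x Px)).
- by exists b.
- split=> [|-> //]; case: t t' => [x|x] [y|y] /= e.
  + by congr inl; apply: val_inj.
  + by have := valP y; rewrite /= -e (valP x).
  + by have := valP x; rewrite /= e (valP y).
  + by congr inr; apply: val_inj.
- exists (gact B g t) => //; case: t => x /=; exact: sub_gactE.
- by case: t => x; rewrite /= !tg_fcast.
Qed.

End SubGamma.

(** * Bijectivity of the map from the coinvariants to F_+(G) *)

Section CoinvariantIso.
Variables (cG : fgrp -> Prop).
Variable (cS : forall G H : fgrp, {group fgT G * fgT H} -> Prop).
Hypothesis ax : pair_axioms cG cS.
Variables (R : comPzRingType) (F : biset_functor cG cS R).
Variables (G : fgrp) (GG : cG G).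
Notation f := (@coinv_fplus _ _ ax _ F G GG).

Lemma coinv_fplus_zcls z : in_sigma cG (tag z) -> f (zcoinv z) = zcls ax GG z.
Proof. by case: z => H a HS; rewrite coinv_fplus_cls dsum_fplus_dinj. Qed.

(** An empty object is isomorphic to its disjoint union with itself, so [A] + [A] = [A]. *)
Lemma gcls_empty (A : gamma F G) : #|A| = 0 -> gcls A = 0.
Proof.
move=> A0; have nA (x : A) : False by have := fintype0 x A0.
apply: (addrI (gcls A)); rewrite addr0 -gcls_sum; apply/esym/gcls_iso.
exists inl, (fun z : sum_gamma A A => match z with inl x => x | inr x => x end).
split=> //; last by case=> x; case: (nA x).
by split=> [g [x|x]|[x|x]]; case: (nA x).
Qed.

(** Induction on the size of the G-set: the orbit of a point x has class [G_x, s(x)]_G, which comes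
    from M_G, and its complement is smaller because it misses x. *)
Lemma coinv_fplus_onto (A : gamma F G) : exists x, f x = gcls A.
Proof.
have [n] := ubnP #|A|; elim: n A => // n IH A; rewrite ltnS => An.
case: (pickP (fun _ : A => true)) => [x _|A0]; last first.
  exists 0; rewrite raddf0 gcls_empty //; apply: eq_card0 => y.
  by have := A0 y.
pose P : pred A := fun y => [exists g in G, y == gact A g x].
have PG g y : g \in G -> P y -> P (gact A g y).
  move=> gG /exists_inP[k kG /eqP ->]; apply/exists_inP.
  by exists (g * k)%g; rewrite ?groupM // gactM.
have PcG g y : g \in G -> predC P y -> predC P (gact A g y).
  move=> gG; apply: contra => /(PG g^-1%g _ (groupVr gG)).
  by rewrite gactK.
have Px : P x by apply/exists_inP; exists 1%g; rewrite ?gact1.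
pose B := sub_gamma PG; pose x0 : B := exist (fun y => P y) x Px.
have [z1 e1] : exists z, f z = gcls B.
  exists (zcoinv (tg (gm_sec B x0))).
  rewrite coinv_fplus_zcls; last exact: in_sigma_gstab.
  apply/esym/zcls_trans => -[y Py]; have /exists_inP[g gG /eqP e] := Py.
  by exists g => //; apply: val_inj; rewrite /= sub_gactE.
have [|z2 e2] := IH (sub_gamma PcG).
  apply: leq_trans An; rewrite card_sig -(cardC P) -[X in (X < _)%N]add0n ltn_add2r.
  by apply/card_gt0P; exists x.
by exists (z1 + z2); rewrite (gcls_split PG PcG) -e1 -e2 raddfD.
Qed.

Lemma coinv_fplus_bij : bijective f.
Proof.
have fK := @coinv_fplusK _ _ ax _ F _ GG.
exists (@fplus_coinv _ _ _ F G) => // y.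
suff [x <-] : exists x, f x = y by rewrite fK.
move: y; apply: fplus_ind => [|_ _ [x <-] [y <-]|A]; last exact: coinv_fplus_onto.
  by exists 0; rewrite raddf0.
by exists (x - y); rewrite raddfB.
Qed.
End CoinvariantIso.

Theorem theorem4p7 (R : comPzRingType) (cG : fgrp -> Prop)
    (cS : forall G H : fgrp, {group fgT G * fgT H} -> Prop)
    (axioms : pair_axioms cG cS) :
  exists P : forall F : biset_functor cG cS R,
      functor_on cG (splus cG cS) (fplus F),
  [/\ (* (a) *)
      forall (F : biset_functor cG cS R) (G H : fgrp), cG G -> cG H ->
      forall U : biset G H, (forall u : U, splus cG cS (bstab U u)) ->
      forall X : gamma F H,
      exists2 t : sect F (tens_gset_on U X), induced_sec (gm_sec X) t &
        is_gcls t (fmap (P F) (bcls U) (gcls X)),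
      (* (b) *)
      exists Q : forall F F' : biset_functor cG cS R, nat_trans F F' ->
          nat_trans (BisetFunctor (P F)) (BisetFunctor (P F')),
      [/\ forall (F F' : biset_functor cG cS R) (phi : nat_trans F F') (G : fgrp),
            cG G -> forall X : gamma F G,
            is_gcls (fun x => phi (FGrp (gstab X x)) (gm_sec X x))
              (Q F F' phi G (gcls X)),
          forall F : biset_functor cG cS R, nat_eq (Q F F (nat_id F)) (nat_id _),
          forall (F F' F'' : biset_functor cG cS R)
            (phi : nat_trans F F') (psi : nat_trans F' F''),
            nat_eq (Q F F'' (nat_comp phi psi))
              (nat_comp (Q F F' phi) (Q F' F'' psi)),
          forall (F F' : biset_functor cG cS R) (phi psi : nat_trans F F'),
            nat_eq (Q F F' (nat_add phi psi)) (nat_add (Q F F' phi) (Q F F' psi)) &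
          forall (F F' : biset_functor cG cS R) (phi : nat_trans F F') (r : R),
            nat_eq (Q F F' (nat_scale phi r)) (nat_scale (Q F F' phi) r)] &
      (* (c) *)
      forall (F : biset_functor cG cS R) (G : fgrp), cG G ->
      exists2 f : {linear coinv F G -> fplus F G}, bijective f &
        forall H : {group fgT G}, H \subset G -> cG (FGrp H) ->
        forall a : F (FGrp H),
        exists2 s : sect F (coset_gset_on H), tg (s (base_coset H)) = tg a &
          is_gcls s (f (coinv_cls (dinj a)))].
Proof.
exists (@fplus_functor cG cS axioms R); split.
- move=> F G H GG HH U UP X; exists (@ten_sec _ _ _ F G H U X).
    exact: ten_induced UP X.
  exists (ten_sec_obj axioms GG HH UP X).
  exact: fplus_fmap_cls.
- exists (fun F F' phi => fplus_nat_trans axioms phi); split.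
  + move=> F F' phi G GG X; exists (nat_sec_obj axioms phi GG (gm_obj X)).
    exact: fplus_ncomp_cls.
  + move=> F; apply: fplus_nat_eq => G GG A; rewrite [LHS](fplus_ncomp_cls axioms _ GG).
    rewrite -[RHS]/(gcls A); case: A => X [S s sP].
    exact/gcls_iso/sec_gamma_iso.
  + move=> F F' F'' phi psi; apply: fplus_nat_eq => G GG A.
    rewrite [LHS](fplus_ncomp_cls axioms _ GG) /=.
    by rewrite !(fplus_ncomp_cls axioms _ GG); exact/gcls_iso/sec_gamma_iso.
  + move=> F F' phi psi; apply: fplus_nat_eq => G GG A.
    rewrite [LHS](fplus_ncomp_cls axioms _ GG) /=.
    rewrite !(fplus_ncomp_cls axioms _ GG) -gcls_add.
    exact/gcls_iso/sec_gamma_iso.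
  + move=> F F' phi r; apply: fplus_nat_eq => G GG A.
    rewrite [LHS](fplus_ncomp_cls axioms _ GG) /=.
    rewrite !(fplus_ncomp_cls axioms _ GG) fplus_scaleE.
    exact/gcls_iso/sec_gamma_iso.
- move=> F G GG; exists (@coinv_fplus _ _ axioms _ F _ GG); first exact: coinv_fplus_bij.
  move=> H sH HH a; have HS : in_sigma cG H by [].
  exists (coset_sec HS a); first exact: coset_sec_base.
  exists (coset_sec_obj axioms GG HS a).
  by rewrite /= coinv_fplus_cls dsum_fplus_dinj // (zclsE axioms GG HS).
Qed.
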